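(* (1) The space $\Lambda^\circ$ decomposes (algebraically) into a direct sum of eigenspaces of $A_{z,z'}$, and this decomposition is orthogonal with respect to the inner product $(f,g)_{z,z'}=\int_\Omega f(\omega)g(\omega)P_{z,z'}(d\omega)$. (2) The set of eigenvalues (spectrum) of $A_{z,z'}$ is $\{0\}\cup\{-\sigma_m:m=2,3,\dots\}$, where $\sigma_m=m(m-1+zz')$. (3) The eigenvalue $0$ is simple, and the multiplicity of $-\sigma_m$ equals the number of partitions of $m$ without parts equal to $1$.
   Context: Young diagrams: $\mathbb Y_n$ is the set of Young diagrams with $n$ boxes; $\mu\nearrow\lambda$ means $\mu\subset\lambda$, $|\lambda|=|\mu|+1$; $(z)_\theta=\prod_{(i,j)\in\theta}(z+j-i)$ for a (skew) diagram $\theta$ ($(i,j)$ = row $i$, column $j$), $(z)_n=z(z+1)\cdots(z+n-1)$; $\dim\lambda$ = number of standard Young tableaux of shape $\lambda$. Modified Frobenius coordinates $\lambda=(a_1,\dots,a_d\mid b_1,\dots,b_d)$: $d$ the number of diagonal boxes, $a_i=\lambda_i-i+\frac12$, $b_i=\lambda'_i-i+\frac12$. $(z,z')$ is fixed in the principal series ($z\notin\mathbb R$, $z'=\bar z$) or complementary series ($z,z'\in(N,N+1)$, $N\in\mathbb Z$); then $zz'>0$. The z-measure on $\mathbb Y_n$ is $M_n(\lambda)=\frac{(z)_\lambda(z')_\lambda}{(zz')_n}\frac{(\dim\lambda)^2}{n!}$. Thoma simplex $\Omega$: pairs $\omega=(\alpha,\beta)$ of nonincreasing sequences of nonnegative reals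 with $\sum_i(\alpha_i+\beta_i)\le1$ (compact in the product topology); $\iota_n:\mathbb Y_n\to\Omega$, $\alpha_i=a_i/n$, $\beta_i=b_i/n$ ($i\le d$), 0 otherwise. The boundary z-measure $P_{z,z'}$ is the weak limit (which exists) of the push-forwards $\iota_n(M_n)$. $\Lambda=\mathbb R[p_1,p_2,\dots]$ is the algebra of symmetric functions with Schur functions $s_\mu$; $\Lambda^\circ=\Lambda/(p_1-1)$, realized as functions on $\Omega$ via $p_1^\circ=1$, $p_k^\circ(\omega)=\sum_i\alpha_i^k+(-1)^{k-1}\sum_i\beta_i^k$ ($k\ge2$). $A_{z,z'}:\Lambda^\circ\to\Lambda^\circ$ is the linear operator $A_{z,z'}s^\circ_\mu=-m(m-1+zz')s^\circ_\mu+\sum_{\mu_\bullet\nearrow\mu}(z)_{\mu/\mu_\bullet}(z')_{\mu/\mu_\bullet}s^\circ_{\mu_\bullet}$, $m=|\mu|$ (the pre-generator of the limit of the up–down Markov chains). *)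

(* Defs.v *)
From HB Require Import structures.
From mathcomp Require Import all_boot all_order all_algebra.
From mathcomp Require Import all_classical all_reals all_analysis.
From mathcomp Require Import Rstruct Rstruct_topology.
From mathcomp Require Import complex.

Set Implicit Arguments.
Unset Strict Implicit.
Unset Printing Implicit Defensive.

Import Order.TTheory GRing.Theory Num.Theory.
Local Open Scope classical_set_scope.
Local Open Scope ring_scope.

Notation R := Rdefinitions.R.
Notation C := (complex.complex R).

Definition is_part (mu : seq nat) : bool :=
  sorted geq mu && all (fun x => 0 < x)%N mu.

(* Y_n is enumerated through n-tuples (row lengths padded with zeros):
   a tuple t : n.-tuple 'I_n.+1 codes a diagram with n boxes iff it is
   nonincreasing and its entries sum to n; the diagram is tup_rows t. *)
Definition isY (n : nat) (t : n.-tuple 'I_n.+1) : bool :=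
  sorted geq (map val t) && (sumn (map val t) == n).

Definition tup_rows (n : nat) (t : n.-tuple 'I_n.+1) : seq nat :=
  [seq x <- map val t | (0 < x)%N].

Definition subdiag (nu mu : seq nat) : bool :=
  all (fun i => nth 0 nu i <= nth 0 mu i)%N (iota 0 (size nu)).

(* (x)_theta for the skew diagram theta = mu / nu:
   product over the boxes (i,j) (row i, column j, 1-based) of mu not in nu
   of (x + j - i). *)
Definition skew_poch (x : C) (mu nu : seq nat) : C :=
  \prod_(r < size mu)
    \prod_((nth 0 nu r).+1 <= j < (nth 0 mu r).+1) (x + j%:R - (r.+1)%:R).

Definition poch (x : C) (lam : seq nat) : C := skew_poch x lam [::].

Definition rising (x : C) (n : nat) : C := \prod_(i < n) (x + i%:R).

(* standard Young tableaux of shape lam (with n = |lam| boxes), stored as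
   functions T on 'I_n * 'I_n (row, column; 0-based) with values in
   {0,...,n}: T > 0 exactly on the boxes of lam, T is injective on the
   boxes (hence a bijection onto {1,...,n}), and T increases along rows
   and down columns. *)
Definition is_syt (lam : seq nat) (T : {ffun 'I_(sumn lam) * 'I_(sumn lam)
                                        -> 'I_(sumn lam).+1}) : bool :=
  let B := ('I_(sumn lam) * 'I_(sumn lam))%type in
  [forall rc : B, ((rc.2 < nth 0 lam rc.1)%N == (0 < T rc)%N)] &&
  [forall rc : B, forall rc' : B,
     ((0 < T rc)%N && (T rc == T rc')) ==> (rc == rc')] &&
  [forall rc : B, forall rc' : B,
     [&& (0 < T rc)%N, (0 < T rc')%N, rc.1 == rc'.1 & (rc.2 < rc'.2)%N]
       ==> (T rc < T rc')%N] &&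
  [forall rc : B, forall rc' : B,
     [&& (0 < T rc)%N, (0 < T rc')%N, rc.2 == rc'.2 & (rc.1 < rc'.1)%N]
       ==> (T rc < T rc')%N].

Definition dimY (lam : seq nat) : nat := #|[pred T | @is_syt lam T]|.

Definition zmeas (z z' : C) (n : nat) (lam : seq nat) : C :=
  poch z lam * poch z' lam / rising (z * z') n
  * ((dimY lam) ^ 2)%:R / (n`!)%:R.

Definition admissible (z z' : C) : Prop :=
  (complex.Im z != 0 /\ z' = complex.conjc z) \/
  (exists N : int, complex.Im z = 0 /\ complex.Im z' = 0 /\
     N%:~R < complex.Re z < (N + 1)%:~R /\
     N%:~R < complex.Re z' < (N + 1)%:~R).

Definition Xamb := ({ptws nat -> R} * {ptws nat -> R})%type.

Definition Thoma : set Xamb :=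
  [set w | (forall i, 0 <= w.1 i) /\ (forall i, 0 <= w.2 i) /\
           (forall i, w.1 i.+1 <= w.1 i) /\ (forall i, w.2 i.+1 <= w.2 i) /\
           (forall N, \sum_(i < N) (w.1 i + w.2 i) <= 1)].

Lemma Thoma0 : ((fun _ => 0, fun _ => 0) : Xamb) \in Thoma.
Proof.
rewrite inE /=; do 4 (split; first by move=> *; rewrite ?lexx).
by move=> N; rewrite big1 ?ler01 // => i _; rewrite addr0.
Qed.

Definition Om : Type := set_type Thoma.
HB.instance Definition _ := Choice.on Om.
HB.instance Definition _ := Topological.copy Om (set_type Thoma).
Definition om0 : Om := @exist Xamb (fun x => x \in Thoma) _ Thoma0.
HB.instance Definition _ := isPointed.Build Om om0.

Definition OmB := g_sigma_algebraType (@open Om).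

Definition alpha (w : Om) : nat -> R := (val w).1.
Definition beta (w : Om) : nat -> R := (val w).2.

Definition dnum (lam : seq nat) : nat :=
  count (fun i => i < nth 0 lam i)%N (iota 0 (size lam)).
Definition colY (lam : seq nat) (i : nat) : nat :=
  count (fun x => i < x)%N lam.

(* alpha_{i+1} = a_{i+1}/n = (lambda_{i+1} - (i+1) + 1/2)/n, i < d *)
Definition iota_raw (n : nat) (lam : seq nat) : Xamb :=
  (fun i => if (i < dnum lam)%N
            then ((nth 0 lam i)%:R - i%:R - 2^-1) / n%:R else 0,
   fun i => if (i < dnum lam)%N
            then ((colY lam i)%:R - i%:R - 2^-1) / n%:R else 0).

(* iota_n (the point iota_raw n lam does lie in Thoma for lam in Y_n) *)
Definition iota_n (n : nat) (lam : seq nat) : Om :=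
  insubd om0 (iota_raw n lam).

(* the boundary z-measure: P is the weak limit of the push-forwards
   iota_n(M_n), i.e. for every continuous f on Omega,
   int f d(iota_n(M_n)) = sum_{lam in Y_n} M_n(lam) f(iota_n lam)
   converges to int f dP.  (M_n(lam) is real; we take its real part.) *)
Definition is_boundary_zmeasure (z z' : C) (P : probability OmB R) : Prop :=
  forall f : Om -> R, continuous f ->
    (fun n : nat => (\sum_(t : n.-tuple 'I_n.+1 | isY t)
        complex.Re (zmeas z z' n (tup_rows t)) * f (iota_n n (tup_rows t)))%:E)
      @ \oo --> (\int[P]_w (f w)%:E)%E.

Definition pcirc (k : nat) (w : Om) : R :=
  if k == 1%N then 1 else
  limn (series (fun i => alpha w i ^+ k))
  + (-1) ^+ k.-1 * limn (series (fun i => beta w i ^+ k)).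

(* complete homogeneous h_0..h_k from power sums via Newton's identities
   k h_k = sum_{i=1}^k p_i h_{k-i} *)
Fixpoint hseq (p : nat -> R) (k : nat) : seq R :=
  match k with
  | 0 => [:: 1]
  | k'.+1 => let s := hseq p k' in
      rcons s ((k'.+1)%:R^-1 *
               \sum_(1 <= i < k'.+2) p i * nth 0 s (k'.+1 - i))
  end.
Definition hfun (p : nat -> R) (k : nat) : R := nth 0 (hseq p k) k.

(* Schur function s_mu^circ via Jacobi-Trudi: det [h_{mu_i - i + j}] *)
Definition schur0 (mu : seq nat) (w : Om) : R :=
  \det (\matrix_(i < size mu, j < size mu)
          (if (i <= nth 0 mu i + j)%N
           then hfun (pcirc ^~ w) (nth 0 mu i + j - i) else 0)).

Definition valid (l : seq (R * seq nat)) : bool := all (fun x => is_part x.2) l.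
Definition ev (l : seq (R * seq nat)) : Om -> R :=
  fun w => \sum_(x <- l) x.1 * schur0 x.2 w.

Definition Lam0 : set (Om -> R) := [set f | exists l, valid l /\ f = ev l].

Definition sigmaz (z z' : C) (m : nat) : R :=
  m%:R * (m%:R - 1 + complex.Re (z * z')).

Definition Aschur (z z' : C) (mu : seq nat) (w : Om) : R :=
  - sigmaz z z' (sumn mu) * schur0 mu w
  + \sum_(t : (sumn mu).-1.-tuple 'I_(sumn mu).-1.+1 |
            isY t && (0 < sumn mu)%N && subdiag (tup_rows t) mu)
      complex.Re (skew_poch z mu (tup_rows t) * skew_poch z' mu (tup_rows t))
      * schur0 (tup_rows t) w.

Definition Aev (z z' : C) (l : seq (R * seq nat)) : Om -> R :=
  fun w => \sum_(x <- l) x.1 * Aschur z z' x.2 w.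

Definition eigsp (z z' : C) (lam : R) : set (Om -> R) :=
  [set f | exists l, valid l /\ f = ev l /\ Aev z z' l = (fun w => lam * f w)].

Definition spectrum (z z' : C) : set R :=
  [set lam | exists f, eigsp z z' lam f /\ f <> (fun=> 0)].

Definition has_dim (E : set (Om -> R)) (d : nat) : Prop :=
  exists g : 'I_d -> Om -> R,
    (forall c : 'I_d -> R,
       (fun w => \sum_(i < d) c i * g i w) = (fun=> 0) -> forall i, c i = 0) /\
    E = [set f | exists c : 'I_d -> R, f = (fun w => \sum_(i < d) c i * g i w)].

Definition npart_no1 (m : nat) : nat :=
  #|[pred t : m.-tuple 'I_m.+1 | isY t && all (fun x => x != 1%N) (map val t)]|.

(* Main.v *)
(* Identify a diagram mu with |mu| = M with its Schur function on Omega. Since p_1 = 1,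
   Pieri's rule gives s_mu = sum of s_nu over nu covering mu, so the spans V_M of the
   Schur functions of level M form an increasing filtration with union Lambda^circ, and
   A + sigma_M maps V_M into V_{M-1}. A commutation relation between adding and removing
   boxes makes A well defined on the union. The Schur functions of one level are linearly
   independent on Omega: at points alpha = 0, beta_i = t^(b_i) / S with a suitable strictly
   concave exponent sequence the Jacobi-Trudi determinants have pairwise distinct degrees
   in t. As the sigma_m are distinct, linear algebra on the filtration gives the
   decomposition, the spectrum and the multiplicities dim V_m - dim V_{m-1}.

   Orthogonality: on Y_n the relative dimensions dim(mu, lambda) / dim lambda converge to
   s_mu with error O(1/n), uniformly in lambda. This is seen by writing them as determinants
   of divided differences in the rows of lambda, whose entries obey a two-term recurrence with
   boundary values the complete functions of the Frobenius coordinates. On these functions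
   the discrete analogue of A is exactly symmetric for M_n, because one step up and one step
   down are mutually reversible. Hence (l1 - l2) sum_lambda M_n(lambda) f g = O(1/n) for
   eigenfunctions f, g, and the limit vanishes. *)
Require Import Defs.
From HB Require Import structures.
From mathcomp Require Import all_boot all_order all_algebra.
From mathcomp Require Import all_classical all_reals all_analysis.
From mathcomp Require Import Rstruct Rstruct_topology complex.
From mathcomp Require Import perm zify ring lra.
Set Implicit Arguments.
Unset Strict Implicit.
Unset Printing Implicit Defensive.
Import Order.TTheory GRing.Theory Num.Theory.
Local Open Scope classical_set_scope.
Local Open Scope ring_scope.

Import numFieldNormedType.Exports.

(** * Young diagrams and the Young graph *)

Section Partitions.
Local Open Scope nat_scope.
Implicit Types (lam mu nu : seq nat) (f : nat -> nat).

(** One formalism serves both sides of the limit. If E (x+1) j = E x (j+1) + c x * E x j, then the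
    determinants with row indices x = mu_i + N - i obey Pieri's rule, with a factor read off from c.
    For c = 0 these are Schur functions; for c x = n + 1/2 - x they are shifted Schur functions at
    lam, which Pieri and a vanishing property identify with relative dimensions. The centre n + 1/2
    does two things. Near x = n the coefficient c x stays bounded, so after scaling by n the second
    recurrence degenerates to the first with error O(1/n). And the power sums of the rows centred
    there, minus those of the empty diagram, are the signed power sums of the Frobenius coordinates.
    Uniformity in lam comes from |h_k| <= 1 on Omega.

    The algebra rests on one identity: (z + x)(z' + x) is monic quadratic in the content x, so its
    sum over addable places minus its sum over removable boxes is zz' + 2m, which is sigma_(m+1) -
    sigma_m.

    An eigenfunction is given through some list of coefficients, possibly of mixed levels; Pieri
    lifts the list to one level, where independence makes the coefficient vector unique. *)

Lemma is_part_gt0 mu i : is_part mu -> (0 < nth 0 mu i) = (i < size mu).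
Proof.
case/andP=> _ /allP h; case: (ltnP i) => hi; last by rewrite nth_default.
by apply: h; rewrite mem_nth.
Qed.

Lemma is_part_nonincr mu i j : is_part mu -> i <= j -> nth 0 mu j <= nth 0 mu i.
Proof.
case/andP=> hs _ hij; have [hj|hj] := ltnP j (size mu); last by rewrite nth_default.
apply: (@sorted_leq_nth _ geq _ _ 0 mu hs) => //.
- by move=> a b c /= h1 h2; apply: leq_trans h2 h1.
- by move=> a /=.
- by rewrite inE (leq_ltn_trans hij).
Qed.

Lemma is_part_ext mu nu : is_part mu -> is_part nu ->
  (forall i, nth 0 mu i = nth 0 nu i) -> mu = nu.
Proof.
move=> hm hn h; apply: (@eq_from_nth _ 0) => // .
apply/eqP; rewrite eqn_leq; apply/andP; split; rewrite leqNgt; apply/negP.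
  by rewrite -(is_part_gt0 _ hm) h nth_default.
by rewrite -(is_part_gt0 _ hn) -h nth_default.
Qed.

Lemma sumn_nth mu K : size mu <= K -> sumn mu = \sum_(i < K) nth 0 mu i.
Proof.
elim: mu K => [|x mu IH] K /=.
  by move=> _; rewrite big1 // => i _; rewrite nth_nil.
by case: K => // K hK; rewrite big_ord_recl /= (IH K).
Qed.

Lemma is_part_size mu : is_part mu -> size mu <= sumn mu.
Proof.
case/andP=> _; elim: mu => //= x mu IH /andP[hx hm].
by rewrite -add1n leq_add // IH.
Qed.

Lemma nth_le_sumn mu i : nth 0 mu i <= sumn mu.
Proof.
elim: mu i => [|x mu IH] [|i] //=; first by rewrite leq_addr.
by apply: leq_trans (IH i) _; rewrite leq_addl.
Qed.

Definition ofrows K f := [seq x <- mkseq f K | 0 < x].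

Lemma ofrows_part K f : (forall i, f i.+1 <= f i) -> is_part (ofrows K f).
Proof.
move=> hf; rewrite /is_part /ofrows filter_all andbT sorted_filter //.
  by move=> a b c /= h1 h2; apply: leq_trans h2 h1.
rewrite /mkseq sorted_map.
apply: (@sub_sorted _ ltn); last exact: iota_ltn_sorted.
move=> a b /=; elim: b => // b IH; rewrite ltnS leq_eqVlt => /orP[/eqP->|/IH h].
  exact: hf.
exact: leq_trans (hf b) h.
Qed.

Lemma nth_ofrows K f i : (forall i, f i.+1 <= f i) -> f K = 0 ->
  nth 0 (ofrows K f) i = f i.
Proof.
move=> hf; have hm a b : a <= b -> f b <= f a.
  move=> /subnKC <-; elim: (b - a) => [|k IH]; first by rewrite addn0.
  by rewrite addnS; apply: leq_trans (hf _) IH.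
rewrite /ofrows => f0; have hK a : K <= a -> f a = 0.
  by move=> h; apply/eqP; rewrite -leqn0 -f0 hm.
suff: forall s, nth 0 [seq x <- [seq f i | i <- iota s K] | 0 < x] i =
   if s + i < s + K then f (s + i) else 0.
  move=> /(_ 0); rewrite !add0n /mkseq => ->; case: ltnP => // h; by rewrite hK.
move: i; clear f0 hK; elim: K => [|K IH] i s /=.
  by rewrite nth_nil addn0 ltnNge leq_addr.
case: ltnP => hfs /=.
  case: i => [|i] /=; first by rewrite addn0 addnS ltnS leq_addr.
  by rewrite IH !addnS !addSn !ltnS.
rewrite IH; case: ltnP => h1; case: ltnP => h2 //.
- apply/eqP; rewrite eqn_leq; apply/andP; split.
    apply: leq_trans (hm s _ _) _; [by rewrite addSn ltnW // ltnS leq_addr|].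
    by apply: leq_trans hfs _.
  by apply: leq_trans (hm s _ _) (leq_trans hfs _); [rewrite leq_addr|].
- apply/eqP; rewrite eqn_leq leq0n andbT.
  by apply: leq_trans (hm s _ _) hfs; rewrite addSn ltnW // ltnS leq_addr.
- apply/esym/eqP; rewrite eqn_leq leq0n andbT.
  by apply: leq_trans (hm s _ _) hfs; rewrite leq_addr.
Qed.

Lemma sumn_ofrows K f : sumn (ofrows K f) = \sum_(i < K) f i.
Proof.
rewrite /ofrows sumnE big_filter big_map -(big_mkord xpredT f) /index_iota subn0.
rewrite big_mkcond; apply: eq_bigr => i _; by case: (f i).
Qed.

Lemma subdiagP nu mu :
  reflect (forall i, nth 0 nu i <= nth 0 mu i) (subdiag nu mu).
Proof.
apply: (iffP allP) => h i; last by move=> _; apply: h.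
case: (ltnP i (size nu)) => hi; last by rewrite nth_default.
by apply: h; rewrite mem_iota.
Qed.

Definition Yn (n : nat) : seq (seq nat) :=
  [seq tup_rows t | t <- enum [pred t : n.-tuple 'I_n.+1 | isY t]].

Lemma tup_rowsE n (t : n.-tuple 'I_n.+1) i : isY t ->
  nth 0 (tup_rows t) i = nth 0 (map val t) i.
Proof.
case/andP=> hs _; set s := map _ _ in hs *.
have hf j : nth 0 s j.+1 <= nth 0 s j.
  have [hj|hj] := ltnP j.+1 (size s); last by rewrite nth_default.
  apply: (@sorted_leq_nth _ geq _ _ 0 s hs) => //.
  - by move=> a b c /= h1 h2; apply: leq_trans h2 h1.
  - by move=> a /=.
  - by rewrite inE /=; lia.
rewrite -[RHS](@nth_ofrows (size s) (nth 0 s) i hf); last by rewrite nth_default.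
by rewrite /ofrows mkseq_nth.
Qed.

Lemma tup_rows_part n (t : n.-tuple 'I_n.+1) : isY t ->
  is_part (tup_rows t) && (sumn (tup_rows t) == n).
Proof.
case/andP=> hs hn; rewrite /is_part /tup_rows filter_all andbT sorted_filter //=.
  have -> // : forall s, sumn [seq x <- s | 0 < x] = sumn s.
  by elim=> //= x s <-; case: x => //= x; rewrite add0n.
by move=> a b c /= h1 h2; apply: leq_trans h2 h1.
Qed.

Lemma mem_Yn n lam : (lam \in Yn n) = is_part lam && (sumn lam == n).
Proof.
apply/mapP/idP => [[t]|/andP[hl /eqP hn]].
  by rewrite mem_enum inE => ht ->; apply: tup_rows_part.
pose t : n.-tuple 'I_n.+1 := [tuple inord (nth 0 lam i) | i < n].
have ts : map val t = mkseq (nth 0 lam) n.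
  rewrite /= -map_comp /mkseq -val_enum_ord -map_comp; apply: eq_map => i /=.
  rewrite inordK // ltnS; apply: leq_trans (nth_le_sumn _ _) _; by rewrite hn.
have tl : tup_rows t = lam.
  rewrite /tup_rows ts; apply: is_part_ext => //.
    by apply: ofrows_part => i; apply: is_part_nonincr.
  move=> i; apply: nth_ofrows => [j|]; first exact: is_part_nonincr.
  by rewrite nth_default // -hn is_part_size.
have tY : isY t.
  rewrite /isY ts; apply/andP; split.
    rewrite /mkseq sorted_map; apply: (@sub_sorted _ ltn); last exact: iota_ltn_sorted.
    by move=> a b /= /ltnW; apply: is_part_nonincr.
  rewrite sumnE big_map -{1}(subn0 n) big_mkord -(@sumn_nth lam n) ?hn //.
  by rewrite -hn is_part_size.
by exists t => //; rewrite mem_enum.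
Qed.

Lemma Yn_uniq n : uniq (Yn n).
Proof.
rewrite map_inj_in_uniq ?enum_uniq // => t u; rewrite !mem_enum !inE => ht hu htu.
apply/val_inj/(inj_map val_inj)/(@eq_from_nth _ 0); first by rewrite !size_map !size_tuple.
by move=> i _; rewrite -!tup_rowsE // htu.
Qed.

Lemma sum_isY (V : nmodType) n (P : pred (seq nat)) (F : seq nat -> V) :
  (\sum_(t : n.-tuple 'I_n.+1 | isY t && P (tup_rows t)) F (tup_rows t) =
   \sum_(lam <- Yn n | P lam) F lam)%R.
Proof. by rewrite /Yn big_map big_enum_cond. Qed.

Lemma is_part_incr mu i : is_part mu ->
  (i == 0) || (nth 0 mu i < nth 0 mu i.-1) -> is_part (incr_nth mu i).
Proof.
move=> hm hi; have hs : i <= size mu.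
  case/orP: hi => [/eqP->//|hi]; rewrite leqNgt; apply/negP => h.
  by move: hi; rewrite !nth_default //; lia.
suff -> : incr_nth mu i = ofrows (size mu).+1 (fun j => nth 0 (incr_nth mu i) j).
  apply: ofrows_part => j; rewrite !nth_incr_nth.
  case: (i =P j.+1) => [ij|_].
    by move: hi; rewrite ij /= gtn_eqF // add1n add0n.
  rewrite add0n; apply: leq_trans (leq_addl _ _); exact: is_part_nonincr.
rewrite /ofrows.
have hsz : size (incr_nth mu i) <= (size mu).+1.
  by rewrite size_incr_nth; case: ifP.
have hall : all (fun x => 0 < x) (incr_nth mu i).
  apply/(all_nthP 0) => j; rewrite size_incr_nth nth_incr_nth.
  case: eqVneq => // hij; rewrite add0n is_part_gt0 //.
  case: ifP => // _; rewrite ltnS => hji; rewrite (leq_trans _ hs) //.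
  by rewrite ltn_neqAle eq_sym hij.
rewrite -(subnKC hsz) /mkseq iotaD map_cat filter_cat -/(mkseq _ _) mkseq_nth.
rewrite (all_filterP hall) (@eq_in_filter _ _ pred0) ?filter_pred0 ?cats0 //.
move=> x /mapP[j]; rewrite mem_iota add0n => /andP[hj _] ->.
by rewrite nth_default.
Qed.

Lemma sumn_incr mu i : sumn (incr_nth mu i) = (sumn mu).+1.
Proof. by elim: mu i => [|x mu IH] [|i] //=; [elim: i => //= i ->|rewrite IH addnS]. Qed.

Lemma cover_incr mu nu : is_part mu -> is_part nu -> subdiag mu nu ->
  sumn nu = (sumn mu).+1 ->
  exists2 i, (i == 0) || (nth 0 mu i < nth 0 mu i.-1) & nu = incr_nth mu i.
Proof.
move=> hm hn /subdiagP hs hsum.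
pose K := maxn (size mu) (size nu).
have hsm := @sumn_nth mu K (leq_maxl _ _).
have hsn := @sumn_nth nu K (leq_maxr _ _).
have [i hi]: exists i : 'I_K, nth 0 mu i < nth 0 nu i.
  apply/existsP; apply: contraT => /existsPn h.
  have : sumn nu = sumn mu.
    rewrite hsm hsn; apply: eq_bigr => i _; apply/eqP; rewrite eqn_leq hs andbT.
    by rewrite leqNgt h.
  by rewrite hsum => /esym/n_Sn.
have hincr : forall j, nth 0 nu j = nth 0 (incr_nth mu i) j.
  have hb : forall j : 'I_K, nth 0 nu j = (i == j :> nat) + nth 0 mu j.
    move: hsum; rewrite hsm hsn (bigD1 i) //= [in X in _ = X -> _](bigD1 i) //=.
    set A := \sum_(_ < _ | _) _; set B := \sum_(_ < _ | _) _ => hAB.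
    have BA : B <= A by apply: leq_sum.
    have hii : nth 0 nu i = (nth 0 mu i).+1 by lia.
    have AB : A = B by lia.
    move=> j; have [->|hj] := eqVneq j i; first by rewrite eqxx hii.
    rewrite eq_sym (negPf (hj : val j != val i)) add0n.
    apply/eqP; rewrite eqn_leq hs andbT.
    have := AB; rewrite /A /B (bigD1 j) //= [in X in _ = X](bigD1 j) //=.
    set A' := \sum_(_ < _ | _) _; set B' := \sum_(_ < _ | _) _.
    have : B' <= A' by apply: leq_sum.
    lia.
  move=> j; rewrite nth_incr_nth; have [hj|hj] := ltnP j K; first exact: (hb (Ordinal hj)).
  rewrite !nth_default ?(leq_trans _ hj) ?leq_maxl ?leq_maxr // addn0.
  by rewrite ltn_eqF // (leq_trans (ltn_ord i)).
have hcond : ((i : nat) == 0) || (nth 0 mu i < nth 0 mu i.-1).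
  case: (posnP i) => [//|i0] /=; have := hincr i; have := hincr i.-1.
  rewrite !nth_incr_nth eqxx gtn_eqF ?prednK // add0n add1n => <- <-.
  by apply: is_part_nonincr => //; rewrite leq_pred.
exists (i : nat) => //; apply: is_part_ext => //.
exact: is_part_incr.
Qed.

(** The bound on K is strict because a new box may open the row [size mu]. *)
Lemma sum_up (V : nmodType) mu K (g : seq nat -> V) : is_part mu -> size mu < K ->
  (\sum_(nu <- Yn (sumn mu).+1 | subdiag mu nu) g nu =
   \sum_(i < K | (i == 0 :> nat) || (nth 0 mu i < nth 0 mu i.-1)%N) g (incr_nth mu i))%R.
Proof.
move=> hm hK; rewrite -big_filter.
rewrite -(big_mkord (fun i => (i == 0) || (nth 0 mu i < nth 0 mu i.-1))
  (fun i => g (incr_nth mu i))) -[RHS]big_filter.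
rewrite -[RHS](big_map (incr_nth mu) xpredT); apply: perm_big; apply: uniq_perm.
- exact/filter_uniq/Yn_uniq.
- by rewrite map_inj_uniq ?filter_uniq ?iota_uniq //; apply: incr_nth_inj.
move=> nu; rewrite mem_filter mem_Yn; apply/idP/mapP.
  case/and3P=> h1 h2 /eqP h3; have [i hi ->] := cover_incr hm h2 h1 h3.
  exists i => //; rewrite mem_filter hi /= mem_index_iota /=.
  apply: leq_ltn_trans hK; case/orP: hi => [/eqP->//|hi].
  rewrite leqNgt; apply/negP => h.
  by move: hi; rewrite !nth_default //; lia.
case=> i; rewrite mem_filter => /andP[hi _] ->.
rewrite is_part_incr // sumn_incr eqxx !andbT; apply/subdiagP => j.
by rewrite nth_incr_nth leq_addl.
Qed.

Definition decr mu i := ofrows (size mu) (fun j => nth 0 mu j - (i == j)).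

Lemma decr_ok mu i : is_part mu -> nth 0 mu i.+1 < nth 0 mu i ->
  [/\ is_part (decr mu i), forall j, nth 0 (decr mu i) j = nth 0 mu j - (i == j)
    & incr_nth (decr mu i) i = mu].
Proof.
move=> hm hi; pose f j := nth 0 mu j - (i == j).
have hf j : f j.+1 <= f j.
  rewrite /f; case: (i =P j) => [ij|_].
    by subst j; lia.
  by rewrite subn0; apply: leq_trans (leq_subr _ _) _; apply: is_part_nonincr.
have hp : is_part (decr mu i) by apply: ofrows_part.
have hn j : nth 0 (decr mu i) j = f j.
  by apply: nth_ofrows => //; rewrite /f nth_default.
have e : forall j, nth 0 (incr_nth (decr mu i) i) j = nth 0 mu j.
  move=> j; rewrite nth_incr_nth hn /f; case: eqP => [<-|_] /=; last by rewrite subn0.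
  by rewrite add1n subn1 (ltn_predK hi).
split=> //; apply: is_part_ext => //; apply: is_part_incr => //.
case: (posnP i) => //= i0; rewrite !hn /f eqxx gtn_eqF ?subn0 ?subn1 //.
  by apply: leq_trans (is_part_nonincr hm (leq_pred i)); rewrite (ltn_predK hi).
by rewrite (ltn_predK i0).
Qed.

Lemma sum_down (V : nmodType) mu n K (g : seq nat -> V) : is_part mu ->
  sumn mu = n.+1 -> size mu <= K ->
  (\sum_(nu <- Yn n | subdiag nu mu) g nu =
   \sum_(i < K | (nth 0 mu i.+1 < nth 0 mu i)%N) g (decr mu i))%R.
Proof.
move=> hm hn hK; rewrite -big_filter.
rewrite -(big_mkord (fun i => nth 0 mu i.+1 < nth 0 mu i)
  (fun i => g (decr mu i))) -[RHS]big_filter.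
rewrite -[RHS](big_map (decr mu) xpredT); apply: perm_big; apply: uniq_perm.
- exact/filter_uniq/Yn_uniq.
- rewrite map_inj_in_uniq ?filter_uniq ?iota_uniq // => i j.
  rewrite !mem_filter => /andP[hi _] /andP[hj _] e.
  have [_ n1 _] := decr_ok hm hi; have [_ n2 _] := decr_ok hm hj.
  have := n1 i; rewrite e n2 eqxx; case: (j =P i) => // _; lia.
move=> nu; rewrite mem_filter mem_Yn; apply/idP/mapP.
  case/and3P=> h1 h2 /eqP h3; have [|i hi e] := cover_incr h2 hm h1.
    by rewrite hn h3.
  have hmi : nth 0 mu i.+1 < nth 0 mu i.
    by rewrite e !nth_incr_nth eqxx ltn_eqF // add0n add1n ltnS is_part_nonincr.
  have [p1 n1 e1] := decr_ok hm hmi.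
  exists i.
    rewrite mem_filter hmi mem_index_iota /= (leq_trans _ hK) //.
    by rewrite -(is_part_gt0 _ hm); apply: leq_ltn_trans hmi.
  apply: is_part_ext => // j; rewrite n1 e nth_incr_nth; lia.
case=> i; rewrite mem_filter => /andP[hi _] ->.
have [p1 n1 e1] := decr_ok hm hi.
rewrite p1 /=; apply/andP; split.
  by apply/subdiagP => j; rewrite n1 leq_subr.
by rewrite -eqSS -(sumn_incr _ i) e1 hn.
Qed.

End Partitions.

(** * Commutation of adding and removing boxes *)

Section Commutation.
Variable F : realFieldType.
Implicit Types (lam mu nu rho tau kap : seq nat).

Lemma big_seq_only (I : eqType) (V : nmodType) (r : seq I) (x : I) (P : pred I) (G : I -> V) :
  uniq r -> x \in r -> P x -> (forall y, y \in r -> P y -> y = x) ->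
  \sum_(y <- r | P y) G y = G x.
Proof.
move=> ur xr Px h; rewrite big_mkcond (bigD1_seq x) //= Px big1_seq ?addr0 //.
move=> y /andP[/eqP yx yr]; case: ifP => // Py; by case: yx; apply: h.
Qed.

Lemma big_seq_none (I : eqType) (V : nmodType) (r : seq I) (P : pred I) (G : I -> V) :
  (forall y, y \in r -> ~~ P y) -> \sum_(y <- r | P y) G y = 0.
Proof.
move=> h; rewrite big_seq_cond big_pred0 // => y; apply/negP => /andP[yr].
exact/negP/h.
Qed.

Lemma subdiag_sumn mu nu : subdiag mu nu -> (sumn mu <= sumn nu)%N.
Proof.
move=> /subdiagP h; rewrite (@sumn_nth mu (maxn (size mu) (size nu))) ?leq_maxl //.
rewrite (@sumn_nth nu (maxn (size mu) (size nu))) ?leq_maxr //.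
exact: leq_sum.
Qed.

Lemma subdiag_eq mu nu : is_part mu -> is_part nu -> subdiag mu nu ->
  (sumn nu <= sumn mu)%N -> mu = nu.
Proof.
move=> hm hn hs hle; apply: is_part_ext => // i.
have /subdiagP h := hs.
pose K := maxn i.+1 (maxn (size mu) (size nu)).
have hsm := @sumn_nth mu K ltac:(rewrite /K; lia).
have hsn := @sumn_nth nu K ltac:(rewrite /K; lia).
have iK : (i < K)%N by rewrite /K; lia.
apply/eqP; rewrite eqn_leq h /=.
move: hle; rewrite hsm hsn (bigD1 (Ordinal iK)) //= [X in (_ <= X)%N](bigD1 (Ordinal iK)) //=.
set A := bigop _ _ _; set B := bigop _ _ _.
have : (B <= A)%N by apply: leq_sum.
lia.
Qed.

(** Union and intersection of two diagrams; [sumn mu + sumn rho] is simply a number of rows that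
    suffices for both. *)
Definition dmax mu rho := ofrows (sumn mu + sumn rho)
  (fun i => maxn (nth 0%N mu i) (nth 0%N rho i)).
Definition dmin mu rho := ofrows (sumn mu + sumn rho)
  (fun i => minn (nth 0%N mu i) (nth 0%N rho i)).

Lemma dmaxP mu rho : is_part mu -> is_part rho ->
  is_part (dmax mu rho) /\
  forall i, nth 0%N (dmax mu rho) i = maxn (nth 0%N mu i) (nth 0%N rho i).
Proof.
move=> hm hr; have h i : (maxn (nth 0 mu i.+1) (nth 0 rho i.+1) <=
    maxn (nth 0 mu i) (nth 0 rho i))%N.
  have := is_part_nonincr hm (leqnSn i); have := is_part_nonincr hr (leqnSn i); lia.
split; first exact: ofrows_part.
move=> i; apply: nth_ofrows => //.
have := is_part_size hm; have := is_part_size hr => h1 h2.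
by rewrite !nth_default //; lia.
Qed.

Lemma dminP mu rho : is_part mu -> is_part rho ->
  is_part (dmin mu rho) /\
  forall i, nth 0%N (dmin mu rho) i = minn (nth 0%N mu i) (nth 0%N rho i).
Proof.
move=> hm hr; have h i : (minn (nth 0 mu i.+1) (nth 0 rho i.+1) <=
    minn (nth 0 mu i) (nth 0 rho i))%N.
  have := is_part_nonincr hm (leqnSn i); have := is_part_nonincr hr (leqnSn i); lia.
split; first exact: ofrows_part.
move=> i; apply: nth_ofrows => //.
have := is_part_size hm; have := is_part_size hr => h1 h2.
by rewrite !nth_default //; lia.
Qed.

Lemma sumn_dmaxmin mu rho : is_part mu -> is_part rho ->
  (sumn (dmax mu rho) + sumn (dmin mu rho) = sumn mu + sumn rho)%N.
Proof.
move=> hm hr; rewrite !sumn_ofrows -big_split /=.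
have h2 := is_part_size hm; have h1 := is_part_size hr.
set K := (_ + _)%N.
rewrite [RHS](_ : _ = \sum_(i < K) nth 0 mu i + \sum_(i < K) nth 0 rho i)%N.
  by rewrite -big_split /=; apply: eq_bigr => i _; lia.
by rewrite -!sumn_nth //; rewrite /K; lia.
Qed.

Variables s tau0 : F.
Definition wc (x : F) := s + tau0 * x + x ^+ 2.

Definition cont lam r : F := (nth 0%N lam r)%:R - r%:R.

(* For [lam] one box below [kap] only the row of the added box contributes, and the
   weight is that of its content; this is (z)_{kap/lam} (z')_{kap/lam} when s = zz'
   and tau0 = z + z'. *)
Definition wt kap lam : F :=
  \sum_(r < size kap | (nth 0 lam r < nth 0 kap r)%N) wc (cont lam r).

Lemma wtE kap lam K : (size kap <= K)%N ->
  wt kap lam = \sum_(r < K | (nth 0 lam r < nth 0 kap r)%N) wc (cont lam r).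
Proof.
move=> h; rewrite /wt.
rewrite (big_ord_widen_cond _ (fun r => (nth 0 lam r < nth 0 kap r)%N)
   (fun r => wc (cont lam r)) h); apply: eq_bigl => r.
by case: (ltnP r (size kap)) => hr; rewrite ?andbT // (nth_default _ hr) ltn0.
Qed.

Lemma wt_incr lam i : wt (incr_nth lam i) lam = wc (cont lam i).
Proof.
have hi : (i < maxn (size (incr_nth lam i)) i.+1)%N by lia.
rewrite (@wtE _ _ (maxn (size (incr_nth lam i)) i.+1)) ?leq_maxl //.
rewrite (big_pred1 (Ordinal hi)) // => r; rewrite nth_incr_nth.
by rewrite inE -val_eqE /= eq_sym; case: eqP => _ /=; rewrite ?add1n ?ltnSn ?add0n ?ltnn.
Qed.

Lemma cover_telescope mu K : is_part mu -> (size mu < K)%N ->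
  \sum_(i < K | (i == 0 :> nat) || (nth 0 mu i < nth 0 mu i.-1)%N) wc (cont mu i) -
  \sum_(i < K | (nth 0 mu i.+1 < nth 0 mu i)%N) wc (cont mu i - 1) = s + 2 * (sumn mu)%:R.
Proof.
move=> hm hK; rewrite -[(size mu < K)%N]/(_ < _)%N in hK.
case: K hK => // K; rewrite ltnS => hK.
rewrite big_mkcond big_ord_recl /= [in X in _ - X]big_mkcond big_ord_recr /=.
rewrite (nth_default _ hK) ltn0 addr0 -addrA -sumrB.
have -> : \sum_(i < K) ((if (nth 0 mu i.+1 < nth 0 mu i)%N
      then wc (cont mu i.+1) else 0) -
    (if (nth 0 mu i.+1 < nth 0 mu i)%N then wc (cont mu i - 1) else 0))
   = \sum_(i < K) (wc (cont mu i.+1) - wc (cont mu i - 1)).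
  apply: eq_bigr => i _; case: ltnP => // h.
  have e : nth 0%N mu i = nth 0%N mu i.+1.
    by apply/eqP; rewrite eqn_leq h is_part_nonincr.
  by rewrite subr0 /cont e -natr1 opprD addrA subrr.
have step k : wc (cont mu 0) + \sum_(i < k) (wc (cont mu i.+1) - wc (cont mu i - 1))
   = wc (cont mu k) + \sum_(i < k) (tau0 + 2 * cont mu i - 1).
  elim: k => [|k IH]; first by rewrite !big_ord0.
  rewrite !big_ord_recr /= addrA IH /wc /=; set c := cont mu k; ring.
rewrite step {1}/cont nth_default // (sumn_nth hK) natr_sum mulr_sumr.
have -> : \sum_(i < K) (tau0 + 2 * cont mu i - 1) =
   \sum_(i < K) (2 * (nth 0%N mu i)%:R) + \sum_(i < K) (tau0 - 2 * i%:R - 1).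
  by rewrite -big_split /=; apply: eq_bigr => i _; rewrite /cont; ring.
have -> : \sum_(i < K) (tau0 - 2 * i%:R - 1) = K%:R * tau0 - K%:R ^+ 2.
  elim: {+}K => [|k IH]; first by rewrite big_ord0; ring.
  by rewrite big_ord_recr /= IH -natr1; ring.
rewrite /wc; ring.
Qed.

(** Distinct diagrams of one level have at most one common cover, their union, and at most one
    common predecessor, their intersection. Sizes add up, so both exist or neither does, and the box
    added to rho is the box removed from mu. The diagonal case is [cover_telescope]. The guard
    [0 < m] excludes m = 0, where [m.-1] is again 0. *)
Lemma commutation m mu rho : is_part mu -> is_part rho -> sumn mu = m -> sumn rho = m ->
  \sum_(nu <- Yn m.+1 | subdiag mu nu && subdiag rho nu) wt nu rho =
  \sum_(tau <- Yn m.-1 | (0 < m)%N && (subdiag tau mu && subdiag tau rho)) wt mu tau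
  + (if mu == rho then s + 2 * m%:R else 0).
Proof.
move=> hm hr em er; case: eqP => [e|ne].
  subst rho; under eq_bigl do rewrite andbb.
  rewrite -em (sum_up (fun nu => wt nu mu) hm (ltnSn (size mu))).
  rewrite -(cover_telescope hm (ltnSn (size mu))) addrC.
  under eq_bigr do rewrite wt_incr.
  apply/esym; rewrite -[RHS]addr0 -addrA; congr (_ + _); apply/eqP.
rewrite addrC subr_eq0; apply/eqP.
  case: (posnP (sumn mu)) => [m0|m0].
    rewrite big_pred0 // big_pred0 // => i.
    by have := nth_le_sumn mu i; rewrite m0 leqn0 => /eqP ->; rewrite ltn0.
  under eq_bigl do rewrite andbb.
  rewrite (sum_down (fun tau => wt mu tau) (mu:=mu) (K:=(size mu).+1)) ?prednK //.
  apply: eq_bigr => i hi; have [p1 n1 e1] := decr_ok hm hi.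
  rewrite -{1}e1 wt_incr /cont n1 eqxx subn1; congr wc.
  by rewrite -{2}(ltn_predK hi) -natr1; ring.
have [px nx] := dmaxP hm hr; have [pn nn] := dminP hm hr.
have sx := sumn_dmaxmin hm hr; rewrite em er in sx.
have smx : subdiag mu (dmax mu rho) by apply/subdiagP => i; rewrite nx leq_maxl.
have srx : subdiag rho (dmax mu rho) by apply/subdiagP => i; rewrite nx leq_maxr.
have smn : subdiag (dmin mu rho) mu by apply/subdiagP => i; rewrite nn geq_minl.
have srn : subdiag (dmin mu rho) rho by apply/subdiagP => i; rewrite nn geq_minr.
have hgt : (m < sumn (dmax mu rho))%N.
  rewrite ltnNge; apply/negP => h; apply: ne.
  have -> := subdiag_eq hm px smx; last by rewrite em.
  by apply/esym; apply: subdiag_eq => //; rewrite er.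
rewrite addr0; have [hx|hx] := eqVneq (sumn (dmax mu rho)) m.+1.
  have hn : sumn (dmin mu rho) = m.-1 by lia.
  have m0 : (0 < m)%N by lia.
  rewrite (@big_seq_only _ _ _ (dmax mu rho)) ?Yn_uniq ?mem_Yn ?px ?hx ?eqxx ?smx ?srx //; last first.
    move=> nu; rewrite mem_Yn => /andP[pnu /eqP nunu] /andP[/subdiagP h1 /subdiagP h2].
    apply/esym; apply: subdiag_eq => //; last by rewrite nunu hx.
    by apply/subdiagP => i; rewrite nx geq_max h1 h2.
  rewrite (@big_seq_only _ _ _ (dmin mu rho)) ?Yn_uniq ?mem_Yn ?pn ?hn ?eqxx ?smn ?srn ?m0 //; last first.
    move=> nu; rewrite mem_Yn => /andP[pnu /eqP nunu] /and3P[_ /subdiagP h1 /subdiagP h2].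
    apply: subdiag_eq => //; last by rewrite nunu hn.
    by apply/subdiagP => i; rewrite nn leq_min h1 h2.
  rewrite (@wtE _ _ (size (dmax mu rho) + size mu)) ?leq_addr //.
  rewrite (@wtE _ _ (size (dmax mu rho) + size mu)) ?leq_addl //.
  apply: eq_big => [r|r]; first by rewrite nx nn; lia.
  rewrite nx => h; rewrite /cont nn; congr (wc (_%:R - _)); lia.
rewrite !big_seq_none // => nu; rewrite mem_Yn => /andP[pnu /eqP nunu].
  apply/negP => /and3P[m0 /subdiagP h1 /subdiagP h2].
  have : subdiag nu (dmin mu rho) by apply/subdiagP => i; rewrite nn leq_min h1 h2.
  move/subdiag_sumn; lia.
apply/negP => /andP[/subdiagP h1 /subdiagP h2].
have : subdiag (dmax mu rho) nu by apply/subdiagP => i; rewrite nx geq_max h1 h2.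
move/subdiag_sumn; lia.
Qed.

End Commutation.

(** * Determinants of Jacobi-Trudi type *)

Section Determinants.
Variable F : comNzRingType.
Implicit Types (a : nat -> nat -> F).

Definition dmx N a : 'M[F]_N := \matrix_(i < N, j < N) a i j.
Definition dt N a : F := \det (dmx N a).

Lemma eq_dt N a b : (forall i j, (i < N)%N -> (j < N)%N -> a i j = b i j) -> dt N a = dt N b.
Proof. by move=> h; congr determinant; apply/matrixP => i j; rewrite !mxE h. Qed.

Lemma dt_last_row N a : (forall j, (j < N)%N -> a N j = 0) -> dt N.+1 a = a N N * dt N a.
Proof.
move=> h; rewrite /dt (expand_det_row _ ord_max) big_ord_recr /= big1 ?add0r; last first.
  by move=> j _; rewrite mxE /= h ?mul0r.
rewrite mxE /= /cofactor -signr_odd oddD addbb expr0 mul1r; congr (_ * \det _).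
by apply/matrixP => i j; rewrite !mxE /= /bump (leqNgt N i) (leqNgt N j) !ltn_ord.
Qed.

(* Padding a Jacobi-Trudi matrix by zero parts does not change its determinant. *)
Lemma dt_pad N M a : (N <= M)%N ->
  (forall i j, (N <= i)%N -> (j <= i)%N -> a i j = (i == j)%:R) -> dt M a = dt N a.
Proof.
move=> /subnKC <- h; elim: (M - N)%N => [|k IH]; first by rewrite addn0.
rewrite addnS dt_last_row; last by move=> j hj; rewrite h ?leq_addr ?gtn_eqF // ltnW.
by rewrite IH h ?leq_addr // eqxx mul1r.
Qed.

Lemma dt_row N a (i : 'I_N) (b : nat -> F) :
  dt N (fun k j => if k == i then b j else a k j) =
  \sum_(j < N) b j * cofactor (dmx N a) i j.
Proof.
rewrite /dt (expand_det_row _ i); apply: eq_bigr => j _; rewrite mxE eqxx.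
congr (_ * (_ * \det _)); apply/matrixP => k l; rewrite !mxE.
by rewrite (eq_sym _ (i : nat)) (negPf (neq_lift i k : (i : nat) != lift i k)).
Qed.

Lemma dt_col N a (j : 'I_N) (b : nat -> F) :
  dt N (fun k l => if l == j then b k else a k l) =
  \sum_(i < N) b i * cofactor (dmx N a) i j.
Proof.
rewrite /dt (expand_det_col _ j); apply: eq_bigr => i _; rewrite mxE eqxx.
congr (_ * (_ * \det _)); apply/matrixP => k l; rewrite !mxE.
by rewrite (eq_sym _ (j : nat)) (negPf (neq_lift j l : (j : nat) != lift j l)).
Qed.

Lemma dt_eq_rows N a i1 i2 : (i1 < N)%N -> (i2 < N)%N -> i1 != i2 ->
  (forall j, (j < N)%N -> a i1 j = a i2 j) -> dt N a = 0.
Proof.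
move=> h1 h2 ne h; apply: (@determinant_alternate _ _ _ (Ordinal h1) (Ordinal h2)) => //.
by move=> j; rewrite !mxE /= h.
Qed.

Lemma dt_eq_cols N a j1 j2 : (j1 < N)%N -> (j2 < N)%N -> j1 != j2 ->
  (forall i, (i < N)%N -> a i j1 = a i j2) -> dt N a = 0.
Proof.
move=> h1 h2 ne h; rewrite /dt -det_tr.
apply: (@determinant_alternate _ _ _ (Ordinal h1) (Ordinal h2)) => //.
by move=> j; rewrite !mxE /= h.
Qed.

Lemma dt_scale N a (r c : nat -> F) :
  dt N (fun i j => r i * a i j * c j) = (\prod_(i < N) r i) * (\prod_(j < N) c j) * dt N a.
Proof.
rewrite mulrAC /dt.
have -> : dmx N (fun i j => r i * a i j * c j) =
   diag_mx (\row_i r i) *m (dmx N a *m diag_mx (\row_j c j)).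
  by apply/matrixP => i j; rewrite mul_diag_mx mxE mul_mx_diag !mxE mulrA.
by rewrite !det_mulmx !det_diag mulrA; congr (_ * _ * _); apply: eq_bigr => i _; rewrite mxE.
Qed.

Variables (E : nat -> nat -> F) (c : nat -> F) (N : nat).
Hypothesis E_raise : forall x j, E x.+1 j = E x j.+1 + c x * E x j.
Hypothesis E_last : forall j, (j <= N)%N -> E 0 j = (j == N)%:R.

(** The N + 1 rows leave room for the row that a cover of a diagram with N rows may open. *)
Definition JT mu : F := dt N.+1 (fun i j => E (nth 0%N mu i + N - i) j).

(* Raising one row at a time and shifting one column at a time give the same
   sum, and all column shifts but the last produce two equal columns. *)
Lemma pieri_JT mu : is_part mu -> (size mu <= N)%N ->
  \sum_(nu <- Yn (sumn mu).+1 | subdiag mu nu) JT nu =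
  (E 0 N.+1 + \sum_(i < N.+1) c (nth 0%N mu i + N - i)) * JT mu.
Proof.
move=> hm hN; rewrite (@sum_up _ mu N.+1 JT) //.
pose x i := (nth 0%N mu i + N - i)%N.
pose a i j := E (x i) j.
have JTi (i : 'I_N.+1) : JT (incr_nth mu i) =
    \sum_(j < N.+1) E (x i).+1 j * cofactor (dmx N.+1 a) i j.
  rewrite -(dt_row a i (E (x i).+1)); apply: eq_dt => k l hk hl.
  rewrite nth_incr_nth eq_sym; case: eqP => [->|_] //=.
  by rewrite /x addSn subSn // (leq_trans _ (leq_addl _ _)) // -ltnS.
rewrite big_mkcond /=.
(* Raising a row that is not addable makes it equal to the row above, so its determinant is zero and
   the sum may run over all rows. *)
have -> : \sum_(i < N.+1) (if (i == 0 :> nat) || (nth 0 mu i < nth 0 mu i.-1)%N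
     then JT (incr_nth mu i) else 0) = \sum_(i < N.+1) JT (incr_nth mu i).
  apply: eq_bigr => i _; case: ifP => // /negbT; rewrite negb_or -lt0n -leqNgt => /andP[i0 h].
  have hi := ltn_ord i; have h' := is_part_nonincr hm (leq_pred i).
  apply/esym/(@dt_eq_rows _ _ i.-1 i) => //; [by lia|by lia|move=> j _].
  rewrite !nth_incr_nth eqxx; congr E.
  have -> : (i == i.-1 :> nat) = false by lia.
  by lia.
rewrite (eq_bigr _ (fun i _ => JTi i)).
under eq_bigr => i _ do under eq_bigr => j _ do rewrite E_raise mulrDl -mulrA.
under eq_bigr => i _ do rewrite big_split /= -mulr_sumr.
rewrite big_split /= mulrDl; congr (_ + _); last first.
  rewrite mulr_suml; apply: eq_bigr => i _; congr (_ * _).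
  rewrite /JT /dt (expand_det_row _ i); apply: eq_bigr => j _; by rewrite mxE.
rewrite exchange_big /= big_ord_recr /= big1 ?add0r; last first.
  move=> j _; rewrite -(dt_col a (widen_ord (leqnSn N) j) (fun i => E (x i) j.+1)).
  have hj := ltn_ord j.
  apply: (@dt_eq_cols _ _ j j.+1) => //=; [by lia|by lia|move=> i hi].
  by rewrite eqxx gtn_eqF.
rewrite -(dt_col a ord_max (fun i => E (x i) N.+1)) /=.
(* Row N of mu is empty: the last row of the matrix is (0, ..., 0, E 0 N.+1) here and (0, ..., 0, 1)
   in [JT mu]. Expanding along it leaves the same minor. *)
have xN : x N = 0%N by rewrite /x nth_default // add0n subnn.
rewrite dt_last_row; last by move=> j hj; rewrite ltn_eqF // /a xN E_last ?ltn_eqF // ltnW.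
rewrite eqxx xN /JT [X in _ = _ * X]dt_last_row; last first.
  by move=> j hj; rewrite -/(x N) xN E_last ?ltn_eqF // ltnW.
rewrite [(_ + N - N)%N]xN (E_last (leqnn N)) eqxx mul1r; congr (_ * _).
by apply: eq_dt => i j _ hj; rewrite ltn_eqF.
Qed.

End Determinants.

(** * Complete functions, Newton's identities and divided differences *)

Section Newton.
Variable F : realFieldType.
Implicit Types (p h : nat -> F).

(** Newton's identities determine h from p, so identities between generating functions can be proved
    through power sums, without formal power series. *)
Definition newton p h := h 0%N = 1 /\
  forall k, k.+1%:R * h k.+1 = \sum_(i < k.+1) p i.+1 * h (k - i)%N.

Lemma newton_uniq p p' h h' : (forall i, p i.+1 = p' i.+1) -> newton p h ->
  newton p' h' -> h =1 h'.
Proof.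
move=> hp [h0 hS] [h0' hS'] k; elim/ltn_ind: k => -[|k] IH; first by rewrite h0.
have nz : k.+1%:R != 0 :> F by rewrite pnatr_eq0.
apply: (mulfI nz); rewrite hS hS'; apply: eq_bigr => i _.
by rewrite hp IH // ltnS leq_subr.
Qed.

(** On generating functions h' = (1 - y t) h, and the logarithmic derivative loses the powers of
    y. *)
Lemma newton_mul p h h' y : newton p h -> h' 0%N = 1 ->
  (forall k, h' k.+1 = h k.+1 - y * h k) -> newton (fun i => p i - y ^+ i) h'.
Proof.
move=> [h0 hS] h0' hS'; split=> // k.
under eq_bigr do rewrite mulrBl; rewrite sumrB.
have -> : \sum_(i < k.+1) y ^+ i.+1 * h' (k - i)%N = y * h k.
  elim: k => [|k IH]; first by rewrite big_ord1 subn0 h0 h0'.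
  rewrite big_ord_recl subn0 hS'.
  under eq_bigr => i _ do rewrite lift0 subSS exprS -mulrA.
  rewrite -mulr_sumr IH; ring.
have -> : \sum_(i < k.+1) p i.+1 * h' (k - i)%N =
   k.+1%:R * h k.+1 - y * (k%:R * h k).
  rewrite hS; case: k => [|k].
    by rewrite !big_ord1 !subn0 h0 h0' mul0r mulr0 subr0.
  rewrite hS mulr_sumr !(big_ord_recr k.+1) /= subnn h0 h0' addrAC -sumrB.
  congr (_ + _); apply: eq_bigr => i _.
  have hi : (i <= k)%N by rewrite -ltnS ltn_ord.
  rewrite (subSn hi) hS'; ring.
rewrite hS' -natr1; ring.
Qed.

Lemma hseq_size (p : nat -> R) k : size (hseq p k) = k.+1.
Proof. by elim: k => //= k IH; rewrite size_rcons IH. Qed.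

Lemma nth_hseq (p : nat -> R) k i : (i <= k)%N -> nth 0 (hseq p k) i = hfun p i.
Proof.
elim: k => [|k IH]; first by rewrite leqn0 => /eqP ->.
rewrite leq_eqVlt => /orP[/eqP->//|]; rewrite ltnS => h.
by rewrite /= nth_rcons hseq_size ltnS h IH.
Qed.
End Newton.

Lemma hfun_newton (p : nat -> R) : newton p (hfun p).
Proof.
split=> // k; rewrite {1}/hfun /= nth_rcons hseq_size ltnn eqxx.
rewrite mulrA divff ?pnatr_eq0 // mul1r big_add1 big_mkord; apply: eq_bigr => i _.
by rewrite subSS nth_hseq // leq_subr.
Qed.

Section Lagrange.
Variable F : realFieldType.

Lemma newton_exists (p : nat -> F) : exists h, newton p h.
Proof.
pose hs := fix hs k : seq F := match k with 0 => [:: 1] | k'.+1 => let s := hs k' in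
  rcons s (k'.+1%:R^-1 * \sum_(i < k'.+1) p i.+1 * nth 0 s (k' - i)%N) end.
have sz k : size (hs k) = k.+1 by elim: k => //= k IH; rewrite size_rcons IH.
have nh k i : (i <= k)%N -> nth 0 (hs k) i = nth 0 (hs i) i.
  elim: k => [|k IH]; first by rewrite leqn0 => /eqP ->.
  rewrite leq_eqVlt => /orP[/eqP->//|]; rewrite ltnS => h.
  by rewrite /= nth_rcons sz ltnS h IH.
exists (fun k => nth 0 (hs k) k); split=> // k.
rewrite /= nth_rcons sz ltnn eqxx mulrA divff ?pnatr_eq0 // mul1r.
by apply: eq_bigr => i _; rewrite nh // leq_subr.
Qed.

(** The inverse of [newton_mul], namely division by 1 - v t. The solution for p + v^i is multiplied
    back by 1 - v t, which by uniqueness gives h; hence it satisfies the recurrence of h'. *)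
Lemma newton_div (p h h' : nat -> F) v : newton p h -> h' 0%N = 1 ->
  (forall k, h' k.+1 = h k.+1 + v * h' k) -> newton (fun i => p i + v ^+ i) h'.
Proof.
move=> nh h0' hS'; have [g ng] := newton_exists (fun i => p i + v ^+ i).
pose g1 k := if k is k'.+1 then g k'.+1 - v * g k' else 1.
have /(newton_uniq _) : newton (fun i => p i + v ^+ i - v ^+ i) g1 by apply: newton_mul ng _ _.
move=> /(_ p h) eg.
have e k : g1 k = h k by apply: eg => // i; rewrite addrK.
have eh : g =1 h'.
  elim=> [|k IH]; first by rewrite h0'; case: ng.
  by rewrite hS' -IH -e /g1 subrK.
case: ng => g0 gS; split=> // k; rewrite -eh gS; apply: eq_bigr => i _; by rewrite eh.
Qed.

(* Divided differences: the functional sum_k w_k f(v_k) extracts the top coefficient. *)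
Definition lagrange_weights N (v w : nat -> F) := forall f : {poly F}, (size f <= N)%N ->
  \sum_(k < N) w k * f.[v k] = f`_N.-1.

(** The weights form the last column of the inverse Vandermonde matrix; explicitly w k is the
    inverse of the product of v k - v l over l != k. *)
Lemma lagrange_weights_exist N (v : nat -> F) :
  (forall i j, (i < N)%N -> (j < N)%N -> v i = v j -> i = j) ->
  exists w, lagrange_weights N v w.
Proof.
case: N => [|N] hv.
  by exists (fun _ => 0) => f; rewrite leqn0 size_poly_eq0 => /eqP ->; rewrite big_ord0 coef0.
pose V := Vandermonde N.+1 (\row_(j < N.+1) v j).
have Vu : V \in unitmx.
  rewrite unitmxE det_Vandermonde unitfE; apply/prodf_neq0 => i _; apply/prodf_neq0 => j ij.
  rewrite !mxE subr_eq0; apply/eqP => /hv e; move: ij; rewrite e ?ltn_ord //.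
  by rewrite ltnn.
pose W := invmx V *m delta_mx ord_max (ord0 : 'I_1).
have VW : V *m W = delta_mx ord_max 0 by rewrite mulmxA mulmxV // mul1mx.
exists (fun k => if insub k is Some k' then W k' 0 else 0) => f hf.
transitivity (\sum_(i < N.+1) f`_i * (V *m W) i 0).
  under eq_bigr => k _ do rewrite valK (horner_coef_wide _ hf) mulr_sumr.
  rewrite exchange_big /=; apply: eq_bigr => i _; rewrite mxE mulr_sumr.
  by apply: eq_bigr => k _; rewrite !mxE; ring.
rewrite VW (bigD1 ord_max) //= mxE !eqxx mulr1 big1 ?addr0 //.
by move=> i /negPf hi; rewrite mxE hi mulr0.
Qed.

(** For j > 0 this is the divided difference of x^(j-1) prod (x - y_i) at the nodes v. At j = 0 the
    exponent would be negative, so the constant term 1 of the generating function is put in by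
    hand. *)
Definition lagrange_eta N (v y w : nat -> F) j :=
  if j is j'.+1 then \sum_(k < N) w k * \prod_(i < N) (v k - y i) * v k ^+ j' else 1.

Lemma size_prod_root N (y : nat -> F) :
  (\prod_(i < N) ('X - (y i)%:P) \is monic) /\ size (\prod_(i < N) ('X - (y i)%:P)) = N.+1.
Proof.
split; first by apply: monic_prod => i _; rewrite monicXsubC.
by rewrite size_prod_XsubC /index_enum -enumT size_enum_ord.
Qed.

(* The generating function of the sums is [prod (1 - y_i t) / (1 - v_i t)]. *)
Lemma newton_lagrange N (v y w : nat -> F) : lagrange_weights N v w ->
  newton (fun i => \sum_(k < N) (v k ^+ i - y k ^+ i)) (lagrange_eta N v y w).
Proof.
elim: N w => [|N IH] w hw.
  split=> // k; rewrite /= big_ord0 mulr0 big1 // => i _; by rewrite big_ord0 mul0r.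
(* Dropping the node v N multiplies each remaining Lagrange weight by v k - v N. *)
pose w' k := w k * (v k - v N).
have sumw' (g : nat -> F) : \sum_(k < N.+1) w k * g k * (v k - v N) = \sum_(k < N) w' k * g k.
  rewrite big_ord_recr /= subrr mulr0 addr0; apply: eq_bigr => k _; rewrite /w'; ring.
have hw' : lagrange_weights N v w'.
  move=> f hf; rewrite -(sumw' (fun k => f.[v k])).
  have hs : (size (('X - (v N)%:P) * f)%R <= N.+1)%N.
    apply: leq_trans (size_polyMleq _ _) _; by rewrite size_XsubC /= ltnS.
  transitivity (\sum_(k < N.+1) w k * (('X - (v N)%:P) * f).[v k]).
    by apply: eq_bigr => k _; rewrite hornerM hornerXsubC; ring.
  rewrite (hw _ hs) /= mulrBl coefB coefXM coefCM (nth_default _ hf) mulr0 subr0.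
  by case: (N) hf => // /[!leqn0] /[!size_poly_eq0] /eqP ->; rewrite coef0.
have [n0 nS] := IH _ hw'.
(* The pair y N, v N contributes the factor (1 - y N t) / (1 - v N t): [newton_mul] supplies the
   numerator, [newton_div] the denominator. *)
pose h'' k := if k is k'.+1 then lagrange_eta N v y w' k'.+1 - y N * lagrange_eta N v y w' k' else 1.
have nh'' := newton_mul (IH _ hw') (erefl : h'' 0%N = 1) (fun k => erefl).
suff hrec k : lagrange_eta N.+1 v y w k.+1 = h'' k.+1 + v N * lagrange_eta N.+1 v y w k.
  have [a b] := newton_div nh'' (erefl : lagrange_eta N.+1 v y w 0 = 1) hrec.
  split=> // k; rewrite b; apply: eq_bigr => i _.
  by rewrite big_ord_recr /=; ring.
case: k => [|k].
    rewrite /= mulr1.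
    (* Write v k - y N as (v k - v N) + (v N - y N). The second part leaves a monic polynomial of
       degree N, on which the weights give 1. *)
    have -> : \sum_(k < N.+1) w k * \prod_(i < N.+1) (v k - y i) * v k ^+ 0 =
       \sum_(k < N.+1) w k * (\prod_(i < N) (v k - y i)) * (v k - v N)
       + (v N - y N) * \sum_(k < N.+1) w k * (\prod_(i < N) ('X - (y i)%:P)).[v k].
      rewrite mulr_sumr -big_split /=; apply: eq_bigr => k _; rewrite horner_prod.
      under [X in _ = _ + _ * (_ * X)]eq_bigr do rewrite hornerXsubC.
      rewrite big_ord_recr /=; ring.
    rewrite (sumw' (fun k => \prod_(i < N) (v k - y i))) hw; last by rewrite (size_prod_root N y).2.
    have [/monicP hm hsz] := size_prod_root N y.
    rewrite /= -[X in _`_X]/(N.+1.-1) -hsz -/(lead_coef _) hm.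
    under [X in _ = X - _ + _]eq_bigr do rewrite expr0 mulr1.
    ring.
  rewrite /=; apply/eqP; rewrite -subr_eq; apply/eqP.
  transitivity (\sum_(k0 < N.+1) w k0 * (\prod_(i < N.+1) (v k0 - y i) * v k0 ^+ k) * (v k0 - v N)).
    by rewrite mulr_sumr -sumrB; apply: eq_bigr => i _; rewrite exprS; ring.
  rewrite (sumw' (fun k0 => \prod_(i < N.+1) (v k0 - y i) * v k0 ^+ k)) mulr_sumr -sumrB; apply: eq_bigr => i _.
  rewrite big_ord_recr exprS /=; ring.
Qed.
End Lagrange.

(** * Relative dimensions and their asymptotics *)

Section RelativeDimension.
Implicit Types (mu nu lam : seq nat).

(* Number of chains of length [k] from [mu] to [lam] in the Young graph, i.e. dim(lam/mu). *)
Fixpoint npaths k mu lam : nat :=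
  if k is k'.+1 then
    (\sum_(nu <- Yn (sumn mu).+1 | subdiag mu nu) npaths k' nu lam)%N
  else (mu == lam).

(** By the pigeonhole principle no permutation sends the i0 + 1 rows up to i0 into the i0 columns
    before i0, so every term of the determinant meets the zero block. *)
Lemma dt_zero_block N (a : nat -> nat -> R) i0 : (i0 < N)%N ->
  (forall i j, (i <= i0)%N -> (i0 <= j)%N -> (j < N)%N -> a i j = 0) -> dt N a = 0.
Proof.
move=> hi0 h; rewrite /dt /determinant big1 // => s _.
suff [i hi hs] : exists2 i : 'I_N, (i <= i0)%N & (i0 <= s i)%N.
  by rewrite (bigD1 i) //= mxE h ?mul0r ?mulr0.
have : ~~ [forall i : 'I_N, (i <= i0)%N ==> (s i < i0)%N].
  apply/negP => /forallP hall.
  pose f (i : 'I_i0.+1) : 'I_N := s (widen_ord hi0 i).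
  have fb i : (f i < i0)%N.
    by have := hall (widen_ord hi0 i); rewrite /= -ltnS ltn_ord.
  pose g i : 'I_i0 := Ordinal (fb i).
  have gi : injective g.
    move=> i j /(congr1 val) /= /val_inj /perm_inj /(congr1 val) /= e; exact: val_inj.
  by have := leq_card g gi; rewrite !card_ord ltnn.
case/forallPn => i; rewrite negb_imply -leqNgt => /andP[h1 h2]; by exists i.
Qed.

Section FixedDiagram.
Variables (n : nat) (lam : seq nat).
Hypotheses (plam : is_part lam) (slam : sumn lam = n).

(* [n.+1] rows are used, so that the shifted parts of [lam] are [lrow k]; centred at
   [n + 1/2] they become [vrow k], and [yrow k] is the same for the empty diagram. *)
Definition vrow k : R := (nth 0%N lam k)%:R - k%:R - 2^-1.
Definition yrow k : R := - k%:R - 2^-1.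
Definition lrow k : R := vrow k + n%:R + 2^-1.
Definition ffall (t : R) x := \prod_(i < x) (t - i%:R).

Variable w : nat -> R.
Hypothesis hw : lagrange_weights n.+1 vrow w.

(** With these entries [JT Hmom n mu] factors into an alternant of falling factorials, the weights
    and a Vandermonde determinant: it is the shifted Schur function of mu at lam. *)
Definition Hmom x j := \sum_(k < n.+1) w k * ffall (lrow k) x * vrow k ^+ j.
Definition Hcoef x : R := n%:R + 2^-1 - x%:R.

Lemma Hmom_raise x j : Hmom x.+1 j = Hmom x j.+1 + Hcoef x * Hmom x j.
Proof.
rewrite /Hmom mulr_sumr -big_split /=; apply: eq_bigr => k _.
rewrite /ffall big_ord_recr exprS /= /lrow /Hcoef; ring.
Qed.

(** A falling factorial of length x times the j-th power is monic of degree x + j in [vrow k], and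
    the weights read off the coefficient of degree n. *)
Lemma Hmom_low x j : (x + j <= n)%N -> Hmom x j = (x + j == n)%:R.
Proof.
move=> hx; pose f : {poly R} := (\prod_(i < x) ('X - (i%:R - n%:R - 2^-1)%:P)) * 'X^j.
have [m1 s1] := size_prod_root x (fun i => i%:R - n%:R - 2^-1 : R).
have sf : size f = (x + j).+1 by rewrite /f size_mulXn ?monic_neq0 // s1 addnS addnC.
have mf : f \is monic by rewrite monicMr // monicXn.
transitivity (\sum_(k < n.+1) w k * f.[vrow k]).
  apply: eq_bigr => k _; rewrite hornerM horner_exp hornerX horner_prod mulrA.
  congr (_ * _ * _); apply: eq_bigr => i _; rewrite hornerXsubC /lrow; ring.
rewrite hw ?sf ?ltnS //=; case: eqP => [<-|/eqP ne].
  by rewrite -[X in _`_X]/((x + j).+1.-1) -sf; apply/monicP.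
by rewrite nth_default // sf ltn_neqAle ne.
Qed.

(** The factors of the falling factorial of length n + 1, in reverse order, are vrow k - yrow i. At
    x = n + 1 the entries are therefore complete functions exactly. *)
Lemma Hmom_eta j : Hmom n.+1 j = lagrange_eta n.+1 vrow yrow w j.+1.
Proof.
apply: eq_bigr => k _; congr (_ * _ * _).
rewrite /ffall (reindex_inj rev_ord_inj) /=; apply: eq_bigr => i _.
have hi : (i <= n)%N by rewrite -ltnS ltn_ord.
rewrite subSS (natrB _ hi) /lrow /yrow; ring.
Qed.

(** By [Hmom_low] the rows beyond [size mu] agree with the identity matrix on and below the
    diagonal. The determinant thus has a size independent of n, which the asymptotics needs. *)
Lemma JT_reduce mu L : (size mu <= L)%N -> (L <= n.+1)%N ->
  JT Hmom n mu = dt L (fun i j => Hmom (nth 0%N mu i + n - i) j).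
Proof.
move=> hm hL.
pose a i j := if (i < n.+1)%N then Hmom (nth 0%N mu i + n - i) j else (i == j)%:R.
transitivity (dt n.+1 a); first by apply: eq_dt => i j hi hj; rewrite /a hi.
rewrite (dt_pad hL); first by apply: eq_dt => i j hi hj; rewrite /a (leq_trans hi).
move=> i j hi hj; rewrite /a; case: ifP => // hin.
rewrite nth_default ?(leq_trans hm) // add0n Hmom_low; last by lia.
by congr (_%:R); congr nat_of_bool; lia.
Qed.

Lemma JT_nil : JT Hmom n [::] = 1.
Proof. by rewrite (@JT_reduce _ 0) // /dt det_mx00. Qed.

Lemma sum_vrow : \sum_(k < n.+1) (vrow k - yrow k) = n%:R.
Proof.
rewrite -[in RHS]slam (@sumn_nth lam n.+1) ?natr_sum; last by rewrite -slam leqW ?is_part_size.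
by apply: eq_bigr => k _; rewrite /vrow /yrow; ring.
Qed.

(** The factor from [pieri_JT] depends on mu only through - |mu|. Its constant is found from the
    empty diagram: the single cover has the 1 x 1 determinant [Hmom n.+1 0], the first power sum of
    the rows, equal to n. *)
Lemma JT_pieri mu : is_part mu -> (sumn mu <= n)%N ->
  \sum_(nu <- Yn (sumn mu).+1 | subdiag mu nu) JT Hmom n nu =
  (n%:R - (sumn mu)%:R) * JT Hmom n mu.
Proof.
have hl j : (j <= n)%N -> Hmom 0 j = (j == n)%:R by move=> h; rewrite Hmom_low.
have key nu : is_part nu -> (size nu <= n)%N ->
  \sum_(i < n.+1) Hcoef (nth 0%N nu i + n - i) =
     \sum_(i < n.+1) (i%:R + 2^-1) - (sumn nu)%:R.
  move=> hn hs; rewrite (@sumn_nth nu n.+1) ?leqW // natr_sum -sumrB.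
  apply: eq_bigr => i _; rewrite /Hcoef natrB ?natrD; first by ring.
  by rewrite (leq_trans _ (leq_addl _ _)) // -ltnS.
move=> hm hmn; have hsm : (size mu <= n)%N by apply: leq_trans (is_part_size hm) hmn.
rewrite (pieri_JT Hmom_raise hl hm hsm) (key _ hm hsm).
have [e0 eS] := newton_lagrange yrow hw.
have e1 : Hmom n.+1 0 = n%:R.
  have := eS 0%N; rewrite mul1r big_ord1 e0 mulr1 Hmom_eta => ->.
  by rewrite -sum_vrow.
have := pieri_JT Hmom_raise hl (isT : is_part [::]) (leq0n n).
rewrite (key [::] isT (leq0n n)) JT_nil mulr1 subr0 /=.
have p1 : is_part [:: 1%N] by [].
rewrite (@big_seq_only _ _ _ [:: 1%N]) ?Yn_uniq ?mem_Yn //; last first.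
  move=> y; rewrite mem_Yn => /andP[py /eqP sy] _.
  case: y py sy => [//|a y] py sy; apply/esym/subdiag_eq => //; last by rewrite sy.
  by apply/subdiagP => -[|i] /=; [have := is_part_gt0 0 py|rewrite nth_nil].
rewrite (@JT_reduce _ 1) //.
rewrite /dt (expand_det_row _ ord0) big_ord1 mxE /= /cofactor det_mx00 mulr1 expr0 mulr1.
rewrite subn0 add1n e1 => ->.
by congr (_ * _); rewrite addrA.
Qed.

(** A diagram nu != lam of the same size has a row i0 longer than that of lam. For i <= i0 <= k the
    natural number [lrow k] is below nu_i + n - i, so the falling factorial contains the factor
    zero, and [dt_zero_block] applies. *)
Lemma JT_vanish nu : is_part nu -> sumn nu = n -> nu != lam -> JT Hmom n nu = 0.
Proof.
move=> hn sn ne.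
have [i0 hi0] : exists i, (nth 0 lam i < nth 0 nu i)%N.
  apply/not_existsP => h; move/eqP: ne; apply.
  apply: subdiag_eq => //; last by rewrite sn slam.
  by apply/subdiagP => i; rewrite leqNgt; apply/negP => /h.
have i0s : (i0 < n.+1)%N.
  rewrite ltnS -sn (leq_trans _ (is_part_size hn)) // ltnW //.
  by rewrite -(is_part_gt0 _ hn) (leq_ltn_trans _ hi0).
pose A := dmx n.+1 (fun i k => ffall (lrow k) (nth 0%N nu i + n - i) * w k).
pose D := dmx n.+1 (fun k j => vrow k ^+ j).
have -> : JT Hmom n nu = \det (A *m D).
  congr determinant; apply/matrixP => i j; rewrite !mxE; apply: eq_bigr => k _.
  by rewrite !mxE; ring.
rewrite det_mulmx -[\det A]/(dt _ _) (@dt_zero_block _ _ i0) ?mul0r // => i k h1 h2 h3.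
have -> : lrow k = (nth 0%N lam k + n - k)%N%:R.
  rewrite natrB ?natrD /lrow /vrow; first by ring.
  by rewrite (leq_trans _ (leq_addl _ _)) // -ltnS.
have m1 := is_part_nonincr plam h2; have m2 := is_part_nonincr hn h1.
have hlt : (nth 0 lam k + n - k < nth 0 nu i + n - i)%N by lia.
by rewrite /ffall (bigD1 (Ordinal hlt)) //= subrr !mul0r.
Qed.

(** Going down from level n, both sides obey the same recursion by [JT_pieri]; [JT_vanish] gives the
    boundary values. *)
Lemma JT_npaths k mu : is_part mu -> (sumn mu + k)%N = n ->
  JT Hmom n mu * k`!%:R = (npaths k mu lam)%:R * JT Hmom n lam.
Proof.
elim: k mu => [|k IH] mu hm sm /=.
  rewrite addn0 in sm; rewrite mulr1; case: eqVneq => [->|ne]; first by rewrite mul1r.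
  by rewrite mul0r JT_vanish.
rewrite natr_sum [RHS]mulr_suml.
have -> : JT Hmom n mu * (k.+1)`!%:R = k`!%:R * ((n%:R - (sumn mu)%:R) * JT Hmom n mu).
  by rewrite factS natrM -[in X in _ = _ * ((X - _) * _)]sm natrD; ring.
rewrite -JT_pieri //; last by rewrite -sm leq_addr.
rewrite mulr_sumr big_seq_cond [RHS]big_seq_cond; apply: eq_bigr => nu.
rewrite mem_Yn => /andP[/andP[pn /eqP sn] _]; rewrite mulrC IH //.
by rewrite sn addSnnS.
Qed.

Lemma JT_lam : (npaths n [::] lam)%:R * JT Hmom n lam = n`!%:R.
Proof. by rewrite -(@JT_npaths n [::]) // JT_nil mul1r. Qed.

End FixedDiagram.

Lemma vrow_inj lam : is_part lam -> injective (vrow lam).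
Proof.
move=> hl i j; wlog: i j / (i <= j)%N => [hw|hij].
  by case/orP: (leq_total i j) => h e; [|apply/esym]; apply: hw.
move=> /(congr1 (fun x => x + 2^-1)); rewrite /vrow !subrK => /eqP.
rewrite subr_eq addrAC eq_sym subr_eq -!natrD eqr_nat => /eqP.
have := is_part_nonincr hl hij; lia.
Qed.

Lemma vrow_weights n lam : is_part lam -> exists w, lagrange_weights n (vrow lam) w.
Proof. by move=> hl; apply: lagrange_weights_exist => i j _ _; apply: vrow_inj. Qed.

(** Zero paths would contradict [JT_lam], where their number divides n! as a real factor. *)
Lemma npaths_gt0 n lam : is_part lam -> sumn lam = n -> (0 < npaths n [::] lam)%N.
Proof.
move=> hl sl; have [w hw] := vrow_weights n.+1 hl.
rewrite lt0n; apply/eqP => h; have := JT_lam hl sl hw.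
by rewrite h mul0r => /esym/eqP; rewrite pnatr_eq0 eqn0Ngt fact_gt0.
Qed.

Definition reldim n mu lam : R :=
  (npaths (n - sumn mu) mu lam)%:R / (npaths n [::] lam)%:R.

Lemma JT_reldim n mu lam w : is_part lam -> sumn lam = n ->
  lagrange_weights n.+1 (vrow lam) w -> is_part mu -> (sumn mu <= n)%N ->
  JT (Hmom n lam w) n mu = (n ^_ (sumn mu))%:R * reldim n mu lam.
Proof.
move=> hl sl hw hm hmn.
have e := JT_npaths hl sl hw hm (subnKC hmn); have el := JT_lam hl sl hw.
have d0 : (npaths n [::] lam)%:R != 0 :> R by rewrite pnatr_eq0 -lt0n npaths_gt0.
have f0 : (n - sumn mu)`!%:R != 0 :> R by rewrite pnatr_eq0 -lt0n fact_gt0.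
apply: (mulIf f0); rewrite e /reldim.
rewrite mulrAC -natrM ffact_fact // -el; field.
by rewrite d0.
Qed.

End RelativeDimension.

(** * Estimates uniform over all diagrams of a level *)

Section UniformBounds.

Definition bd (a : nat -> seq nat -> R) := exists C n0, forall n lam,
  (n0 <= n)%N -> lam \in Yn n -> `|a n lam| <= C.
(* Families of size O(1/n), uniformly on Y_n. *)
Definition sm (a : nat -> seq nat -> R) := bd (fun n lam => n%:R * a n lam).

Lemma bd_ext a b n0 : (forall n lam, (n0 <= n)%N -> lam \in Yn n -> a n lam = b n lam) ->
  bd a -> bd b.
Proof.
move=> h [C [n1 hC]]; exists C, (maxn n0 n1) => n lam; rewrite geq_max => /andP[h0 h1] hl.
by rewrite -h // hC.
Qed.

Lemma sm_ext a b n0 : (forall n lam, (n0 <= n)%N -> lam \in Yn n -> a n lam = b n lam) ->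
  sm a -> sm b.
Proof. by move=> h; apply: (@bd_ext _ _ n0) => n lam hn hl; rewrite h. Qed.

Lemma bd_cst c : bd (fun _ _ => c).
Proof. by exists `|c|, 0%N. Qed.

Lemma bdD a b : bd a -> bd b -> bd (fun n lam => a n lam + b n lam).
Proof.
move=> [A [n0 hA]] [B [n1 hB]]; exists (A + B), (maxn n0 n1) => n lam.
rewrite geq_max => /andP[h0 h1] hl; apply: le_trans (ler_normD _ _) _.
by apply: lerD; [apply: hA|apply: hB].
Qed.

Lemma bdM a b : bd a -> bd b -> bd (fun n lam => a n lam * b n lam).
Proof.
move=> [A [n0 hA]] [B [n1 hB]]; exists (A * B), (maxn n0 n1) => n lam.
rewrite geq_max => /andP[h0 h1] hl; rewrite normrM.
by apply: ler_pM => //; [apply: hA|apply: hB].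
Qed.

Lemma bdN a : bd a -> bd (fun n lam => - a n lam).
Proof. by move=> [A [n0 hA]]; exists A, n0 => n lam h1 h2; rewrite normrN hA. Qed.

Lemma bdB a b : bd a -> bd b -> bd (fun n lam => a n lam - b n lam).
Proof. by move=> ha hb; apply: bdD => //; apply: bdN. Qed.

Lemma smD a b : sm a -> sm b -> sm (fun n lam => a n lam + b n lam).
Proof.
move=> ha hb; apply: (@bd_ext _ _ 0 _ (bdD ha hb)) => n lam _ _; by rewrite mulrDr.
Qed.

Lemma smN a : sm a -> sm (fun n lam => - a n lam).
Proof. by move=> ha; apply: (@bd_ext _ _ 0 _ (bdN ha)) => n lam _ _; rewrite mulrN. Qed.

Lemma smB a b : sm a -> sm b -> sm (fun n lam => a n lam - b n lam).
Proof. by move=> ha hb; apply: smD => //; apply: smN. Qed.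

Lemma sm0 : sm (fun _ _ => 0).
Proof. by exists 0, 0%N => n lam _ _; rewrite mulr0 normr0. Qed.

Lemma smMl a b : sm a -> bd b -> sm (fun n lam => a n lam * b n lam).
Proof. by move=> ha hb; apply: (@bd_ext _ _ 0 _ (bdM ha hb)) => n lam _ _; rewrite mulrA. Qed.

Lemma smMr a b : bd a -> sm b -> sm (fun n lam => a n lam * b n lam).
Proof.
move=> ha hb; apply: (@bd_ext _ _ 0 _ (bdM hb ha)) => n lam _ _; by rewrite -mulrA [b _ _ * _]mulrC.
Qed.

Lemma sm_bd a : sm a -> bd a.
Proof.
move=> [C [n0 hC]]; exists C, n0.+1 => n lam hn hl.
apply: le_trans (hC n lam (ltnW hn) hl); rewrite normrM ler_peMl //.
by rewrite ger0_norm ?ler0n // ler1n (leq_trans _ hn).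
Qed.

Lemma sm_inv a : bd a -> sm (fun n lam => a n lam / n%:R).
Proof.
apply: (@bd_ext _ _ 1) => n lam hn _; rewrite mulrCA divff ?mulr1 //.
by rewrite pnatr_eq0 -lt0n.
Qed.

Lemma bd_close a b : bd b -> sm (fun n lam => a n lam - b n lam) -> bd a.
Proof.
move=> hb /sm_bd hs; apply: (@bd_ext _ _ 0 _ (bdD hs hb)) => n lam _ _; by rewrite subrK.
Qed.

Lemma close_prod (I : Type) (r : seq I) (a b : I -> nat -> seq nat -> R) :
  (forall i, bd (b i)) -> (forall i, sm (fun n lam => a i n lam - b i n lam)) ->
  bd (fun n lam => \prod_(i <- r) b i n lam) /\
  sm (fun n lam => \prod_(i <- r) a i n lam - \prod_(i <- r) b i n lam).
Proof.
move=> hb hs; elim: r => [|i r [IH1 IH2]]; split.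
- by apply: (@bd_ext _ _ 0 _ (bd_cst 1)) => n lam _ _; rewrite big_nil.
- by apply: (@sm_ext _ _ 0 _ sm0) => n lam _ _; rewrite !big_nil subrr.
- by apply: (@bd_ext _ _ 0 _ (bdM (hb i) IH1)) => n lam _ _; rewrite big_cons.
- have h1 := smMl (hs i) (bd_close IH1 IH2); have h2 := smMr (hb i) IH2.
  by apply: (@sm_ext _ _ 0 _ (smD h1 h2)) => n lam _ _; rewrite !big_cons; ring.
Qed.

Lemma bd_sum (I : Type) (r : seq I) (P : pred I) (b : I -> nat -> seq nat -> R) :
  (forall i, P i -> bd (b i)) -> bd (fun n lam => \sum_(i <- r | P i) b i n lam).
Proof.
move=> hb; elim: r => [|i r IH].
  by apply: (@bd_ext _ _ 0 _ (bd_cst 0)) => n lam _ _; rewrite big_nil.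
case: (boolP (P i)) => Pi; last first.
  by apply: (@bd_ext _ _ 0 _ IH) => n lam _ _; rewrite big_cons (negPf Pi).
by apply: (@bd_ext _ _ 0 _ (bdD (hb i Pi) IH)) => n lam _ _; rewrite big_cons Pi.
Qed.

Lemma sm_sum (I : Type) (r : seq I) (P : pred I) (b : I -> nat -> seq nat -> R) :
  (forall i, P i -> sm (b i)) -> sm (fun n lam => \sum_(i <- r | P i) b i n lam).
Proof.
move=> hb; apply: (@bd_ext _ _ 0 _ (bd_sum r (P:=P) hb)) => n lam _ _.
by rewrite mulr_sumr.
Qed.

Lemma close_dt L (a b : nat -> nat -> nat -> seq nat -> R) :
  (forall i j, (i < L)%N -> bd (b i j)) ->
  (forall i j, (i < L)%N -> sm (fun n lam => a i j n lam - b i j n lam)) ->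
  bd (fun n lam => dt L (fun i j => b i j n lam)) /\
  sm (fun n lam => dt L (fun i j => a i j n lam) - dt L (fun i j => b i j n lam)).
Proof.
move=> hb hs.
have h (s : 'S_L) := @close_prod _ (index_enum 'I_L) (fun i => a i (s i)) (fun i => b i (s i))
  (fun i => hb i (s i) (ltn_ord i)) (fun i => hs i (s i) (ltn_ord i)).
split.
  have := bd_sum (index_enum 'S_L) (P := xpredT)
    (fun s _ => bdM (bd_cst ((-1) ^+ s)) (h s).1).
  apply: (@bd_ext _ _ 0) => n lam _ _; apply: eq_bigr => s _; congr (_ * _).
  by apply: eq_bigr => i _; rewrite mxE.
have := sm_sum (index_enum 'S_L) (P := xpredT)
  (fun s _ => smMr (bd_cst ((-1) ^+ s)) (h s).2).
apply: (@sm_ext _ _ 0) => n lam _ _; rewrite /dt /determinant -sumrB.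
apply: eq_bigr => s _; rewrite -mulrBr; congr (_ * (_ - _)).
  by apply: eq_bigr => i _; rewrite mxE.
by apply: eq_bigr => i _; rewrite mxE.
Qed.

End UniformBounds.

(** * Convergence of relative dimensions to Jacobi-Trudi determinants *)

Section Asymptotics.

Lemma vrow_weights_fun : exists W : nat -> seq nat -> nat -> R, forall n lam,
  is_part lam -> lagrange_weights n.+1 (vrow lam) (W n lam).
Proof.
have h n lam : exists w, is_part lam -> lagrange_weights n.+1 (vrow lam) w.
  have [hl|hl] := boolP (is_part lam); last by exists (fun _ => 0).
  by have [w hw] := vrow_weights n.+1 hl; exists w.
exists (fun n lam => projT1 (cid (h n lam))) => n lam; exact: (projT2 (cid (h n lam))).
Qed.

(** For i >= 1 this is p_i at the point [iota_n n lam], as [newton_iota] shows; here h stays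
    abstract, known only through Newton's identities and a uniform bound. *)
Definition pscaled n lam i : R := n%:R ^- i * \sum_(k < n.+1) (vrow lam k ^+ i - yrow k ^+ i).

Variable W : nat -> seq nat -> nat -> R.
Hypothesis hW : forall n lam, is_part lam -> lagrange_weights n.+1 (vrow lam) (W n lam).
Variable h : nat -> seq nat -> nat -> R.
Hypothesis h_newton : forall n lam, lam \in Yn n -> (0 < n)%N -> newton (pscaled n lam) (h n lam).
Hypothesis h_bd : forall k, bd (fun n lam => h n lam k).

Let H n lam := Hmom n lam (W n lam).

Lemma h_eta n lam k : lam \in Yn n -> (0 < n)%N ->
  h n lam k = n%:R ^- k * lagrange_eta n.+1 (vrow lam) yrow (W n lam) k.
Proof.
move=> hl n0.
pose g k := n%:R ^- k * lagrange_eta n.+1 (vrow lam) yrow (W n lam) k.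
suff ng : newton (pscaled n lam) g by apply: (newton_uniq (fun _ => erefl) (h_newton hl n0) ng k).
have pl : is_part lam by move: hl; rewrite mem_Yn => /andP[].
have [e0 eS] := newton_lagrange yrow (@hW n lam pl).
rewrite /g; split=> [|{}k]; first by rewrite e0 expr0 invr1 mulr1.
rewrite mulrCA eS mulr_sumr; apply: eq_bigr => i _.
have hi : (i <= k)%N by rewrite -ltnS ltn_ord.
have -> : n%:R ^- k.+1 = n%:R ^- i.+1 * n%:R ^- (k - i) :> R.
  by rewrite -invfM -exprD addSn subnKC.
rewrite /pscaled; ring.
Qed.

Definition hsub n lam k p : R := if (p <= k)%N then h n lam (k - p) else 0.

Lemma hsub_bd k p : bd (fun n lam => hsub n lam k p).
Proof. by rewrite /hsub; case: (p <= k)%N; [apply: h_bd|apply: bd_cst]. Qed.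

(** At x = n + 1 equality is exact by [h_eta]. A step of the recurrence from x = n + 1 + q has the
    coefficient -(1/2 + q), bounded in n, so after scaling its second term is O(1/n). *)
Lemma close_up q j :
  sm (fun n lam => n%:R ^- (q + j).+1 * H n lam (n.+1 + q) j - h n lam (q + j).+1).
Proof.
elim: q j => [|q IH] j.
  apply: (@sm_ext _ _ 1 _ sm0) => n lam n1 hl.
  by rewrite addn0 /H Hmom_eta -h_eta // subrr.
have h1 := IH j.+1; have h2 := bd_close (h_bd (q + j).+1) (IH j).
have hc : sm (fun n lam => (n%:R ^- (q + j).+1 * H n lam (n.+1 + q) j) * (- (2^-1 + q%:R)) / n%:R).
  by apply: sm_inv; apply: bdM => //; apply: bd_cst.
apply: (@sm_ext _ _ 1 _ (smD h1 hc)) => n lam n1 hl.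
rewrite [in RHS]addnS /H Hmom_raise addnS addSn /Hcoef.
have -> : n%:R + 2^-1 - (n.+1 + q)%:R = - (2^-1 + q%:R) :> R.
  by rewrite natrD -natr1; field.
have -> : n%:R ^- (q + j).+2 = n%:R ^- (q + j).+1 / n%:R :> R.
  by rewrite [_ ^+ _.+2]exprSr invfM.
ring.
Qed.

(** Below n + 1 the recurrence is solved for [Hmom x j.+1], starting from the exact values of
    [Hmom_low]. The coefficient 1/2 + p at x = n - p is again bounded in n. *)
Lemma close_down p j :
  sm (fun n lam => n%:R ^- j.+1 * n%:R ^+ p.+1 * H n lam (n - p) j - hsub n lam j p).
Proof.
have low p' j' : (j' <= p')%N ->
   sm (fun n lam => n%:R ^- j'.+1 * n%:R ^+ p'.+1 * H n lam (n - p') j' - hsub n lam j' p').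
  move=> jp; apply: (@sm_ext _ _ p'.+1 _ sm0) => n lam n1 hl.
  have n0 : (0 < n)%N by apply: leq_trans n1.
  have pl : is_part lam by move: hl; rewrite mem_Yn => /andP[].
  rewrite /H (Hmom_low (@hW n lam pl)); last by lia.
  rewrite /hsub; case: (ltngtP j' p') jp => // hjp _.
    by rewrite [_ == _](_ : _ = false) ?mulr0 ?subrr //; lia.
  rewrite hjp subnn [_ == _](_ : _ = true); last by lia.
  by rewrite (h_newton hl n0).1 mulr1 mulVf ?subrr // expf_neq0 // pnatr_eq0 -lt0n.
elim: p j => [|p IHp] j.
  case: j => [|j]; first exact: low.
  have step : forall j, sm (fun n lam => n%:R ^- j.+1 * n%:R * H n lam n j - h n lam j) ->
     sm (fun n lam => n%:R ^- j.+2 * n%:R * H n lam n j.+1 - h n lam j.+1).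
    move=> {}j IHj; have h2 := bd_close (h_bd j) IHj.
    have hc : sm (fun n lam => (n%:R ^- j.+1 * n%:R * H n lam n j) * (- 2^-1) / n%:R).
      by apply: sm_inv; apply: bdM => //; apply: bd_cst.
    apply: (@sm_ext _ _ 1 _ (smD (close_up 0 j) hc)) => n lam n1 hl.
    have nz : n%:R != 0 :> R by rewrite pnatr_eq0 -lt0n.
    rewrite add0n addn0 /H Hmom_raise /Hcoef.
    have -> : n%:R ^- j.+2 = n%:R ^- j.+1 / n%:R :> R by rewrite [_ ^+ _.+2]exprSr invfM.
    by field; rewrite ?expf_neq0 ?nz.
  have all j' : sm (fun n lam => n%:R ^- j'.+1 * n%:R * H n lam n j' - h n lam j').
    elim: j' => [|j' IHj]; last exact: step.
    have := low 0%N 0%N (leqnn _); apply: (@sm_ext _ _ 0) => n lam _ _.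
    by rewrite subn0 /hsub /= subn0 expr1.
  by have := all j.+1; apply: (@sm_ext _ _ 0) => n lam _ _; rewrite subn0 /hsub /= subn0 expr1.
elim: j => [|j IHj]; first exact: low.
have h2 := bd_close (hsub_bd j p.+1) IHj.
have hc : sm (fun n lam => (n%:R ^- j.+1 * n%:R ^+ p.+2 * H n lam (n - p.+1) j) *
     (- (2^-1 + p.+1%:R)) / n%:R).
  by apply: sm_inv; apply: bdM => //; apply: bd_cst.
apply: (@sm_ext _ _ p.+2 _ (smD (IHp j) hc)) => n lam n1 hl.
have nz : n%:R != 0 :> R by rewrite pnatr_eq0 -lt0n; lia.
have -> : (n - p = (n - p.+1).+1)%N by lia.
rewrite /H Hmom_raise /Hcoef.
have -> : hsub n lam j.+1 p.+1 = hsub n lam j p by rewrite /hsub ltnS subSS.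
have -> : n%:R + 2^-1 - (n - p.+1)%:R = 2^-1 + p.+1%:R :> R.
  by rewrite natrB; [ring|lia].
have -> : n%:R ^- j.+2 = n%:R ^- j.+1 / n%:R :> R by rewrite [_ ^+ _.+2]exprSr invfM.
rewrite [_ ^+ p.+2]exprS; by field; rewrite ?expf_neq0 ?nz.
Qed.

Lemma close_entry m i j :
  sm (fun n lam => n%:R ^+ i * n%:R ^- m * n%:R ^- j * H n lam (m + n - i) j
       - hsub n lam (m + j) i).
Proof.
case: (leqP m i) => hmi.
  have := close_down (i - m) j; apply: (@sm_ext _ _ 1) => n lam n1 hl.
  have nz : n%:R != 0 :> R by rewrite pnatr_eq0 -lt0n.
  have -> : hsub n lam (m + j) i = hsub n lam j (i - m).
    rewrite /hsub leq_subLR; case: ifP => // _; congr h; lia.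
  have -> : (m + n - i = n - (i - m))%N by lia.
  congr (_ * _ - _); rewrite -{2}(subnK hmi) exprD !exprS; field.
  by rewrite !expf_neq0 // nz.
have [q hq] : exists q, m = (i + q.+1)%N by exists (m - i).-1; lia.
have := close_up q j; apply: (@sm_ext _ _ 1) => n lam n1 hl.
have nz : n%:R != 0 :> R by rewrite pnatr_eq0 -lt0n.
have -> : hsub n lam (m + j) i = h n lam (q + j).+1.
  rewrite /hsub; have -> : (i <= m + j)%N by lia.
  congr h; lia.
have -> : (m + n - i = n.+1 + q)%N by lia.
congr (_ * _ - _); rewrite hq !exprD !exprS !exprD; field.
by rewrite !expf_neq0 // nz.
Qed.

Definition schur_h (hh : nat -> R) mu : R :=
  dt (size mu) (fun i j => if (i <= nth 0%N mu i + j)%N then hh (nth 0%N mu i + j - i)%N else 0).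

Lemma bd_schur_h mu : bd (fun n lam => schur_h (h n lam) mu).
Proof.
pose b i j n lam := hsub n lam (nth 0%N mu i + j) i.
have hb i j : (i < size mu)%N -> bd (b i j).
  by move=> _; apply: hsub_bd.
have hs i j : (i < size mu)%N -> sm (fun n lam => b i j n lam - b i j n lam).
  by move=> _; apply: (@sm_ext _ _ 0 _ sm0) => *; rewrite subrr.
exact: (close_dt hb hs).1.
Qed.

(** Row i is scaled by n^(i - mu_i) and column j by n^(-j). The powers n^i and n^(-j) cancel in the
    determinant and the factor n^(-|mu|) remains. *)
Lemma close_JT mu : is_part mu ->
  sm (fun n lam => n%:R ^- sumn mu * JT (H n lam) n mu - schur_h (h n lam) mu).
Proof.
move=> hm.
pose b i j n lam := hsub n lam (nth 0%N mu i + j) i.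
pose a i j n lam := n%:R ^+ i * n%:R ^- nth 0%N mu i * n%:R ^- j *
  H n lam (nth 0%N mu i + n - i) j.
have hb i j : (i < size mu)%N -> bd (b i j).
  by move=> _; apply: hsub_bd.
have hs i j : (i < size mu)%N -> sm (fun n lam => a i j n lam - b i j n lam).
  by move=> _; apply: close_entry.
have := (close_dt hb hs).2; apply: (@sm_ext _ _ (maxn 1 (sumn mu))) => n lam; rewrite geq_max => /andP[n1 hn] hl.
have := hl; rewrite mem_Yn => /andP[pl /eqP sl].
have nz : n%:R != 0 :> R by rewrite pnatr_eq0 -lt0n.
have hsz := is_part_size hm.
congr (_ - _); rewrite (JT_reduce pl sl (@hW n lam pl) (leqnn _)); last by lia.
transitivity (dt (size mu) (fun i j => (n%:R ^+ i * n%:R ^- nth 0%N mu i) *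
   H n lam (nth 0%N mu i + n - i) j * n%:R ^- j)).
  by apply: eq_dt => i j _ _; rewrite /a mulrAC.
rewrite dt_scale; congr (_ * _).
rewrite -big_split /= (eq_bigr (fun i : 'I_(size mu) => n%:R ^- nth 0%N mu i)).
  rewrite prodfV; congr (_^-1).
  by rewrite (sumn_nth (leqnn _)) expr_sum.
move=> i _; rewrite mulrAC divff ?mul1r // expf_neq0 //.
Qed.

Lemma ffact_ratio m : sm (fun n _ => (n ^_ m)%:R / n%:R ^+ m - 1).
Proof.
elim: m => [|m IH].
  by apply: (@sm_ext _ _ 0 _ sm0) => n lam _ _; rewrite ffactn0 expr0 divr1 subrr.
have b : bd (fun n _ => (n ^_ m)%:R / n%:R ^+ m) by apply: bd_close IH; apply: bd_cst.
have hc := sm_inv (bdM b (bd_cst (- m%:R))).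
apply: (@sm_ext _ _ m.+1 _ (smD IH hc)) => n lam n1 _.
have nz : n%:R != 0 :> R by rewrite pnatr_eq0 -lt0n; lia.
rewrite ffactnSr natrM natrB; last by lia.
rewrite exprS; field; by rewrite !expf_neq0 // nz.
Qed.

Lemma reldim_bd_close mu : is_part mu ->
  sm (fun n lam => reldim n mu lam - schur_h (h n lam) mu).
Proof.
move=> hm; have hJ := close_JT hm; have hb := bd_close (bd_schur_h mu) hJ.
have [A [n0 hA]] := hb; have [B [n1 hB]] := ffact_ratio (sumn mu).
(* Boundedness of [reldim] comes first: once n > 2 B the ratio of the falling factorial to n^m is
   within 1/2 of 1, hence at least 1/2, and can be divided out. *)
have hrb : bd (fun n lam => reldim n mu lam).
  exists (2 * A), (maxn (maxn n0 n1) (maxn (sumn mu).+1 (Num.bound (2 * B)))) => n lam.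
  rewrite !geq_max => /and3P[/andP[hn0 hn1] hn2 hn3] hl.
  have := hl; rewrite mem_Yn => /andP[pl /eqP sl].
  have nz : 0 < n%:R :> R by rewrite ltr0n; lia.
  have := hA n lam hn0 hl; have := hB n lam hn1 hl.
  rewrite (JT_reldim pl sl (@hW n lam pl) hm) 1?ltnW //.
  rewrite normrM (ger0_norm (ltW nz)) mulrA => h1 h2.
  set r := (n ^_ _)%:R / _ in h1.
  have h2B : 2 * B < n%:R.
    apply: lt_le_trans (_ : (Num.bound (2 * B))%:R <= _); last by rewrite ler_nat.
    have B0 : 0 <= B.
      by apply: le_trans h1; rewrite mulr_ge0 // ltW.
    by apply: archi_boundP; rewrite mulr_ge0.
  have hr : `|r - 1| <= 2^-1.
    rewrite -(ler_pM2l nz); apply: le_trans h1 _; lra.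
  have hr2 : 2^-1 <= `|r|.
    by move: hr; rewrite ler_distl => /andP[hr _]; apply: le_trans (ler_norm _); lra.
  have e : n%:R ^- sumn mu * (n ^_ sumn mu)%:R = r by rewrite /r mulrC.
  rewrite e normrM in h2.
  have : 2^-1 * `|reldim n mu lam| <= A by apply: le_trans h2; rewrite ler_wpM2r.
  lra.
apply: (@sm_ext _ _ (sumn mu).+1 _ (smB hJ (smMl (ffact_ratio (sumn mu)) hrb))) => n lam hn hl.
have := hl; rewrite mem_Yn => /andP[pl /eqP sl].
rewrite (JT_reldim pl sl (@hW n lam pl) hm) 1?ltnW //; ring.
Qed.

End Asymptotics.

(** * Frobenius coordinates and the embedding into the Thoma simplex *)

Section FrobeniusCoordinates.
Implicit Types (lam : seq nat).

Lemma colY_lt lam i j : is_part lam -> (i < colY lam j)%N = (j < nth 0 lam i)%N.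
Proof.
case/andP=> hs _; elim: lam i hs => [|x lam IH] i hs; first by rewrite nth_nil.
have hs' : sorted geq lam by move: hs; rewrite /=; apply: path_sorted.
have hx : all (geq x) lam.
  by move: hs; apply: order_path_min => a b c h1 h2; apply: leq_trans h2 h1.
rewrite /colY /=; case: (ltnP j x) => hj.
  by case: i => [|i] //=; rewrite add1n ltnS IH.
have -> : count (fun y => j < y)%N lam = 0%N.
  apply/eqP; rewrite -leqn0 leqNgt -has_count; apply/hasPn => y /(allP hx) hy.
  by rewrite -leqNgt (leq_trans hy).
rewrite add0n ltn0; case: i => [|i] /=; first by rewrite ltnNge hj.
apply/esym/negbTE; rewrite -leqNgt.
case: (ltnP i (size lam)) => hi; last by rewrite nth_default.
exact: leq_trans (allP hx _ (mem_nth _ hi)) hj.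
Qed.

Lemma colY_nonincr lam i : (colY lam i.+1 <= colY lam i)%N.
Proof. by apply: sub_count => x /= /ltnW. Qed.

Lemma dnum_lt lam i : is_part lam -> (i < dnum lam)%N = (i < nth 0 lam i)%N.
Proof.
move=> hl; pose p k := (k < nth 0 lam k)%N.
have hp a b : (a <= b)%N -> p b -> p a.
  move=> hab hb; apply: leq_ltn_trans (hab) _; apply: leq_trans hb _.
  exact: is_part_nonincr.
have key m : (i < count p (iota 0 m))%N = (i < m)%N && p i.
  elim: m => [|m IH] //; rewrite -[X in iota 0 X]addn1 iotaD count_cat /= add0n addn0.
  case: (boolP (p m)) => pm.
    have -> : count p (iota 0 m) = m.
      rewrite -[RHS](size_iota 0); apply/eqP; rewrite -all_count; apply/allP => k.
      by rewrite mem_iota add0n => /andP[_ hk]; apply: hp pm; apply: ltnW.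
    by rewrite addn1; case: (ltnP i m.+1) => //= h; rewrite (hp _ _ _ pm).
  rewrite addn0 IH ltnS; case: (ltngtP i m) => //= ->; by rewrite (negPf pm).
rewrite /dnum key; case: (ltnP i (size lam)) => //= hi.
by rewrite nth_default // ltn0.
Qed.

Definition av lam i : R := if (i < nth 0 lam i)%N then (nth 0%N lam i)%:R - i%:R - 2^-1 else 0.
Definition bv lam i : R := if (i < nth 0 lam i)%N then (colY lam i)%:R - i%:R - 2^-1 else 0.

Lemma sum_interval (V : nmodType) m M (P : pred nat) (F : nat -> V) L : (L <= M)%N ->
  (forall j, P j = (m <= j < L)%N) ->
  \sum_(j < M | P j) F j = \sum_(m <= j < L) F j.
Proof.
move=> hL hP; rewrite (big_nat_widenl _ 0) // (big_nat_widen _ _ _ _ _ hL) big_mkord.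
by apply: eq_bigl => j; rewrite hP.
Qed.

(* Both sides are the sum over the boxes (k, j) of
   g (j - k + 1/2) - g (j - k - 1/2); on the right it is computed hook by hook
   along the diagonal. *)
Lemma frobenius_sum n lam (g : R -> R) : is_part lam -> sumn lam = n ->
  \sum_(k < n.+1) (g (vrow lam k) - g (yrow k)) =
  \sum_(i < n.+1 | (i < nth 0 lam i)%N) (g (av lam i) - g (- bv lam i)).
Proof.
move=> hl sl; pose d (j k : nat) : R := g (j%:R - k%:R + 2^-1) - g (j%:R - k%:R - 2^-1).
have hrow k : (nth 0 lam k <= n.+1)%N by rewrite -sl leqW ?nth_le_sumn.
have hcol j : (colY lam j <= n.+1)%N.
  by apply: leq_trans (count_size _ _) _; rewrite -sl leqW ?is_part_size.
transitivity (\sum_(k < n.+1) \sum_(j < n.+1 | (j < nth 0 lam k)%N) d j k).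
  apply: eq_bigr => k _.
  transitivity (\sum_(0 <= j < nth 0%N lam k) d j k); last first.
    by symmetry; apply: (@sum_interval _ 0 n.+1 (fun j => (j < nth 0 lam k)%N) (fun j => d j k) _ (hrow k)).
  pose f j : R := g (j%:R - k%:R - 2^-1).
  rewrite (eq_bigr (fun j => f j.+1 - f j)); last first.
    by move=> j _; rewrite /f /d -natr1; congr (g _ - _); field.
  by rewrite telescope_sumr // /f /vrow /yrow sub0r.
(* Boxes on or right of the diagonal form the arms, giving g (a_i) - g (-1/2); boxes below it form
   the legs, giving g (-1/2) - g (- b_i). *)
under eq_bigr => k _ do rewrite (bigID (fun j : 'I_n.+1 => (k <= j)%N)) /=.
rewrite big_split /=.
have -> : \sum_(k < n.+1) \sum_(j < n.+1 | (j < nth 0 lam k)%N && (k <= j)%N) d j k =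
  \sum_(i < n.+1 | (i < nth 0 lam i)%N) (g (av lam i) - g (- 2^-1)).
  rewrite [RHS]big_mkcond; apply: eq_bigr => k _.
  transitivity (\sum_(k <= j < nth 0%N lam k) d j k).
    apply: (@sum_interval _ k n.+1 (fun j => (j < nth 0 lam k)%N && (k <= j)%N)
      (fun j => d j k) _ (hrow k)) => j; by rewrite andbC.
  rewrite /av; case: ltnP => hk; last by rewrite big_geq.
  pose f j : R := g (j%:R - k%:R - 2^-1).
  rewrite (eq_bigr (fun j => f j.+1 - f j)); last first.
    by move=> j _; rewrite /f /d -natr1; congr (g _ - _); field.
  by rewrite telescope_sumr ?(ltnW hk) // /f subrr sub0r.
rewrite (exchange_big_dep xpredT) //=.
have -> : \sum_(j < n.+1) \sum_(k < n.+1 | (j < nth 0 lam k)%N && ~~ (k <= j)%N) d j k =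
  \sum_(i < n.+1 | (i < nth 0 lam i)%N) (g (- 2^-1) - g (- bv lam i)).
  rewrite [RHS]big_mkcond; apply: eq_bigr => j _.
  transitivity (\sum_(j.+1 <= k < colY lam j) d j k).
    apply: (@sum_interval _ j.+1 n.+1 (fun k => (j < nth 0 lam k)%N && ~~ (k <= j)%N)
      (fun k => d j k) _ (hcol j)) => k; by rewrite -ltnNge andbC colY_lt.
  rewrite /bv -(colY_lt j j hl); case: ltnP => hk; last by rewrite big_geq // leqW.
  pose f k : R := - g (j%:R - k%:R + 2^-1).
  rewrite (eq_bigr (fun k => f k.+1 - f k)); last first.
    move=> k _; rewrite /f /d opprK addrC; congr (- g _ + _); rewrite -natr1; by field.
  rewrite telescope_sumr // /f opprK addrC -natr1; congr (g _ - g _); by field.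
rewrite -big_split /=; apply: eq_bigr => i _; ring.
Qed.

Lemma av_ge0 lam i : 0 <= av lam i.
Proof.
rewrite /av; case: ifP => // h; have : (i%:R + 1 <= (nth 0%N lam i)%:R :> R).
  by rewrite natr1 ler_nat.
lra.
Qed.

Lemma bv_ge0 lam i : is_part lam -> 0 <= bv lam i.
Proof.
rewrite /bv => hl; rewrite -(colY_lt i i hl); case: ifP => // h.
have : (i%:R + 1 <= (colY lam i)%:R :> R) by rewrite natr1 ler_nat.
lra.
Qed.

Lemma av_nonincr lam i : is_part lam -> av lam i.+1 <= av lam i.
Proof.
move=> hl; have hm := is_part_nonincr hl (leqnSn i).
have h0 := av_ge0 lam i; rewrite {1}/av; case: ifP => // h.
rewrite /av ifT; last by lia.
have : (nth 0%N lam i.+1)%:R <= (nth 0%N lam i)%:R :> R by rewrite ler_nat.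
rewrite -natr1; lra.
Qed.

Lemma bv_nonincr lam i : is_part lam -> bv lam i.+1 <= bv lam i.
Proof.
move=> hl; have hm := is_part_nonincr hl (leqnSn i).
have h0 := bv_ge0 i hl; rewrite {1}/bv; case: ifP => // h.
rewrite /bv ifT; last by lia.
have : (colY lam i.+1)%:R <= (colY lam i)%:R :> R by rewrite ler_nat colY_nonincr.
rewrite -natr1; lra.
Qed.

Lemma sum_avbv n lam : is_part lam -> sumn lam = n ->
  \sum_(i < n.+1) (av lam i + bv lam i) = n%:R.
Proof.
move=> hl sl; rewrite -(sum_vrow hl sl) (frobenius_sum id hl sl) [RHS]big_mkcond.
by apply: eq_bigr => i _; rewrite opprK /av /bv; case: ifP => // _; rewrite addr0.
Qed.

Lemma av_large n lam i : is_part lam -> sumn lam = n -> (n < i)%N -> av lam i = 0 /\ bv lam i = 0.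
Proof.
move=> hl sl hi; have e : (i < nth 0 lam i)%N = false.
  by rewrite nth_default ?ltn0 // (leq_trans (is_part_size hl)) // sl ltnW.
by rewrite /av /bv e.
Qed.

Lemma iota_rawE n lam : is_part lam ->
  (forall i, (iota_raw n lam).1 i = av lam i / n%:R) /\
  (forall i, (iota_raw n lam).2 i = bv lam i / n%:R).
Proof.
by move=> hl; split=> i; rewrite /iota_raw /= (dnum_lt i hl) /av /bv; case: ifP => // _; rewrite mul0r.
Qed.

Lemma iota_raw_Thoma n lam : is_part lam -> sumn lam = n -> (0 < n)%N ->
  iota_raw n lam \in Thoma.
Proof.
move=> hl sl n0; have [e1 e2] := iota_rawE n hl.
have nn : 0 <= n%:R^-1 :> R by rewrite invr_ge0.
rewrite inE /=; split; [|split; [|split; [|split]]].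
- by move=> i; rewrite e1 mulr_ge0 ?av_ge0.
- by move=> i; rewrite e2 mulr_ge0 ?bv_ge0.
- by move=> i; rewrite !e1 ler_wpM2r // av_nonincr.
- by move=> i; rewrite !e2 ler_wpM2r // bv_nonincr.
move=> N; under eq_bigr => i _ do rewrite e1 e2 -mulrDl.
rewrite -mulr_suml ler_pdivrMr ?ltr0n // mul1r -(sum_avbv hl sl).
have pos i : 0 <= av lam i + bv lam i by rewrite addr_ge0 ?av_ge0 ?bv_ge0.
have [hN|hN] := leqP N n.+1.
  rewrite (big_ord_widen n.+1 (fun i => av lam i + bv lam i) hN) big_mkcond /=.
  by apply: ler_sum => i _; case: ifP.
rewrite (big_ord_widen N (fun i => av lam i + bv lam i) (ltnW hN)) [leRHS]big_mkcond /=.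
apply: ler_sum => i _; case: ltnP => // hi.
by have [-> ->] := av_large hl sl hi; rewrite addr0.
Qed.

Lemma val_iota_n n lam : is_part lam -> sumn lam = n -> (0 < n)%N ->
  val (iota_n n lam) = iota_raw n lam.
Proof. by move=> hl sl n0; rewrite /iota_n val_insubd iota_raw_Thoma. Qed.

Lemma lim_series_finite (u : nat -> R) M : (forall i, (M <= i)%N -> u i = 0) ->
  limn (series u) = \sum_(i < M) u i.
Proof.
move=> hu; apply: cvg_lim => /=; first exact: Rhausdorff.
suff h : [sequence series u (k + M)%N]_k @ \oo --> \sum_(i < M) u i.
  by move: h; rewrite cvg_shiftn.
rewrite (_ : (fun _ => _) = cst (\sum_(i < M) u i)); first exact: cvg_cst.
apply/funext => k /=; rewrite /series /= addnC /index_iota subn0 iotaD big_cat /= add0n.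
rewrite -(big_mkord xpredT u) /index_iota subn0 [X in _ + X]big1_seq ?addr0 //.
by move=> i /andP[_]; rewrite mem_iota => /andP[h _]; apply: hu.
Qed.

Lemma newton_ext (p p' h : nat -> R) : (forall i, p i.+1 = p' i.+1) -> newton p h -> newton p' h.
Proof. by move=> e [h0 hS]; split=> // k; rewrite hS; apply: eq_bigr => i _; rewrite e. Qed.

(** At i = 1 the scaled row differences sum to 1, matching the convention for p_1. At i >= 2,
    [frobenius_sum] for x^i applies, and - (- b)^i gives the sign of the beta part. *)
Lemma newton_iota n lam : lam \in Yn n -> (0 < n)%N ->
  newton (pscaled n lam) (hfun (pcirc ^~ (iota_n n lam))).
Proof.
rewrite mem_Yn => /andP[hl /eqP sl] n0.
have nz : n%:R != 0 :> R by rewrite pnatr_eq0 -lt0n.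
apply: newton_ext (hfun_newton _) => -[|i].
  rewrite /pcirc eqxx /pscaled expr1; under eq_bigr do rewrite !expr1.
  by rewrite (sum_vrow hl sl) mulVf.
have [e1 e2] := iota_rawE n hl.
rewrite /pcirc /= /alpha /beta (val_iota_n hl sl n0).
rewrite (lim_series_finite (M := n.+1)); last first.
  by move=> k hk; rewrite e1 (av_large hl sl hk).1 mul0r expr0n.
rewrite (lim_series_finite (M := n.+1)); last first.
  by move=> k hk; rewrite e2 (av_large hl sl hk).2 mul0r expr0n.
rewrite /pscaled (frobenius_sum (fun x => x ^+ i.+2) hl sl) [X in _ = _ * X]big_mkcond.
rewrite !mulr_sumr -big_split; apply: eq_bigr => k _; rewrite e1 e2 !expr_div_n /=.
case: ifP => hk; last by rewrite /av /bv hk !expr0n /= !mul0r !mulr0 addr0.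
rewrite [(- bv lam k) ^+ _]exprNn [(-1) ^+ i.+2]exprS; ring.
Qed.

End FrobeniusCoordinates.

(** * Continuity and bounds of power sums on the Thoma simplex *)

Section PowerSums.
Variable K : realType.

Lemma continuous_cst (T : topologicalType) (c : K) : continuous (fun _ : T => c).
Proof. by move=> x; apply: cvg_cst. Qed.

Lemma continuous_add (T : topologicalType) (f g : T -> K) :
  continuous f -> continuous g -> continuous (fun x => f x + g x).
Proof. by move=> hf hg x; apply: cvgD; [apply: hf|apply: hg]. Qed.

Lemma continuous_mul (T : topologicalType) (f g : T -> K) :
  continuous f -> continuous g -> continuous (fun x => f x * g x).
Proof. by move=> hf hg x; apply: cvgM; [apply: hf|apply: hg]. Qed.

Lemma continuous_sumr (T : topologicalType) (I : Type) (r : seq I) (P : pred I) (f : I -> T -> K) :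
  (forall i, P i -> continuous (f i)) -> continuous (fun x => \sum_(i <- r | P i) f i x).
Proof.
move=> hf; elim: r => [|i r IH] x.
  under eq_fun do rewrite big_nil; exact: cvg_cst.
case: (boolP (P i)) => Pi; last first.
  under eq_fun do rewrite big_cons (negPf Pi); exact: IH.
by under eq_fun do rewrite big_cons Pi; apply: cvgD; [apply: hf|apply: IH].
Qed.

Lemma continuous_prodr (T : topologicalType) (I : Type) (r : seq I) (f : I -> T -> K) :
  (forall i, continuous (f i)) -> continuous (fun x => \prod_(i <- r) f i x).
Proof.
move=> hf; elim: r => [|i r IH] x.
  under eq_fun do rewrite big_nil; exact: cvg_cst.
by under eq_fun do rewrite big_cons; apply: cvgM; [apply: hf|apply: IH].
Qed.

Lemma continuous_exprn (T : topologicalType) (f : T -> K) k :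
  continuous f -> continuous (fun x => f x ^+ k).
Proof.
move=> hf; elim: k => [|k IH] x; first by under eq_fun do rewrite expr0; apply: cvg_cst.
by under eq_fun do rewrite exprS; apply: cvgM; [apply: hf|apply: IH].
Qed.

Lemma dist_squeeze (S S' L L' c e : K) : S <= L -> L <= S + c -> S' <= L' -> L' <= S' + c ->
  c < e / 3 -> `|S - S'| < e / 3 -> `|L - L'| < e.
Proof. by move=> h1 h2 h3 h4 h5; rewrite !ltr_norml => /andP[h6 h7]; apply/andP; split; lra. Qed.

Definition simplex_seq (a : nat -> K) :=
  [/\ forall i, 0 <= a i, forall i, a i.+1 <= a i & forall N, \sum_(i < N) a i <= 1].

(** By monotonicity M + 1 times the M-th term is at most the sum of the first M + 1 terms. *)
Lemma simplex_seq_le a M i : simplex_seq a -> (M <= i)%N -> a i <= M.+1%:R^-1.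
Proof.
move=> [a0 am a1] hi; have mono k l : a (k + l)%N <= a k.
  elim: l => [|l IH]; first by rewrite addn0.
  by rewrite addnS; apply: le_trans (am _) IH.
apply: (@le_trans _ _ (a M)); first by rewrite -(subnKC hi) mono.
have := a1 M.+1; rewrite -div1r ler_pdivlMr ?ltr0n //; apply: le_trans.
rewrite mulrC mulr_natl -[X in _ *+ X](card_ord M.+1) -sumr_const.
apply: ler_sum => j _; have hj : (j <= M)%N by rewrite -ltnS ltn_ord.
by rewrite -{1}(subnKC hj) mono.
Qed.

(** One factor a_i is bounded by 1/(M+1) and another is kept for the sum. The bound is the same for
    all sequences, so power sums of degree at least 2 converge uniformly and are continuous; the
    plain sum of coordinates is not. *)
Lemma simplex_tail a k M N : simplex_seq a ->
  \sum_(M <= i < N) a i ^+ k.+2 <= M.+1%:R^-1.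
Proof.
move=> ha; have [a0 am a1] := ha.
apply: (@le_trans _ _ (\sum_(M <= i < N) M.+1%:R^-1 * a i)).
  rewrite big_nat_cond [leRHS]big_nat_cond; apply: ler_sum => i /andP[/andP[hi _] _].
  have ai1 : a i <= 1.
    by apply: le_trans (simplex_seq_le ha (leq0n i)) _; rewrite invr1.
  rewrite exprSr ler_wpM2r // exprS.
  apply: (@le_trans _ _ (a i)); last exact: simplex_seq_le.
  by rewrite ler_piMr // exprn_ile1.
rewrite -mulr_sumr ler_piMr ?invr_ge0 //.
case: (leqP M N) => hMN; last by rewrite big_geq; [exact: ler01|exact: ltnW].
apply: le_trans (a1 N); rewrite -(big_mkord xpredT a) (big_cat_nat (leq0n M) hMN) //=.
by rewrite lerDr sumr_ge0.
Qed.

Lemma series_mkord (a : nat -> K) N : series a N = \sum_(i < N) a i.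
Proof. by rewrite /series /= big_mkord. Qed.

Lemma simplex_power_sum a k : simplex_seq a ->
  cvgn (series (fun i => a i ^+ k.+2)) /\
  forall M, \sum_(i < M) a i ^+ k.+2 <= limn (series (fun i => a i ^+ k.+2))
     <= \sum_(i < M) a i ^+ k.+2 + M.+1%:R^-1.
Proof.
move=> ha; have [a0 am a1] := ha; set u := fun i => a i ^+ k.+2.
have u0 i : 0 <= u i by rewrite exprn_ge0.
have nd : nondecreasing_seq (series u).
  by apply: nondecreasing_series => i _ _.
have bdd M N : series u N <= series u M + M.+1%:R^-1.
  case: (leqP M N) => h.
    rewrite /series /= (big_cat_nat (leq0n M) h) //= lerD2l; exact: simplex_tail.
  apply: le_trans (nd _ _ (ltnW h)) _; by rewrite lerDl invr_ge0.
have cv : cvgn (series u).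
  apply: nondecreasing_is_cvgn => //; exists (series u 0 + 1%:R^-1) => _ [N _ <-].
  exact: bdd.
split=> // M; rewrite -(series_mkord u); apply/andP; split.
  exact: nondecreasing_cvgn_le.
apply: limr_le => //; apply: nearW => N; exact: bdd.
Qed.

Lemma power_sum_continuous (T : topologicalType) (f : nat -> T -> K) k : (forall i, continuous (f i)) ->
  (forall w, simplex_seq (f ^~ w)) ->
  continuous (fun w => limn (series (fun i => f i w ^+ k.+2))).
Proof.
move=> cf sf w; apply/cvgrPdist_lt => e e0.
have [M hM] : exists M : nat, M.+1%:R^-1 < e / 3.
  exists (Num.bound (e / 3)^-1); rewrite invf_plt ?posrE //; last by lra.
  apply: lt_le_trans (archi_boundP _) _; last by rewrite ler_nat.
  rewrite invr_ge0; lra.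
have cS : continuous (fun w => \sum_(i < M) f i w ^+ k.+2).
  by apply: continuous_sumr => i _; apply: continuous_exprn.
have e3 : 0 < e / 3 by lra.
have /cvgrPdist_lt /(_ _ e3) := cS w; apply: filterS => w' /=.
have [_ /(_ M) /andP[h1 h2]] := simplex_power_sum k (sf w).
have [_ /(_ M) /andP[h3 h4]] := simplex_power_sum k (sf w').
set L := limn _ in h1 h2 *; set L' := limn _ in h3 h4 *.
exact: (dist_squeeze h1 h2 h3 h4 hM).
Qed.

Lemma power_sums_le1 (a b : nat -> K) k : simplex_seq a -> simplex_seq b ->
  (forall N, \sum_(i < N) (a i + b i) <= 1) ->
  [/\ 0 <= limn (series (fun i => a i ^+ k.+2)), 0 <= limn (series (fun i => b i ^+ k.+2)) &
  limn (series (fun i => a i ^+ k.+2)) + limn (series (fun i => b i ^+ k.+2)) <= 1].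
Proof.
move=> sa sb s1.
have [ca /(_ 0%N)] := simplex_power_sum k sa; rewrite big_ord0 => /andP[a0 _].
have [cb /(_ 0%N)] := simplex_power_sum k sb; rewrite big_ord0 => /andP[b0 _].
split=> //; rewrite -limD //; apply: limr_le; first exact: is_cvgD.
apply: nearW => N; rewrite [leLHS](_ : _ = \sum_(i < N) (a i ^+ k.+2 + b i ^+ k.+2)); last first.
  by rewrite big_split /= -(series_mkord (fun i => a i ^+ k.+2)) -(series_mkord (fun i => b i ^+ k.+2)).
apply: le_trans (s1 N); apply: ler_sum => i _.
have pw (c : nat -> K) : simplex_seq c -> c i ^+ k.+2 <= c i.
  move=> sc; have [c0 _ _] := sc.
  rewrite exprS ler_piMr //; apply: exprn_ile1 => //.
  by apply: le_trans (simplex_seq_le sc (leq0n i)) _; rewrite invr1.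
by apply: lerD; apply: pw.
Qed.

End PowerSums.

Section Continuity.

Lemma alpha_continuous i : continuous (fun w : Om => alpha w i).
Proof.
move=> w; rewrite /alpha.
apply: (@continuous_comp _ _ _ (fun w : Om => (val w).1) (fun f => f i)).
  apply: (@continuous_comp _ _ _ (fun w : Om => val w) fst).
    exact: initial_continuous.
  exact: cvg_fst.
exact: (@proj_continuous nat (fun _ => R) i).
Qed.

Lemma beta_continuous i : continuous (fun w : Om => beta w i).
Proof.
move=> w; rewrite /beta.
apply: (@continuous_comp _ _ _ (fun w : Om => (val w).2) (fun f => f i)).
  apply: (@continuous_comp _ _ _ (fun w : Om => val w) snd).
    exact: initial_continuous.
  exact: cvg_snd.
exact: (@proj_continuous nat (fun _ => R) i).
Qed.

Lemma Om_simplex (w : Om) : simplex_seq (alpha w) /\ simplex_seq (beta w).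
Proof.
have := valP w; rewrite inE /= => -[a0 [b0 [am [bm s1]]]].
split; split=> // N; apply: le_trans (s1 N); apply: ler_sum => i _.
  by rewrite lerDl.
by rewrite lerDr.
Qed.

Lemma pcirc_continuous k : (0 < k)%N -> continuous (pcirc k).
Proof.
case: k => // -[|k] _; first exact: (@continuous_cst R Om 1).
apply: (@continuous_add R Om (fun w => limn (series (fun i => alpha w i ^+ k.+2)))).
  apply: (@power_sum_continuous R Om (fun i w => alpha w i)) => [i|v].
    exact: alpha_continuous.
  by case: (Om_simplex v).
apply: (@continuous_mul R Om (fun _ => (-1) ^+ k.+1)); first exact: continuous_cst.
apply: (@power_sum_continuous R Om (fun i w => beta w i)) => [i|v].
  exact: beta_continuous.
by case: (Om_simplex v).
Qed.

Lemma hfun_continuous k : continuous (fun w => hfun (pcirc ^~ w) k).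
Proof.
elim/ltn_ind: k => -[|k] IH; first exact: (@continuous_cst R Om 1).
have -> : (fun w => hfun (pcirc ^~ w) k.+1) =
    (fun w => k.+1%:R^-1 * \sum_(i < k.+1) pcirc i.+1 w * hfun (pcirc ^~ w) (k - i)).
  apply/funext => w; have [_ /(_ k) <-] := hfun_newton (pcirc ^~ w).
  by rewrite mulKf // pnatr_eq0.
apply: (@continuous_mul R Om (fun _ => k.+1%:R^-1)); first exact: continuous_cst.
apply: (@continuous_sumr R Om) => i _.
apply: (@continuous_mul R Om (pcirc i.+1)); first exact: pcirc_continuous.
by apply: IH; rewrite ltnS leq_subr.
Qed.

Lemma schur0_continuous mu : continuous (schur0 mu).
Proof.
rewrite /schur0 /determinant; apply: (@continuous_sumr R Om) => s _.
apply: (@continuous_mul R Om (fun _ => (-1) ^+ s)); first exact: continuous_cst.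
apply: (@continuous_prodr R Om) => i.
rewrite (_ : (fun _ => _) = (fun w => if (i <= nth 0 mu i + s i)%N
  then hfun (pcirc ^~ w) (nth 0%N mu i + s i - i) else 0)); last first.
  by apply/funext => w; rewrite mxE.
case: (_ <= _)%N; [exact: hfun_continuous|exact: (@continuous_cst R Om 0)].
Qed.

Lemma pcirc_bound k w : (0 < k)%N -> `|pcirc k w| <= 1.
Proof.
case: k => // -[|k] _; first by rewrite /pcirc eqxx normr1.
have [sa sb] := Om_simplex w; rewrite /pcirc /=.
have := valP w; rewrite inE /= => -[_ [_ [_ [_ s1]]]].
have [a0 b0 le1] := power_sums_le1 k sa sb s1.
apply: le_trans (ler_normD _ _) _; rewrite normrM normrX normrN1 expr1n mul1r.
by rewrite !ger0_norm.
Qed.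

(** Newton's identity makes h_k the mean of k products of modulus at most 1. *)
Lemma hfun_bound k w : `|hfun (pcirc ^~ w) k| <= 1.
Proof.
elim/ltn_ind: k => -[|k] IH; first by rewrite (hfun_newton _).1 normr1.
have kp : 0 < k.+1%:R :> R by rewrite ltr0n.
rewrite -(ler_pM2l kp) -[X in X * _](ger0_norm (ltW kp)) -normrM (hfun_newton _).2 mulr1.
apply: le_trans (ler_norm_sum _ _ _) _.
rewrite -[leRHS]mulr_natl -[X in X%:R](card_ord k.+1).
rewrite mulr_natl -sumr_const; apply: ler_sum => i _; rewrite normrM.
by rewrite -[leRHS]mulr1; apply: ler_pM => //; [apply: pcirc_bound|apply: IH; rewrite ltnS leq_subr].
Qed.

Lemma schur0E mu w : schur0 mu w = schur_h (hfun (pcirc ^~ w)) mu.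
Proof. by []. Qed.

Lemma reldim_schur0 mu : is_part mu ->
  sm (fun n lam => reldim n mu lam - schur0 mu (iota_n n lam)).
Proof.
move=> hm; have [W hW] := vrow_weights_fun.
apply: (reldim_bd_close hW (h := fun n lam => hfun (pcirc ^~ (iota_n n lam)))) => //.
  by move=> n lam; apply: newton_iota.
by move=> k; exists 1, 0%N => n lam _ _; apply: hfun_bound.
Qed.

Lemma schur0_bd mu : bd (fun n lam => schur0 mu (iota_n n lam)).
Proof.
have hb k : bd (fun n lam => hfun (pcirc ^~ (iota_n n lam)) k).
  by exists 1, 0%N => n lam _ _; apply: hfun_bound.
exact: (bd_schur_h (h := fun n lam => hfun (pcirc ^~ (iota_n n lam))) hb mu).
Qed.

End Continuity.

(** * Standard tableaux *)

Section StandardTableaux.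
Local Open Scope nat_scope.
Implicit Types (lam mu nu kap : seq nat) (t : nat -> nat -> nat).

Lemma big_seq_indic (r : seq (seq nat)) (P : pred (seq nat)) x : uniq r -> x \in r ->
  \sum_(y <- r | P y) (y == x) = P x.
Proof.
move=> ur xr; rewrite big_mkcond (bigD1_seq x) //= eqxx big1 ?addn0; first by case: (P x).
by move=> y /negPf ->; case: (P y).
Qed.

Lemma npaths_last k mu kap : is_part mu -> kap \in Yn (sumn mu + k).+1 ->
  npaths k.+1 mu kap = \sum_(lam <- Yn (sumn mu + k) | subdiag lam kap) npaths k mu lam.
Proof.
elim: k mu => [|k IH] mu hm hk.
  rewrite addn0 in hk *; rewrite /= big_seq_indic ?Yn_uniq //.
  under eq_bigr do rewrite eq_sym.
  by rewrite big_seq_indic ?Yn_uniq // mem_Yn hm eqxx.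
transitivity (\sum_(nu <- Yn (sumn mu).+1 | subdiag mu nu)
  \sum_(lam <- Yn (sumn mu + k.+1) | subdiag lam kap) npaths k nu lam).
  rewrite [LHS]/= big_seq_cond [RHS]big_seq_cond; apply: eq_bigr => nu.
  rewrite mem_Yn => /andP[/andP[pn /eqP sn] _]; rewrite -[LHS]/(npaths k.+1 nu kap).
  by rewrite IH ?sn ?addSnnS // addSnnS.
by rewrite exchange_big.
Qed.

(** [is_syt] with the side K of the square separated from [sumn lam], so that the shape can vary
    while the type of the table stays fixed. *)
Definition sytn K lam (T : {ffun 'I_K * 'I_K -> 'I_K.+1}) : bool :=
  let B := ('I_K * 'I_K)%type in
  [forall rc : B, ((rc.2 < nth 0 lam rc.1)%N == (0 < T rc)%N)] &&
  [forall rc : B, forall rc' : B,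
     ((0 < T rc)%N && (T rc == T rc')) ==> (rc == rc')] &&
  [forall rc : B, forall rc' : B,
     [&& (0 < T rc)%N, (0 < T rc')%N, rc.1 == rc'.1 & (rc.2 < rc'.2)%N]
       ==> (T rc < T rc')%N] &&
  [forall rc : B, forall rc' : B,
     [&& (0 < T rc)%N, (0 < T rc')%N, rc.2 == rc'.2 & (rc.1 < rc'.1)%N]
       ==> (T rc < T rc')%N].

Definition dimn K lam := #|[pred T | @sytn K lam T]|.

Lemma dimYE lam : dimY lam = dimn (sumn lam) lam.
Proof. by []. Qed.

(** Tableaux as functions on all pairs of naturals, zero off the diagram: inserting or deleting the
    largest entry then changes no index type. *)
Definition syt_fun lam t := [/\ forall a b, (b < nth 0 lam a) = (0 < t a b),
  forall a b a' b', 0 < t a b -> t a b = t a' b' -> a = a' /\ b = b',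
  forall a b b', 0 < t a b -> 0 < t a b' -> b < b' -> t a b < t a b'
  & forall a a' b, 0 < t a b -> 0 < t a' b -> a < a' -> t a b < t a' b].

Definition tabval K (T : {ffun 'I_K * 'I_K -> 'I_K.+1}) a b : nat :=
  match insub a, insub b with Some a', Some b' => T (a', b') | _, _ => 0 end.

Lemma tabvalE K (T : {ffun 'I_K * 'I_K -> 'I_K.+1}) (a b : 'I_K) : tabval T a b = T (a, b).
Proof. by rewrite /tabval !valK. Qed.

Lemma tabval_gt0 K (T : {ffun 'I_K * 'I_K -> 'I_K.+1}) a b : 0 < tabval T a b ->
  exists a' b' : 'I_K, a = a' /\ b = b'.
Proof.
rewrite /tabval; case: insubP => // a' _ <-; case: insubP => // b' _ <- _.
by exists a', b'.
Qed.

Lemma tabval_le K (T : {ffun 'I_K * 'I_K -> 'I_K.+1}) a b : tabval T a b <= K.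
Proof.
rewrite /tabval; case: insubP => // a' _ _; case: insubP => // b' _ _.
by rewrite -ltnS ltn_ord.
Qed.

Lemma box_bound K lam a b : is_part lam -> sumn lam <= K -> b < nth 0 lam a -> a < K /\ b < K.
Proof.
move=> hl sl hb; split; last by apply: leq_trans hb (leq_trans (nth_le_sumn _ _) sl).
apply: leq_trans (leq_trans (is_part_size hl) sl).
by rewrite -(is_part_gt0 _ hl) (leq_ltn_trans _ hb).
Qed.

Lemma sytP K lam (T : {ffun 'I_K * 'I_K -> 'I_K.+1}) : is_part lam -> sumn lam <= K ->
  reflect (syt_fun lam (tabval T)) (sytn lam T).
Proof.
move=> hl sl; apply: (iffP idP).
  case/andP=> /andP[/andP[/forallP h1 /forallP h2] /forallP h3] /forallP h4; split.
  - move=> a b; apply/idP/idP => hb.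
      have [ha' hb'] := box_bound hl sl hb.
      have /eqP := h1 (Ordinal ha', Ordinal hb').
      by rewrite -(tabvalE T (Ordinal ha') (Ordinal hb')) /= hb => <-.
    have [a' [b' [ea eb]]] := tabval_gt0 hb; subst a b.
    by have /eqP := h1 (a', b'); rewrite -tabvalE hb.
  - move=> a b a' b' h0 e; have h0' : 0 < tabval T a' b' by rewrite -e.
    have [c [d [? ?]]] := tabval_gt0 h0; subst a b.
    have [c' [d' [? ?]]] := tabval_gt0 h0'; subst a' b'.
    have /forallP /(_ (c', d')) := h2 (c, d).
    rewrite -!tabvalE h0 /= -val_eqE /= -!tabvalE e eqxx /=.
    by case/eqP => -> ->.
  - move=> a b b' h0 h0' hb.
    have [c [d [? ?]]] := tabval_gt0 h0; subst a b.
    have [c' [d' [e ?]]] := tabval_gt0 h0'; subst b'; have ? := val_inj e; subst c'.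
    have /forallP /(_ (c, d')) := h3 (c, d).
    by rewrite -!tabvalE h0 h0' eqxx hb.
  move=> a a' b h0 h0' hb.
  have [c [d [? ?]]] := tabval_gt0 h0; subst a b.
  have [c' [d' [? e]]] := tabval_gt0 h0'; subst a'; have ? := val_inj e; subst d'.
  have /forallP /(_ (c', d)) := h4 (c, d).
  by rewrite -!tabvalE h0 h0' eqxx hb.
case=> h1 h2 h3 h4; apply/andP; split; first (apply/andP; split; first (apply/andP; split)).
- by apply/forallP => -[a b]; rewrite -tabvalE h1.
- apply/forallP => -[a b]; apply/forallP => -[a' b']; apply/implyP.
  rewrite -val_eqE /= -!tabvalE => /andP[h0 /eqP e].
  by have [/val_inj -> /val_inj ->] := h2 _ _ _ _ h0 e.
- apply/forallP => -[a b]; apply/forallP => -[a' b']; apply/implyP => /=.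
  rewrite -!tabvalE => /and4P[h0 h0' /eqP e hb]; subst a'; exact: h3.
- apply/forallP => -[a b]; apply/forallP => -[a' b']; apply/implyP => /=.
  rewrite -!tabvalE => /and4P[h0 h0' /eqP e hb]; subst b'; exact: h4.
Qed.

Definition mktab K t : {ffun 'I_K * 'I_K -> 'I_K.+1} :=
  [ffun rc : 'I_K * 'I_K => inord (t rc.1 rc.2)].

Lemma tabval_mktab K lam t : is_part lam -> sumn lam <= K -> syt_fun lam t ->
  (forall a b, t a b <= K) -> forall a b, tabval (mktab K t) a b = t a b.
Proof.
move=> hl sl [h1 _ _ _] hK a b; rewrite /tabval.
case: insubP => [a' _ <-|ha]; last first.
  apply/esym/eqP; rewrite -leqn0 leqNgt -h1; apply/negP => /(box_bound hl sl) [h _].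
  by rewrite h in ha.
case: insubP => [b' _ <-|hb]; last first.
  apply/esym/eqP; rewrite -leqn0 leqNgt -h1; apply/negP => /(box_bound hl sl) [_ h].
  by rewrite h in hb.
by rewrite ffunE inordK // ltnS.
Qed.

Lemma mktab_tabval K t (T : {ffun 'I_K * 'I_K -> 'I_K.+1}) :
  (forall a b, t a b = tabval T a b) -> mktab K t = T.
Proof.
by move=> e; apply/ffunP => -[a b]; rewrite ffunE e tabvalE; apply: val_inj; rewrite /= inordK.
Qed.

Lemma card_boxes K lam : is_part lam -> sumn lam <= K ->
  #|[set rc : 'I_K * 'I_K | rc.2 < nth 0 lam rc.1]%SET| = sumn lam.
Proof.
move=> hl sl; rewrite -sum1dep_card.
rewrite -(pair_big_dep xpredT (fun i j : 'I_K => j < nth 0 lam i) (fun _ _ => 1)) /=.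
rewrite (sumn_nth (leq_trans (is_part_size hl) sl)); apply: eq_bigr => i _.
have hi : nth 0 lam i <= K by apply: leq_trans (nth_le_sumn _ _) sl.
rewrite -(big_ord_widen K (fun _ => 1) hi) sum_nat_const card_ord muln1 //.
Qed.

Lemma syt_max_attained n kap (T : {ffun 'I_n.+1 * 'I_n.+1 -> 'I_n.+2}) : is_part kap ->
  sumn kap = n.+1 -> sytn kap T -> exists a b, tabval T a b = n.+1.
Proof.
move=> hk sk hT; have hs : sumn kap <= n.+1 by rewrite sk.
have [h1 h2 _ _] := sytP T hk hs hT.
pose B := [set rc : 'I_n.+1 * 'I_n.+1 | rc.2 < nth 0 kap rc.1]%SET.
have cB : #|B| = n.+1 by rewrite card_boxes.
have Tinj : {in B &, injective T}.
  move=> [a b] [a' b']; rewrite !inE /= h1 => h0 _ e.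
  have e' : tabval T a b = tabval T a' b' by rewrite !tabvalE e.
  by have [/val_inj -> /val_inj ->] := h2 _ _ _ _ h0 e'.
have sub : T @: B \subset [set~ ord0]%SET.
  apply/fintype.subsetP => x /imsetP[[a b]]; rewrite inE /= h1 tabvalE => h0 ->.
  by rewrite !inE -val_eqE /= -lt0n.
have : T @: B = [set~ ord0]%SET.
  by apply/eqP; rewrite eqEcard sub (card_in_imset Tinj) cB cardsC1 card_ord leqnn.
move/setP/(_ ord_max); rewrite !inE => /imsetP[[a b] _ e].
by exists a, b; rewrite tabvalE -e.
Qed.

Section RemoveMax.
Variables (n : nat) (kap : seq nat) (i : nat).
Hypotheses (pk : is_part kap) (sk : sumn kap = n.+1) (hi : nth 0 kap i.+1 < nth 0 kap i).
Let lam := decr kap i.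
Let c := (nth 0 kap i).-1.

Definition addmax t a b := if (a == i) && (b == c) then n.+1 else t a b.
Definition delmax t a b := if t a b == n.+1 then 0 else t a b.

Lemma syt_addmax t : syt_fun lam t -> (forall a b, t a b <= n) -> syt_fun kap (addmax t).
Proof.
have [pl nl _] := decr_ok pk hi; rewrite -/lam in pl nl.
have lamE a b : (b < nth 0 kap a) = ((a == i) && (b == c)) || (b < nth 0 lam a).
  by rewrite nl (eq_sym i a) /c; case: eqP => [->|_] /=; lia.
move=> [h1 h2 h3 h4] hn; have hN a b : t a b < n.+1 by rewrite ltnS.
split.
- by move=> a b; rewrite lamE h1 /addmax; case: ifP.
- move=> a b a' b'; rewrite /addmax; case: ifP => [/andP[/eqP -> /eqP ->]|_].
    case: ifP => [/andP[/eqP -> /eqP ->]//|_ _ e].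
    by have := hN a' b'; rewrite -e ltnn.
  case: ifP => [_ _ e|_]; last exact: h2.
  by have := hN a b; rewrite e ltnn.
- move=> a b b'; rewrite /addmax; case: ifP => [/andP[/eqP -> /eqP ->]|_].
    case: ifP => [/andP[_ /eqP ->]|_ _]; first by rewrite ltnn.
    by rewrite -h1 nl eqxx /c; lia.
  by case: ifP => [_ _ _ _|_]; [apply: hN|apply: h3].
- move=> a a' b; rewrite /addmax; case: ifP => [/andP[/eqP -> /eqP ->]|_].
    case: ifP => [/andP[/eqP -> _]|_ _]; first by rewrite ltnn.
    rewrite -h1 nl => h h'; have := is_part_nonincr pk h'; rewrite /c in h *; lia.
  by case: ifP => [_ _ _ _|_]; [apply: hN|apply: h4].
Qed.

Lemma syt_delmax t : syt_fun kap t -> (forall a b, t a b <= n.+1) -> t i c = n.+1 ->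
  syt_fun lam (delmax t) /\ forall a b, delmax t a b <= n.
Proof.
have [pl nl _] := decr_ok pk hi; rewrite -/lam in pl nl.
move=> [h1 h2 h3 h4] hn hic.
have top a b : (t a b == n.+1) = (a == i) && (b == c).
  apply/eqP/andP => [e|[/eqP -> /eqP -> //]].
  by have [-> ->] := h2 a b i c ltac:(by rewrite e) ltac:(by rewrite e hic).
split; last first.
  by move=> a b; rewrite /delmax; case: eqP => // /eqP ne; rewrite -ltnS ltn_neqAle ne hn.
have pos a b : 0 < delmax t a b -> delmax t a b = t a b by rewrite /delmax; case: ifP.
split.
- move=> a b; rewrite nl /delmax top -(eq_sym a); case: eqP => [->|_] /=.
    case: eqP => [->|hb] /=; first by rewrite /c; lia.
    by rewrite -h1; rewrite /c in hb; lia.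
  by rewrite subn0 h1.
- move=> a b a' b' h0 e; have h0' : 0 < delmax t a' b' by rewrite -e.
  by apply: h2; rewrite -?(pos _ _ h0) // e pos.
- by move=> a b b' h0 h0' hb; rewrite (pos _ _ h0) (pos _ _ h0'); apply: h3 => //; rewrite -pos.
- by move=> a a' b h0 h0' hb; rewrite (pos _ _ h0) (pos _ _ h0'); apply: h4 => //; rewrite -pos.
Qed.

Lemma card_syt_max :
  #|[set T | @sytn n.+1 kap T & tabval T i c == n.+1]%SET| = dimn n lam.
Proof.
have [pl nl il] := decr_ok pk hi; rewrite -/lam in pl nl il.
have sl : sumn lam = n by apply: succn_inj; rewrite -(sumn_incr _ i) il.
have sln : sumn lam <= n by rewrite sl.
have skn : sumn kap <= n.+1 by rewrite sk.
pose psi (T : {ffun 'I_n * 'I_n -> 'I_n.+1}) := mktab n.+1 (addmax (tabval T)).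
pose phi (T : {ffun 'I_n.+1 * 'I_n.+1 -> 'I_n.+2}) := mktab n (delmax (tabval T)).
have addle t : (forall a b, t a b <= n) -> forall a b, addmax t a b <= n.+1.
  by move=> h a b; rewrite /addmax; case: ifP => // _; rewrite leqW.
have psiE T : sytn lam T -> forall a b, tabval (psi T) a b = addmax (tabval T) a b.
  move=> hT; apply: (tabval_mktab pk skn); last by apply: addle => a b; apply: tabval_le.
  by apply: syt_addmax => [|a b]; [apply/sytP|apply: tabval_le].
have syt_ext lam' t t' : (forall a b, t a b = t' a b) -> syt_fun lam' t -> syt_fun lam' t'.
  by move=> e [h1 h2 h3 h4]; split=> *; rewrite -?e; [apply: h1|apply: h2; rewrite ?e|apply: h3; rewrite ?e|apply: h4; rewrite ?e].
have psiK T : sytn lam T -> phi (psi T) = T.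
  move=> hT; apply: mktab_tabval => a b; rewrite /delmax psiE // /addmax.
  have [h1 _ _ _] := sytP T pl sln hT.
  case: (boolP ((a == i) && (b == c))) => [/andP[/eqP -> /eqP ->]|_].
    rewrite eqxx; apply/esym/eqP; rewrite -leqn0 leqNgt -h1 nl eqxx /c; lia.
  by rewrite ltn_eqF // ltnS tabval_le.
have -> : [set T | @sytn n.+1 kap T & tabval T i c == n.+1]%SET =
    (psi @: [set T | @sytn n lam T])%SET.
  apply/setP => T; apply/idP/imsetP.
    rewrite !inE => /andP[hT /eqP hic].
    have /(sytP T pk skn) hs := hT.
    have [hd hle] := syt_delmax hs (tabval_le T) hic.
    have phiE := tabval_mktab pl sln hd hle.
    exists (phi T).
      rewrite inE; apply/(sytP _ pl sln); apply: syt_ext hd => a b; by rewrite phiE.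
    apply/esym/mktab_tabval => a b; rewrite /addmax; case: ifP => [/andP[/eqP -> /eqP ->]//|h].
    rewrite phiE /delmax; case: eqP => // e.
    have [_ h2 _ _] := hs.
    have [ea eb] := h2 a b i c ltac:(by rewrite e) ltac:(by rewrite e hic).
    by rewrite ea eb !eqxx in h.
  case=> T'; rewrite inE => hT' ->; rewrite inE; apply/andP; split.
    apply/(sytP _ pk skn); have hs := sytP _ pl sln hT'.
    apply: syt_ext (syt_addmax hs (tabval_le T')) => a b; by rewrite psiE.
  by rewrite psiE // /addmax !eqxx.
rewrite card_in_imset; first by rewrite cardsE.
by move=> T T'; rewrite !inE => hT hT' e; rewrite -(psiK T hT) e psiK.
Qed.
End RemoveMax.

Lemma dimn_rec n kap : is_part kap -> sumn kap = n.+1 ->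
  dimn n.+1 kap = \sum_(lam <- Yn n | subdiag lam kap) dimn n lam.
Proof.
move=> hk sk; have hs : sumn kap <= n.+1 by rewrite sk.
rewrite (@sum_down _ kap n n.+1 (dimn n)) //; last by rewrite -sk is_part_size.
under eq_bigr => i hi do rewrite -(card_syt_max hk sk hi).
rewrite /dimn -sum1_card.
under [RHS]eq_bigr do rewrite -sum1dep_card.
under [RHS]eq_bigr do rewrite big_mkcondr.
(* Each tableau is counted once, at the corner that holds its entry n + 1: a neighbour to the right
   or below would have to carry a larger entry. *)
rewrite exchange_big /=; apply: eq_bigr => T hT.
have hf := sytP T hk hs hT; have [h1 h2 h3 h4] := hf.
have [a [b hab]] := syt_max_attained hk sk hT.
have hbox : b < nth 0 kap a by rewrite h1 hab.
have hc : b = (nth 0 kap a).-1.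
  suff : ~~ (b.+1 < nth 0 kap a) by lia.
  apply/negP => hb1.
  have := h3 a b b.+1 ltac:(by rewrite hab) ltac:(by rewrite -h1) (ltnSn b).
  by rewrite hab ltnNge tabval_le.
have ha : nth 0 kap a.+1 < nth 0 kap a.
  rewrite ltnNge; apply/negP => hle.
  have hb1 : b < nth 0 kap a.+1 by apply: leq_trans hbox hle.
  have := h4 a a.+1 b ltac:(by rewrite hab) ltac:(by rewrite -h1) (ltnSn a).
  by rewrite hab ltnNge tabval_le.
have aK : a < n.+1 by case: (box_bound hk hs hbox).
rewrite (bigD1 (Ordinal aK)) //= -hc hab eqxx big1 ?addn0 // => j /andP[_ ja].
case: eqP => // e; case/eqP: ja; apply: val_inj => /=.
by have [] := h2 a b j (nth 0 kap j).-1 ltac:(by rewrite hab) ltac:(by rewrite hab e).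
Qed.

Lemma dimn0 : dimn 0 [::] = 1.
Proof.
rewrite /dimn -[RHS](card1 (mktab 0 (fun _ _ => 0))); apply: eq_card => T; rewrite !inE.
have -> : T = mktab 0 (fun _ _ => 0) by apply/ffunP => -[[]].
rewrite eqxx; apply/sytP => //.
have z a b : tabval (mktab 0 (fun _ _ => 0)) a b = 0 by rewrite /tabval; case: insubP => // -[].
by split=> [a b|a b a' b'|a b b'|a a' b]; rewrite !z ?nth_nil.
Qed.

Lemma dimY_npaths n lam : is_part lam -> sumn lam = n -> dimY lam = npaths n [::] lam.
Proof.
move=> hl sl; rewrite dimYE sl; elim: n lam hl sl => [|n IH] lam hl sl.
  have -> : lam = [::] by apply/nilP; rewrite /nilp -leqn0 -sl is_part_size.
  exact: dimn0.
rewrite dimn_rec // npaths_last //; last by rewrite add0n mem_Yn hl sl eqxx.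
rewrite big_seq_cond [RHS]big_seq_cond; apply: eq_bigr => mu.
by rewrite mem_Yn => /andP[/andP[pm /eqP sm'] _]; apply: IH.
Qed.

End StandardTableaux.

(** * Linear independence of Schur functions *)

Section MonicDegree.
Variable F : comNzRingType.

Definition monic_deg (p : {poly F}) d := p \is monic /\ size p = d.+1.

Lemma monic_deg1 : monic_deg 1 0.
Proof. by split; [apply: monic1|rewrite size_poly1]. Qed.

Lemma monic_degM p q d e : monic_deg p d -> monic_deg q e -> monic_deg (p * q) (d + e).
Proof.
move=> [mp sp] [mq sq]; split; first by rewrite monicMr.
by rewrite size_monicM ?monic_neq0 // sp sq addSn addnS.
Qed.

Lemma monic_deg_prod (I : Type) (r : seq I) (p : I -> {poly F}) (d : I -> nat) :
  (forall i, monic_deg (p i) (d i)) -> monic_deg (\prod_(i <- r) p i) (\sum_(i <- r) d i)%N.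
Proof.
move=> h; elim: r => [|i r IH]; first by rewrite !big_nil; apply: monic_deg1.
by rewrite !big_cons; apply: monic_degM.
Qed.

Lemma monic_degD (p q : {poly F}) d : monic_deg p d -> (size q <= d)%N -> monic_deg (p + q) d.
Proof.
move=> [mp sp] sq; have hs : (size q < size p)%N by rewrite sp.
by split; rewrite ?size_polyDl // monicE lead_coefDl // -monicE.
Qed.

End MonicDegree.

Section LeadingExponents.
Variables (F : comNzRingType) (b : nat -> nat) (N : nat).
Hypothesis b_decr : forall i j, (i < j)%N -> (j < N)%N -> (b j < b i)%N.

(* Elementary symmetric polynomials of the monomials 'X^(b 0), ..., 'X^(b m.-1). *)
Fixpoint esp m k : {poly F} :=
  match m, k with
  | 0, 0 => 1
  | 0, _.+1 => 0
  | m'.+1, 0 => 1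
  | m'.+1, k'.+1 => esp m' k'.+1 + 'X^(b m') * esp m' k'
  end.

Definition edeg k := (\sum_(i < k) b i)%N.

Lemma edegS k : edeg k.+1 = (edeg k + b k)%N.
Proof. by rewrite /edeg big_ord_recr. Qed.

Lemma esp0 m : esp m 0 = 1.
Proof. by case: m. Qed.

(** Since b decreases, the product of the first k monomials is the unique term of highest degree in
    e_k. *)
Lemma esp_deg m k : (m <= N)%N ->
  ((k <= m)%N -> monic_deg (esp m k) (edeg k)) /\ ((m < k)%N -> esp m k = 0).
Proof.
elim: m k => [|m IH] [|k] hm /=.
- by split=> // _; rewrite /edeg big_ord0; apply: monic_deg1.
- by split.
- by split=> // _; rewrite /edeg big_ord0; apply: monic_deg1.
have [h1 h2] := IH k.+1 (ltnW hm); have [h3 h4] := IH k (ltnW hm).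
have mX d : monic_deg ('X^d : {poly F}) d by split; rewrite ?monicXn ?size_polyXn.
split=> hk; last by rewrite h2 ?h4 ?mulr0 ?addr0 // ltnW.
have hM : monic_deg ('X^(b m) * esp m k) (b m + edeg k) by apply: monic_degM => //; apply: h3.
move: hk; rewrite ltnS leq_eqVlt => /orP[/eqP km|km].
  by subst k; rewrite h2 // add0r edegS addnC.
apply: monic_degD; first exact: h1.
by case: hM => _ ->; rewrite edegS addnC ltn_add2l b_decr.
Qed.

Definition schur_poly mu : {poly F} :=
  dt (size mu) (fun i j => if (i <= nth 0%N mu i + j)%N then esp N (nth 0%N mu i + j - i) else 0).

Definition sdeg mu := (\sum_(i < size mu) edeg (nth 0 mu i))%N.

(* The potentials [v] certify that the diagonal term of the Jacobi-Trudi
   determinant strictly dominates every other permutation. *)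
Lemma edeg_potential mu : is_part mu -> (nth 0 mu 0 + size mu <= N)%N -> exists v : nat -> nat,
  forall i j, (i < size mu)%N -> (j < size mu)%N -> (i <= nth 0 mu i + j)%N ->
  (edeg (nth 0 mu i + j - i) + v i <= edeg (nth 0 mu i) + v j)%N /\
  ((i < j)%N -> (edeg (nth 0 mu i + j - i) + v i < edeg (nth 0 mu i) + v j)%N).
Proof.
(* From column j to j + 1 the potential grows by b (mu_(j+1) - 1). Moving right from the diagonal in
   row i, the degree grows by strictly less; moving left, it falls by at least the drop of v. Both
   follow from the monotonicity of b and mu. *)
move=> hm hN; pose v j := (\sum_(k < j) b (nth 0 mu k.+1).-1)%N.
have vS j : v j.+1 = (v j + b (nth 0 mu j.+1).-1)%N by rewrite /v big_ord_recr.
have m0 i : (nth 0 mu i <= nth 0 mu 0)%N by apply: is_part_nonincr.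
exists v.
have up i d : ((i + d).+1 < size mu)%N -> (nth 0 mu i + d < N)%N ->
   (edeg (nth 0 mu i + d).+1 + v i < edeg (nth 0 mu i) + v (i + d).+1)%N.
  have step e : ((i + e).+1 < size mu)%N -> (nth 0 mu i + e < N)%N ->
     (b (nth 0 mu i + e) < b (nth 0 mu (i + e).+1).-1)%N.
    move=> h1 h2; have hpos : (0 < nth 0 mu (i + e).+1)%N by rewrite is_part_gt0.
    have hmono := is_part_nonincr hm (leqW (leq_addr e i)).
    by apply: b_decr => //; lia.
  elim: d => [|d IH] h1 h2; rewrite edegS vS.
    by have := step 0%N h1 h2; rewrite !addn0; lia.
  have := IH ltac:(lia) ltac:(lia); have := step d.+1 h1 h2; rewrite !addnS; lia.
have down i d : (i < size mu)%N -> (d <= i)%N -> (d <= nth 0 mu i)%N ->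
   (edeg (nth 0 mu i - d) + v i <= edeg (nth 0 mu i) + v (i - d))%N.
  elim: d => [|d IH] hi h1 h2; first by rewrite !subn0.
  have m1 := is_part_nonincr hm (leq_subr d i).
  have m2 := is_part_nonincr hm (leq_sub2l i (leqnSn d)).
  have {}IH := IH hi (ltnW h1) (ltnW h2).
  have e1 : (nth 0 mu i - d = (nth 0 mu i - d.+1).+1)%N by lia.
  have e2 : (i - d = (i - d.+1).+1)%N by lia.
  rewrite e1 edegS in IH; rewrite {1}e2 vS -e2 in IH.
  have : (b (nth 0 mu (i - d)).-1 <= b (nth 0 mu i - d.+1))%N.
    have m3 := m0 (i - d)%N.
    case: (ltngtP (nth 0 mu i - d.+1) (nth 0 mu (i - d)).-1)%N => h; last by rewrite h.
      by apply/ltnW/b_decr => //; lia.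
    lia.
  lia.
move=> i j hi hj hij; have mi := m0 i; case: (ltnP i j) => h.
  have [d hd] : exists d, j = (i + d.+1)%N by exists (j - i).-1; lia.
  have := up i d ltac:(lia) ltac:(lia); rewrite hd addnS.
  have -> : (nth 0 mu i + (i + d).+1 - i = (nth 0 mu i + d).+1)%N by lia.
  by move=> hlt; split=> // ; apply: ltnW.
split=> [|//].
have := down i (i - j)%N hi (leq_subr _ _) ltac:(lia).
have -> : (i - (i - j) = j)%N by lia.
by have -> : (nth 0 mu i - (i - j) = nth 0 mu i + j - i)%N by lia.
Qed.

(** If s i <= i for all i, equality of the sums of both sides forces s = 1. *)
Lemma perm_neq1_lt n (s : 'S_n) : s != 1%g -> exists i : 'I_n, (i < s i)%N.
Proof.
move=> hs; apply/existsP; apply: contraNT hs => /existsPn h.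
have hle (i : 'I_n) : true -> (s i <= i)%N by rewrite leqNgt h.
have e : (\sum_i s i = \sum_(i < n) i)%N by rewrite [RHS](reindex_inj (@perm_inj _ s)).
apply/eqP/permP => i; rewrite perm1; apply: val_inj; apply/eqP; rewrite eqn_leq hle //=.
move/eqP: e; rewrite (bigD1 i) //= [X in _ == X](bigD1 i) //=.
set A := (\sum_(_ < _ | _) _)%N; set A' := (\sum_(_ < _ | _) _)%N.
have : (A <= A')%N by apply: leq_sum => j _; apply: hle.
by move=> hA /eqP; lia.
Qed.

Lemma schur_poly_deg mu : is_part mu -> (nth 0 mu 0 + size mu <= N)%N ->
  monic_deg (schur_poly mu) (sdeg mu).
Proof.
move=> hm hN; have [v hv] := edeg_potential hm hN.
have mi i : (nth 0 mu i <= nth 0 mu 0)%N by apply: is_part_nonincr.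
rewrite /schur_poly /dt /determinant (bigD1 (1%g : 'S_(size mu))) //=.
apply: monic_degD.
  rewrite odd_perm1 expr0 mul1r; apply: monic_deg_prod => i.
  rewrite mxE perm1 leq_addl addnK; apply: (esp_deg _ (leqnn N)).1.
  by apply: leq_trans (mi i) _; apply: leq_trans hN; apply: leq_addr.
apply: (leq_trans (size_sum _ _ _)); apply/bigmax_leqP => s hs.
have -> : size ((-1) ^+ s * \prod_i dmx (size mu) (fun i j => if (i <= nth 0%N mu i + j)%N
    then esp N (nth 0%N mu i + j - i) else 0) i (s i)) =
  size (\prod_i dmx (size mu) (fun i j => if (i <= nth 0%N mu i + j)%N
    then esp N (nth 0%N mu i + j - i) else 0) i (s i)).
  by case: (odd_perm s); rewrite /= ?expr1 ?expr0 ?mulN1r ?size_polyN ?mul1r.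
case: (boolP [forall i : 'I_(size mu), (i <= nth 0 mu i + s i)%N]) => [/forallP hall|]; last first.
  case/forallPn => i hi; rewrite (bigD1 i) //= mxE (negPf hi) mul0r size_poly0 //.
have [_ ->] : monic_deg (\prod_i dmx (size mu) (fun i j => if (i <= nth 0%N mu i + j)%N
    then esp N (nth 0%N mu i + j - i) else 0) i (s i))
    (\sum_(i < size mu) edeg (nth 0 mu i + s i - i)).
  apply: monic_deg_prod => i; rewrite mxE hall; apply: (esp_deg _ (leqnn N)).1.
  have := mi i; have := ltn_ord (s i); lia.
have [i0 hi0] := perm_neq1_lt hs.
(* The potentials cancel over a permutation; the index i0, moved to the right, makes the comparison
   with the diagonal strict. *)
have e : (\sum_(i < size mu) v (s i) = \sum_(i < size mu) v i)%N.
  by rewrite [RHS](reindex_inj (@perm_inj _ s)).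
rewrite -(ltn_add2r (\sum_(i < size mu) v i)) /sdeg -{2}e -!big_split /=.
rewrite (bigD1 i0) //= [X in (_ < X)%N](bigD1 i0) //=.
rewrite -addSn leq_add //.
  exact: (hv _ _ (ltn_ord i0) (ltn_ord (s i0)) (hall i0)).2.
by apply: leq_sum => i _; apply: (hv _ _ (ltn_ord i) (ltn_ord (s i)) (hall i)).1.
Qed.

End LeadingExponents.

(** For these exponents [edeg k] telescopes to L k - (B^k - 1). The linear part is constant on a
    level and the convex part separates diagrams; L is large enough to make the natural subtractions
    exact. *)
Lemma sdeg_split L B mu N : is_part mu -> (2 <= B)%N -> (nth 0 mu 0 <= N)%N -> (B ^ N <= L)%N ->
  (sdeg (fun i => L - (B ^ i.+1 - B ^ i)) mu + \sum_(i < size mu) (B ^ nth 0 mu i - 1) =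
   L * sumn mu)%N.
Proof.
move=> hm hB hN hL; rewrite (sumn_nth (leqnn _)) big_distrr /= /sdeg -big_split /=.
apply: eq_bigr => i _; have : (nth 0 mu i <= N)%N.
  by apply: leq_trans hN; apply: is_part_nonincr.
elim: (nth 0%N mu i) => [|k IH] hk; first by rewrite /edeg big_ord0 expn0 muln0.
have {}IH := IH (ltnW hk).
have h1 : (B ^ k <= B ^ k.+1)%N by rewrite leq_exp2l.
have h2 : (B ^ k.+1 <= B ^ N)%N by rewrite leq_exp2l.
have h3 : (0 < B ^ k)%N by rewrite expn_gt0 (leq_trans _ hB).
rewrite edegS mulnS; lia.
Qed.

(** With fewer than B terms the largest part decides: terms with parts at most a sum to less than
    B^(a+1) - 1. *)
Lemma digits_inj B (mu lam : seq nat) : is_part mu -> is_part lam -> (size mu < B)%N ->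
  (size lam < B)%N ->
  (\sum_(x <- mu) (B ^ x - 1) = \sum_(x <- lam) (B ^ x - 1))%N -> mu = lam.
Proof.
elim: mu lam => [|x mu IH] [|y lam] hm hl sm' sl' //.
- case/andP: hl => _ /= /andP[y0 _]; rewrite big_nil big_cons.
  have : (B ^ 1 <= B ^ y)%N by rewrite leq_exp2l //; move: sl' => /=; lia.
  rewrite expn1; move: sl' => /=; lia.
- case/andP: hm => _ /= /andP[y0 _]; rewrite big_nil big_cons.
  have : (B ^ 1 <= B ^ x)%N by rewrite leq_exp2l //; move: sm' => /=; lia.
  rewrite expn1; move: sm' => /=; lia.
have B1 : (1 < B)%N by move: sm' => /=; lia.
have main a s c s' : is_part (a :: s) -> (size (a :: s) < B)%N -> (a < c)%N ->
   (\sum_(x <- a :: s) (B ^ x - 1) < \sum_(x <- c :: s') (B ^ x - 1))%N.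
  move=> hp hs hac.
  have hb : (\sum_(x <- a :: s) (B ^ x - 1) <= \sum_(x <- a :: s) (B ^ a - 1))%N.
    rewrite big_seq [X in (_ <= X)%N]big_seq; apply: leq_sum => z /(nthP 0%N) [k hk <-].
    by rewrite leq_sub2r // leq_exp2l // (is_part_nonincr hp (leq0n k)).
  rewrite big_const_seq count_predT iter_addn_0 in hb.
  apply: (leq_ltn_trans hb); rewrite [X in (_ < X)%N]big_cons.
  have h1 : (B * B ^ a <= B ^ c)%N by rewrite -expnS leq_exp2l.
  have h2 : (0 < B ^ a)%N by rewrite expn_gt0 (ltnW B1).
  have h3 : ((B ^ a - 1) * size (a :: s) <= (B ^ a - 1) * (B - 1))%N.
    by rewrite leq_mul2l; apply/orP; right; lia.
  apply: (leq_ltn_trans h3); apply: (@leq_trans (B ^ c - 1)); last exact: leq_addr.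
  have : ((B ^ a - 1) * (B - 1) + B + B ^ a = B * B ^ a + 1)%N by nia.
  lia.
case: (ltngtP x y) => [xy|yx|<-] e.
- by have := main x mu y lam hm sm' xy; rewrite e ltnn.
- by have := main y lam x mu hl sl' yx; rewrite e ltnn.
rewrite !big_cons in e; congr (_ :: _); apply: IH; last by lia.
- by case/andP: hm => /= /path_sorted h1 /andP[_ h2]; rewrite /is_part h1.
- by case/andP: hl => /= /path_sorted h1 /andP[_ h2]; rewrite /is_part h1.
- exact: ltnW.
- exact: ltnW.
Qed.

Section Independence.

Lemma newton_scale (c : R) (p h : nat -> R) : newton p h ->
  newton (fun i => c ^+ i * p i) (fun k => c ^+ k * h k).
Proof.
move=> [h0 hS]; split=> [|k]; first by rewrite expr0 mul1r.
rewrite mulrCA hS mulr_sumr; apply: eq_bigr => i _.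
have hi : (i <= k)%N by rewrite -ltnS ltn_ord.
have -> : c ^+ k.+1 = c ^+ i.+1 * c ^+ (k - i) by rewrite -exprD addSn subnKC.
ring.
Qed.

Section Point.
Variables (b : nat -> nat) (N : nat) (t : R).
Hypothesis b_decr : forall i j, (i < j)%N -> (j < N.+1)%N -> (b j < b i)%N.
Hypothesis t1 : 1 <= t.

Lemma esp_newton m : newton (fun i => \sum_(j < m) - (- t ^+ b j) ^+ i) (fun k => (esp R b m k).[t]).
Proof.
elim: m => [|m IH].
  split=> [|k]; first by rewrite hornerE.
  by rewrite /= horner0 mulr0 big1 // => i _; rewrite big_ord0 mul0r.
have [a0 aS] : newton (fun i => \sum_(j < m) - (- t ^+ b j) ^+ i - (- t ^+ b m) ^+ i)
    (fun k => (esp R b m.+1 k).[t]).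
  apply: newton_mul IH _ _ => [|k]; first by rewrite esp0 hornerE.
  by rewrite /= hornerD hornerM hornerXn mulNr opprK.
by split=> // k; rewrite aS; apply: eq_bigr => i _; rewrite big_ord_recr.
Qed.

(** Dividing by [ptS] makes the beta coordinates sum to 1, so the value 1 assigned to p_1 is their
    actual sum and h_k becomes their elementary symmetric polynomial. *)
Definition ptS := \sum_(j < N.+1) t ^+ b j.
Definition pt_raw : Xamb := (fun _ => 0, fun i => if (i < N.+1)%N then t ^+ b i / ptS else 0).
Definition pt : Om := insubd om0 pt_raw.

Let t0 : 0 < t. Proof. exact: lt_le_trans t1. Qed.

Lemma ptS_gt0 : 0 < ptS.
Proof.
rewrite /ptS big_ord_recl ltr_wpDr ?exprn_gt0 //.
by apply: sumr_ge0 => i _; rewrite exprn_ge0 // ltW.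
Qed.

Lemma pt_Thoma : pt_raw \in Thoma.
Proof.
have S0 := ptS_gt0.
have pos i : 0 <= pt_raw.2 i.
  by rewrite /=; case: ifP => // _; rewrite divr_ge0 ?exprn_ge0 // ltW.
rewrite inE /=; split; [|split; [|split; [|split]]] => //.
- move=> i; rewrite /pt_raw /=; case: ifP => h; last exact: (pos i).
  rewrite ltnW // ler_wpM2r ?invr_ge0 ?(ltW S0) // ler_weXn2l //.
  exact/ltnW/b_decr.
move=> K; under eq_bigr do rewrite add0r.
have tot : \sum_(i < N.+1) (if (i < N.+1)%N then t ^+ b i / ptS else 0) = 1.
  under eq_bigr => i _ do rewrite ltn_ord.
  by rewrite -mulr_suml divff // gt_eqF.
have [hK|hK] := leqP K N.+1.
  rewrite -tot (big_ord_widen N.+1 (fun i => pt_raw.2 i) hK) big_mkcond /=.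
  by apply: ler_sum => i _; case: ifP => // _; apply: (pos i).
rewrite -tot [leRHS](big_ord_widen K (fun i => pt_raw.2 i) (ltnW hK)) [leRHS]big_mkcond /=.
by apply: ler_sum => i _; case: ifP.
Qed.

Lemma hfun_pt k : hfun (pcirc ^~ pt) k = ptS^-1 ^+ k * (esp R b N.+1 k).[t].
Proof.
have S0 := ptS_gt0; have Sn : ptS != 0 by rewrite gt_eqF.
apply: newton_uniq (hfun_newton _) (newton_scale ptS^-1 (esp_newton N.+1)) _ => -[|i].
  rewrite /pcirc eqxx expr1 -(mulVf Sn); congr (_ * _).
  by apply: eq_bigr => j _; rewrite expr1 opprK.
rewrite /pcirc /= /alpha /beta val_insubd pt_Thoma /=.
rewrite (lim_series_finite (M := 0)); last by move=> j _; rewrite expr0n.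
rewrite big_ord0 add0r (lim_series_finite (M := N.+1)); last first.
  by move=> j hj; rewrite ltnNge hj expr0n.
rewrite !mulr_sumr; apply: eq_bigr => j _; rewrite ltn_ord expr_div_n.
rewrite [(- (t ^+ b j)) ^+ _]exprNn [(-1) ^+ i.+2]exprS exprVn; ring.
Qed.

Lemma schur_poly_eval mu :
  (schur_poly R b N.+1 mu).[t] = dt (size mu) (fun i j => if (i <= nth 0%N mu i + j)%N
     then (esp R b N.+1 (nth 0%N mu i + j - i)).[t] else 0).
Proof.
rewrite /schur_poly /dt -[LHS]/(horner_eval t _) -det_map_mx; congr determinant.
by apply/matrixP => i j; rewrite !mxE; case: ifP => _; rewrite /= /horner_eval ?horner0.
Qed.

Lemma schur0_pt mu : schur0 mu pt = ptS^-1 ^+ sumn mu * (schur_poly R b N.+1 mu).[t].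
Proof.
have S0 := ptS_gt0; have Sn : ptS != 0 by rewrite gt_eqF.
rewrite schur_poly_eval schur0E.
transitivity (dt (size mu) (fun i j => (ptS^-1 ^+ nth 0%N mu i * ptS ^+ i) *
  (if (i <= nth 0%N mu i + j)%N then (esp R b N.+1 (nth 0%N mu i + j - i)).[t] else 0)
  * ptS^-1 ^+ j)).
  apply: eq_dt => i j _ _; case: ifP => h; last by rewrite mulr0 mul0r.
  rewrite hfun_pt mulrAC; congr (_ * _).
  have -> : ptS ^+ i = ptS^-1 ^- i by rewrite exprVn invrK.
  have cn : ptS^-1 ^+ i != 0 by rewrite expf_neq0 // invr_eq0.
  by apply: (mulIf cn); rewrite -exprD subnK // mulrAC divfK // exprD.
rewrite dt_scale; congr (_ * _); rewrite -big_split /=.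
rewrite (eq_bigr (fun i : 'I_(size mu) => ptS^-1 ^+ nth 0%N mu i)).
  by rewrite (sumn_nth (leqnn _)) expr_sum.
by move=> i _; rewrite -mulrA -exprMn divff // expr1n mulr1.
Qed.
End Point.

Lemma poly_vanish (p : {poly R}) : (forall t, 1 <= t -> p.[t] = 0) -> p = 0.
Proof.
move=> h; apply: (@roots_geq_poly_eq0 _ p [seq k.+1%:R | k <- iota 0 (size p)]).
- by apply/allP => x /mapP[k _ ->]; apply/eqP/h; rewrite ler1n.
- rewrite map_inj_uniq ?iota_uniq // => i j /eqP; by rewrite eqr_nat => /eqP [].
- by rewrite size_map size_iota.
Qed.

Lemma schur0_independent M (c : seq nat -> R) :
  (forall w, \sum_(mu <- Yn M) c mu * schur0 mu w = 0) ->
  forall mu, mu \in Yn M -> c mu = 0.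
Proof.
(* B exceeds the number of rows of every diagram of level M, as [digits_inj] requires; N + 1
   variables cover mu_0 + size mu <= 2M; L = B^(N+1) dominates every B^(i+1) with i <= N. *)
move=> hc; pose B := M.+2; pose N := (M + M)%N; pose L := (B ^ N.+1)%N.
pose b i := (L - (B ^ i.+1 - B ^ i))%N.
have bd i j : (i < j)%N -> (j < N.+1)%N -> (b j < b i)%N.
  move=> hij hj; rewrite /b; have h1 : (B ^ j.+1 <= L)%N by rewrite leq_exp2l.
  have h2 : (B * B ^ i <= B ^ j)%N by rewrite -expnS leq_exp2l.
  have h3 : (0 < B ^ i)%N by rewrite expn_gt0.
  rewrite !expnS in h1 *; rewrite /B in h1 h2 h3 *; nia.
have inY mu : mu \in Yn M -> [/\ is_part mu, sumn mu = M, (nth 0 mu 0 + size mu <= N.+1)%N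
    & (size mu < B)%N].
  rewrite mem_Yn => /andP[hm /eqP sm']; have h1 := is_part_size hm.
  have h2 := nth_le_sumn mu 0.
  rewrite sm' in h1 h2; split=> //; last exact: leqW.
  by rewrite leqW // leq_add.
pose P : {poly R} := \sum_(mu <- Yn M) c mu *: schur_poly R b N.+1 mu.
have P0 : P = 0.
  apply: poly_vanish => t t1; have S0 := ptS_gt0 b N t1.
  have := hc (pt b N t); rewrite (eq_big_seq (fun mu =>
     (ptS b N t)^-1 ^+ M * (c mu * (schur_poly R b N.+1 mu).[t]))).
    rewrite -mulr_sumr => /eqP; rewrite mulf_eq0 expf_eq0 invr_eq0 (gt_eqF S0) andbF /=.
    by move/eqP => <-; rewrite /P horner_sum; apply: eq_bigr => mu _; rewrite hornerZ.
  move=> mu /inY [_ sm' _ _]; rewrite (schur0_pt bd t1) sm'; ring.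
have dinj mu nu : mu \in Yn M -> nu \in Yn M -> sdeg b mu = sdeg b nu -> mu = nu.
  move=> /inY [p1 s1 n1 z1] /inY [p2 s2 n2 z2] e.
  have B2 : (2 <= B)%N by [].
  have q1 := sdeg_split (L := L) p1 B2 (leq_trans (leq_addr _ _) n1) (leqnn _).
  have q2 := sdeg_split (L := L) p2 B2 (leq_trans (leq_addr _ _) n2) (leqnn _).
  apply: (digits_inj p1 p2 z1 z2); rewrite [LHS](big_nth 0%N) [RHS](big_nth 0%N) !big_mkord.
  by move: q1 q2; rewrite -/b s1 s2 e => <- /addnI.
move=> mu0 hmu0; apply/eqP; apply: contraT => cne.
(* Among the diagrams with nonzero coefficient, the one of largest degree d is alone in that degree,
   so its leading term survives in P. *)
pose Q d := has (fun mu => (c mu != 0) && (sdeg b mu == d)) (Yn M).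
have exQ : exists d, Q d by exists (sdeg b mu0); apply/hasP; exists mu0; rewrite ?cne ?eqxx.
have bdQ d : Q d -> (d <= L * M)%N.
  case/hasP => mu /inY [p1 s1 n1 _] /andP[_ /eqP <-].
  have := sdeg_split (L := L) p1 (isT : (2 <= B)%N) (leq_trans (leq_addr _ _) n1) (leqnn _).
  rewrite s1 => <-; exact: leq_addr.
case: (ex_maxnP exQ bdQ) => d /hasP[mu hmu /andP[cmu /eqP dmu]] dmax.
have : P`_d = c mu.
  rewrite /P coef_sum (bigD1_seq mu) ?Yn_uniq //= big_seq_cond big1 ?addr0.
    have [p1 _ n1 _] := inY _ hmu; have [m1 s1] := schur_poly_deg R bd p1 n1.
    rewrite coefZ -dmu -[X in _`_X]/((sdeg b mu).+1.-1) -s1 -/(lead_coef _).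
    by rewrite (monicP m1) mulr1.
  move=> nu /andP[hnu nemu]; rewrite coefZ; have [->|cnu] := eqVneq (c nu) 0; first by rewrite mul0r.
  have [p1 _ n1 _] := inY _ hnu; have [_ s1] := schur_poly_deg R bd p1 n1.
  have hle : (sdeg b nu <= d)%N by apply: dmax; apply/hasP; exists nu; rewrite ?cnu ?eqxx.
  rewrite nth_default ?mulr0 // s1 ltn_neqAle hle andbT.
  by apply: contraNN nemu => /eqP e; apply/eqP/dinj => //; rewrite e dmu.
by rewrite P0 coef0 => /esym/eqP; rewrite (negPf cmu).
Qed.

End Independence.

(** * The z-measures and orthogonality *)

Section RealParameters.
Variables (z z' : C).
Hypothesis adm : admissible z z'.

Definition zs : R := complex.Re (z * z').
Definition ztau : R := complex.Re (z + z').

Lemma complex_realE (x : C) : complex.Im x = 0 -> x = real_complex R (complex.Re x).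
Proof. by case: x => a b /= ->. Qed.

Lemma mul_zz' : z * z' = real_complex R zs.
Proof.
apply: complex_realE; case: adm => [[_ ->]|[N [h1 [h2 _]]]].
  by case: (z) => a b /=; ring.
by move: h1 h2; case: (z) => a b; case: (z') => c d /= -> ->; ring.
Qed.

Lemma add_zz' : z + z' = real_complex R ztau.
Proof.
apply: complex_realE; case: adm => [[_ ->]|[N [h1 [h2 _]]]].
  by case: (z) => a b /=; ring.
by move: h1 h2; case: (z) => a b; case: (z') => c d /= -> ->; ring.
Qed.

Notation zw := (wc zs ztau).
Notation zwt := (wt zs ztau).

Lemma mul_shift (x : R) :
  (z + real_complex R x) * (z' + real_complex R x) = real_complex R (zw x).
Proof.
rewrite /wc !rmorphD rmorphM rmorphXn /= -mul_zz' -add_zz'; ring.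
Qed.

(** In the principal series the value is |z + x|^2. In the complementary series z + x and z' + x lie
    between the same consecutive integers and so have the same sign. *)
Lemma zw_gt0 (j r : nat) : 0 < zw (j%:R - r%:R).
Proof.
rewrite /wc /zs /ztau; case: adm => [[h ->]|[N [h1 [h2 [h3 h4]]]]].
  move: h; case: (z) => a b /= b0; set x := j%:R - r%:R.
  have -> : a * a - b * - b + (a + a) * x + x ^+ 2 = (a + x) ^+ 2 + b ^+ 2 by ring.
  by rewrite ltr_wpDl ?sqr_ge0 // exprn_even_gt0.
move: h1 h2 h3 h4; case: (z) => a b; case: (z') => c d /= -> -> h3 h4.
have -> : a * c - 0 * 0 + (a + c) * (j%:R - r%:R) + (j%:R - r%:R) ^+ 2 =
  (a + (j%:R - r%:R)) * (c + (j%:R - r%:R)) :> R by ring.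
have e : j%:R - r%:R = (j%:Z - r%:Z)%:~R :> R by rewrite rmorphB /=.
rewrite e; set k := (j%:Z - r%:Z); have [hk|hk] := lerP 0 (N + k).
  have hk' : 0 <= N%:~R + k%:~R :> R by rewrite -rmorphD /= ler0z.
  by apply: mulr_gt0; case/andP: h3 => ? ?; case/andP: h4 => ? ?; lra.
have hk' : (N + 1)%:~R + k%:~R <= 0 :> R by rewrite -rmorphD /= lerz0; lia.
by rewrite nmulr_rgt0; case/andP: h3 => ? ?; case/andP: h4 => ? ?; lra.
Qed.

Lemma zs_gt0 : 0 < zs.
Proof. by have := zw_gt0 0 0; rewrite subrr /wc mulr0 expr0n !addr0. Qed.

Definition wskew mu nu : R :=
  \prod_(r < size mu) \prod_((nth 0 nu r).+1 <= j < (nth 0 mu r).+1) zw (j%:R - r.+1%:R).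

Lemma skew_poch_mul mu nu :
  skew_poch z mu nu * skew_poch z' mu nu = real_complex R (wskew mu nu).
Proof.
rewrite /skew_poch -big_split /= /wskew rmorph_prod; apply: eq_bigr => r _.
rewrite -big_split /= rmorph_prod; apply: eq_bigr => j _.
by rewrite -[RHS]/(real_complex R _) -mul_shift rmorphB !rmorph_nat !addrA.
Qed.

Lemma wskewE mu nu K : (size mu <= K)%N ->
  wskew mu nu = \prod_(r < K) \prod_((nth 0 nu r).+1 <= j < (nth 0 mu r).+1) zw (j%:R - r.+1%:R).
Proof.
move=> h; rewrite /wskew.
rewrite (big_ord_widen K (fun r => \prod_((nth 0 nu r).+1 <= j < (nth 0 mu r).+1)
  zw (j%:R - r.+1%:R)) h) big_mkcond; apply: eq_bigr => r _.
by case: ltnP => // hr; rewrite (nth_default _ hr) big_geq.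
Qed.

Lemma wskew_incr nu i : wskew (incr_nth nu i) nu = zwt (incr_nth nu i) nu.
Proof.
rewrite wt_incr; pose K := (size (incr_nth nu i) + i.+1)%N.
have hi : (i < K)%N by rewrite /K addnS ltnS leq_addl.
rewrite (@wskewE _ _ K) ?leq_addr // (bigD1 (Ordinal hi)) //= [X in _ * X]big1 ?mulr1.
  by rewrite nth_incr_nth eqxx add1n big_nat1 /cont -!natr1; congr zw; ring.
move=> r; rewrite -val_eqE /= => /negPf hr.
by rewrite nth_incr_nth eq_sym hr add0n big_geq.
Qed.

Lemma wskew_incr0 nu i : wskew (incr_nth nu i) [::] = wskew nu [::] * zwt (incr_nth nu i) nu.
Proof.
rewrite wt_incr; pose K := (size nu + size (incr_nth nu i) + i.+1)%N.
have hi : (i < K)%N by rewrite /K addnS ltnS leq_addl.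
have h1 : (size (incr_nth nu i) <= K)%N by rewrite /K -addnA addnCA leq_addr.
have h2 : (size nu <= K)%N by rewrite /K -addnA leq_addr.
rewrite (wskewE _ h1) (wskewE _ h2).
rewrite (bigD1 (Ordinal hi)) //= [in RHS](bigD1 (Ordinal hi)) //=.
rewrite nth_nil nth_incr_nth eqxx add1n [X in X * _ = _]big_nat_recr //= [RHS]mulrAC.
congr (_ * _ * _).
  by rewrite /cont -!natr1; congr zw; ring.
apply: eq_bigr => r; rewrite -val_eqE /= => /negPf hr.
by rewrite nth_incr_nth eq_sym hr add0n.
Qed.

Lemma wskew_gt0 mu : 0 < wskew mu [::].
Proof.
by apply: prodr_gt0 => r _; apply: prodr_gt0 => j _; apply: zw_gt0.
Qed.

Lemma sigmazE m : sigmaz z z' m = m%:R * (m%:R - 1 + zs).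
Proof. by []. Qed.

Lemma AschurE mu w : is_part mu -> Aschur z z' mu w = - sigmaz z z' (sumn mu) * schur0 mu w +
  \sum_(tau <- Yn (sumn mu).-1 | (0 < sumn mu)%N && subdiag tau mu) zwt mu tau * schur0 tau w.
Proof.
move=> hm; rewrite /Aschur; congr (_ + _).
under eq_bigl do rewrite -andbA.
rewrite (@sum_isY _ _ (fun tau => (0 < sumn mu)%N && subdiag tau mu)
  (fun tau => complex.Re (skew_poch z mu tau * skew_poch z' mu tau) * schur0 tau w)).
rewrite big_seq_cond [RHS]big_seq_cond; apply: eq_bigr => tau.
rewrite mem_Yn => /andP[/andP[pt /eqP st] /andP[m0 hs]].
have [|i _ e] := cover_incr pt hm hs; first by rewrite st prednK.
by rewrite skew_poch_mul /= {1 2}e wskew_incr -e.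
Qed.

Definition zm n lam : R :=
  wskew lam [::] / (\prod_(i < n) (zs + i%:R)) * (npaths n [::] lam)%:R ^+ 2 / n`!%:R.

Lemma zmeasE n lam : lam \in Yn n -> complex.Re (zmeas z z' n lam) = zm n lam.
Proof.
rewrite mem_Yn => /andP[hl /eqP sl]; rewrite /zmeas /poch skew_poch_mul.
have -> : rising (z * z') n = real_complex R (\prod_(i < n) (zs + i%:R)).
  rewrite /rising rmorph_prod; apply: eq_bigr => i _.
  by rewrite mul_zz' rmorphD /= rmorph_nat.
rewrite (dimY_npaths hl sl) -(rmorph_nat (real_complex R)) -(rmorph_nat (real_complex R) n`!).
rewrite -fmorphV -rmorphM -rmorphM -fmorphV -rmorphM /= /zm natrX //.
Qed.

Lemma zm_ge0 n lam : 0 <= zm n lam.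
Proof.
rewrite /zm !mulr_ge0 ?invr_ge0 ?ler0n ?sqr_ge0 // ?(ltW (wskew_gt0 _)) //.
by apply: prodr_ge0 => i _; rewrite addr_ge0 ?(ltW zs_gt0).
Qed.

(** Detailed balance: M_(n+1) times the down transition probability equals M_n times the up
    transition probability. *)
Lemma zm_cover n lam kap : lam \in Yn n -> kap \in Yn n.+1 -> subdiag lam kap ->
  zm n.+1 kap * ((npaths n [::] lam)%:R / (npaths n.+1 [::] kap)%:R) =
  zm n lam / ((n.+1%:R) * (n%:R + zs)) * zwt kap lam *
    ((npaths n.+1 [::] kap)%:R / (npaths n [::] lam)%:R).
Proof.
rewrite !mem_Yn => /andP[pl /eqP sl] /andP[pk /eqP sk] hs.
have [|i _ e] := cover_incr pl pk hs; first by rewrite sl.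
have dl : (npaths n [::] lam)%:R != 0 :> R by rewrite pnatr_eq0 -lt0n npaths_gt0.
have dk : (npaths n.+1 [::] kap)%:R != 0 :> R by rewrite pnatr_eq0 -lt0n npaths_gt0.
have ek : wskew kap [::] = wskew lam [::] * zwt kap lam by rewrite {1 2}e wskew_incr0.
have s0 := zs_gt0.
have pn : \prod_(i < n) (zs + i%:R) != 0.
  by rewrite gt_eqF //; apply: prodr_gt0 => j _; rewrite ltr_wpDr.
have sn : n%:R + zs != 0 by rewrite gt_eqF // ltr_wpDl.
have fn : n`!%:R != 0 :> R by rewrite pnatr_eq0 -lt0n fact_gt0.
have n1 : 1 + n%:R != 0 :> R by rewrite nat1r pnatr_eq0.
rewrite /zm ek big_ord_recr /= factS natrM [zs + n%:R]addrC.
set a := (npaths n [::] lam)%:R in dl *; set b := (npaths n.+1 [::] kap)%:R in dk *.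
set p := \prod_(_ < _) _ in pn *; set f := n`!%:R in fn *.
by field; rewrite pn sn fn n1 dl dk.
Qed.

(** The weighted step at lam is moved along the paths down to mu. Each level j from m to n
    contributes the commutator zs + 2j, and these sum to (k + 1)(n + m + zs). *)
Lemma npaths_up k m n mu lam : is_part mu -> sumn mu = m -> (m + k)%N = n -> lam \in Yn n ->
  \sum_(kap <- Yn n.+1 | subdiag lam kap) zwt kap lam * (npaths k.+1 mu kap)%:R =
  k.+1%:R * ((n + m)%:R + zs) * (npaths k mu lam)%:R +
  \sum_(tau <- Yn m.-1 | (0 < m)%N && subdiag tau mu) zwt mu tau * (npaths k.+1 tau lam)%:R.
Proof.
elim: k m mu => [|k IH] m mu hm sm' emn hl.
  rewrite addn0 in emn; subst n; have := hl; rewrite mem_Yn => /andP[pl /eqP sl].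
  have := commutation zs ztau hm pl sm' sl => hc.
  transitivity (\sum_(nu <- Yn m.+1 | subdiag mu nu && subdiag lam nu) zwt nu lam).
    rewrite big_mkcond [RHS]big_mkcond big_seq [RHS]big_seq; apply: eq_bigr => kap hk.
    rewrite /= big_seq_indic ?Yn_uniq ?sm' //.
    by rewrite andbC; case: (subdiag lam kap); case: (subdiag mu kap); rewrite /= ?mulr1 ?mulr0.
  rewrite hc addrC mul1r; congr (_ + _).
    rewrite /=; case: eqP => _; rewrite ?mulr0 // mulr1 addnn -mul2n natrM; ring.
  rewrite big_mkcond [RHS]big_mkcond big_seq [RHS]big_seq; apply: eq_bigr => tau.
  rewrite mem_Yn => /andP[pt /eqP st]; rewrite andbA; case: (boolP ((0 < m)%N && subdiag tau mu)) => //=.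
  move=> /andP[m0 _]; rewrite st prednK // big_seq_indic ?Yn_uniq //.
  by case: (subdiag tau lam); rewrite ?mulr1 ?mulr0.
transitivity (\sum_(nu <- Yn m.+1 | subdiag mu nu)
   \sum_(kap <- Yn n.+1 | subdiag lam kap) zwt kap lam * (npaths k.+1 nu kap)%:R).
  rewrite exchange_big /=; apply: eq_bigr => kap _.
  by rewrite -mulr_sumr -natr_sum sm'.
transitivity (\sum_(nu <- Yn m.+1 | subdiag mu nu)
  (k.+1%:R * ((n + m.+1)%:R + zs) * (npaths k nu lam)%:R +
   \sum_(tau <- Yn m | subdiag tau nu) zwt nu tau * (npaths k.+1 tau lam)%:R)).
  rewrite big_seq_cond [RHS]big_seq_cond; apply: eq_bigr => nu.
  rewrite mem_Yn => /andP[/andP[pn /eqP sn] _].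
  by rewrite (IH m.+1) //; rewrite -emn addSnnS.
rewrite big_split /= -mulr_sumr -natr_sum -sm' -/(npaths k.+1 mu lam) sm'.
transitivity (k.+1%:R * ((n + m.+1)%:R + zs) * (npaths k.+1 mu lam)%:R +
  \sum_(tau <- Yn m) (npaths k.+1 tau lam)%:R *
    \sum_(nu <- Yn m.+1 | subdiag mu nu && subdiag tau nu) zwt nu tau).
  congr (_ + _); rewrite (exchange_big_dep xpredT) //=; apply: eq_bigr => tau _.
  by rewrite mulr_sumr; apply: eq_bigr => nu _; rewrite mulrC.
have -> : \sum_(tau <- Yn m) (npaths k.+1 tau lam)%:R *
    \sum_(nu <- Yn m.+1 | subdiag mu nu && subdiag tau nu) zwt nu tau =
  \sum_(tau <- Yn m.-1 | (0 < m)%N && subdiag tau mu) zwt mu tau * (npaths k.+2 tau lam)%:R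
  + (zs + 2 * m%:R) * (npaths k.+1 mu lam)%:R.
  transitivity (\sum_(tau <- Yn m) ((npaths k.+1 tau lam)%:R *
    (\sum_(r <- Yn m.-1 | (0 < m)%N && (subdiag r mu && subdiag r tau)) zwt mu r) +
    (npaths k.+1 tau lam)%:R * (if mu == tau then zs + 2 * m%:R else 0))).
    rewrite big_seq [RHS]big_seq; apply: eq_bigr => tau; rewrite mem_Yn => /andP[pt /eqP st].
    by rewrite (commutation zs ztau hm pt sm' st) mulrDr.
  rewrite big_split /=; congr (_ + _).
    under eq_bigr do rewrite mulr_sumr.
    rewrite (exchange_big_dep (fun r => (0 < m)%N && subdiag r mu)) /=; last first.
      by move=> tau r _ /and3P[-> ->].
    rewrite big_seq_cond [RHS]big_seq_cond; apply: eq_bigr => r.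
    rewrite mem_Yn => /andP[/andP[pr /eqP sr] /andP[m0 hr]].
    rewrite natr_sum mulr_sumr sr prednK //; apply: eq_big => [tau|tau _]; last by rewrite mulrC.
    by rewrite m0 hr.
  rewrite (bigD1_seq mu) ?Yn_uniq ?mem_Yn ?hm ?sm' ?eqxx //= [X in _ + X]big1 ?addr0 1?mulrC //.
  by move=> tau /negPf ht; rewrite eq_sym ht mulr0.
rewrite addrCA addrC; congr (_ + _).
rewrite -mulrDl; congr (_ * _); rewrite -emn !natrD -!natr1; ring.
Qed.

Definition Areldim n mu lam : R := - sigmaz z z' (sumn mu) * reldim n mu lam +
  \sum_(tau <- Yn (sumn mu).-1 | (0 < sumn mu)%N && subdiag tau mu) zwt mu tau * reldim n tau lam.

Definition zE n (f : seq nat -> R) := \sum_(lam <- Yn n) zm n lam * f lam.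

Lemma reldim_down n nu kap : is_part nu -> (sumn nu <= n)%N -> kap \in Yn n.+1 ->
  reldim n.+1 nu kap = \sum_(lam <- Yn n | subdiag lam kap)
    (npaths n [::] lam)%:R / (npaths n.+1 [::] kap)%:R * reldim n nu lam.
Proof.
move=> hn hnn hk; rewrite /reldim subSn // npaths_last ?subnKC // natr_sum mulr_suml.
rewrite big_seq_cond [RHS]big_seq_cond; apply: eq_bigr => lam.
rewrite mem_Yn => /andP[/andP[pl /eqP sl] _].
have dl : (npaths n [::] lam)%:R != 0 :> R by rewrite pnatr_eq0 -lt0n npaths_gt0.
have := hk; rewrite mem_Yn => /andP[pk /eqP sk].
have dk : (npaths n.+1 [::] kap)%:R != 0 :> R by rewrite pnatr_eq0 -lt0n npaths_gt0.
by field; rewrite dl dk.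
Qed.

(** With k = n - m the factor (k + 1)(n + m + zs) of [npaths_up] equals (n + 1)(n + zs) - sigma_m;
    this is how sigma_m enters the discrete picture. *)
Lemma reldim_up n mu lam : is_part mu -> (sumn mu <= n)%N -> lam \in Yn n ->
  \sum_(kap <- Yn n.+1 | subdiag lam kap) zwt kap lam *
    ((npaths n.+1 [::] kap)%:R / (npaths n [::] lam)%:R) * reldim n.+1 mu kap =
  n.+1%:R * (n%:R + zs) * reldim n mu lam + Areldim n mu lam.
Proof.
move=> hm hmn hl; have := hl; rewrite mem_Yn => /andP[pl /eqP sl].
have dl : (npaths n [::] lam)%:R != 0 :> R by rewrite pnatr_eq0 -lt0n npaths_gt0.
transitivity ((\sum_(kap <- Yn n.+1 | subdiag lam kap)
    zwt kap lam * (npaths (n - sumn mu).+1 mu kap)%:R) / (npaths n [::] lam)%:R).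
  rewrite mulr_suml big_seq_cond [RHS]big_seq_cond; apply: eq_bigr => kap.
  rewrite mem_Yn => /andP[/andP[pk /eqP sk] _].
  have dk : (npaths n.+1 [::] kap)%:R != 0 :> R by rewrite pnatr_eq0 -lt0n npaths_gt0.
  by rewrite /reldim subSn //; field; rewrite dl dk.
rewrite (npaths_up hm (erefl _) (subnKC hmn) hl) /Areldim mulrDl addrA; congr (_ + _).
  rewrite /reldim sigmazE -natr1 natrB // natrD -natr1; ring.
rewrite mulr_suml big_seq_cond [RHS]big_seq_cond; apply: eq_bigr => tau.
rewrite mem_Yn => /andP[/andP[pt /eqP st] /andP[m0 _]].
rewrite /reldim st mulrA; congr (_ * (npaths _ _ _)%:R / _); lia.
Qed.

(* The discrete Dirichlet form: one step up followed by one step down is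
   reversible for the z-measure, which makes the left-hand side symmetric. *)
Lemma zE_Areldim n mu nu : is_part mu -> is_part nu -> (sumn mu <= n)%N -> (sumn nu <= n)%N ->
  zE n (fun lam => Areldim n mu lam * reldim n nu lam) =
  n.+1%:R * (n%:R + zs) * (zE n.+1 (fun kap => reldim n.+1 mu kap * reldim n.+1 nu kap)
    - zE n (fun lam => reldim n mu lam * reldim n nu lam)).
Proof.
move=> hm hn hmn hnn.
have s0 : n.+1%:R * (n%:R + zs) != 0.
  by rewrite mulf_neq0 ?pnatr_eq0 // gt_eqF // ltr_wpDl ?zs_gt0.
have -> : zE n.+1 (fun kap => reldim n.+1 mu kap * reldim n.+1 nu kap) =
  \sum_(lam <- Yn n) zm n lam / (n.+1%:R * (n%:R + zs)) * reldim n nu lam *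
     (n.+1%:R * (n%:R + zs) * reldim n mu lam + Areldim n mu lam).
  transitivity (\sum_(kap <- Yn n.+1) \sum_(lam <- Yn n | subdiag lam kap)
     zm n.+1 kap * ((npaths n [::] lam)%:R / (npaths n.+1 [::] kap)%:R) *
     (reldim n.+1 mu kap * reldim n nu lam)).
    rewrite /zE big_seq [RHS]big_seq; apply: eq_bigr => kap hk.
    rewrite (reldim_down hn hnn hk) !mulr_sumr; apply: eq_bigr => lam _; ring.
  rewrite (exchange_big_dep xpredT) //= big_seq [RHS]big_seq; apply: eq_bigr => lam hl.
  rewrite -(reldim_up hm hmn hl) mulr_sumr big_seq_cond [RHS]big_seq_cond.
  apply: eq_bigr => kap /andP[hk hs]; rewrite (zm_cover hl hk hs); ring.
rewrite /zE -sumrB mulr_sumr; apply: eq_bigr => lam _; field.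
by apply/andP; split; [exact: lt0r_neq0 (ltr_wpDl (ler0n _ n) zs_gt0)|rewrite nat1r pnatr_eq0].
Qed.

Lemma zE_sym n mu nu : is_part mu -> is_part nu -> (sumn mu <= n)%N -> (sumn nu <= n)%N ->
  zE n (fun lam => Areldim n mu lam * reldim n nu lam) =
  zE n (fun lam => reldim n mu lam * Areldim n nu lam).
Proof.
move=> hm hn hmn hnn; rewrite zE_Areldim //.
transitivity (zE n (fun lam => Areldim n nu lam * reldim n mu lam)).
  rewrite zE_Areldim //; congr (_ * (_ - _)).
    by apply: eq_bigr => kap _; rewrite [reldim _ nu _ * _]mulrC.
  by apply: eq_bigr => kap _; rewrite [reldim _ nu _ * _]mulrC.
by apply: eq_bigr => lam _; rewrite [reldim _ mu _ * _]mulrC.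
Qed.

Lemma reldim_nil n lam : lam \in Yn n -> reldim n [::] lam = 1.
Proof.
rewrite mem_Yn => /andP[pl /eqP sl]; rewrite /reldim subn0 divff //.
by rewrite pnatr_eq0 -lt0n npaths_gt0.
Qed.

(** For the empty diagram the relative dimension is 1 and [Areldim] is 0, so [zE_Areldim] says that
    the mass is the same at levels n and n + 1. *)
Lemma zE_mass n : zE n (fun _ => 1) = 1.
Proof.
elim: n => [|n IH].
  rewrite /zE; have -> : Yn 0 = [:: [::]].
    have : perm_eq (Yn 0) [:: [::]].
      apply: uniq_perm; rewrite ?Yn_uniq // => y; rewrite mem_Yn inE.
      apply/andP/eqP => [[py /eqP sy]|-> //].
      by apply/nilP; rewrite /nilp -leqn0 -sy is_part_size.
    by move/perm_size; case: (Yn 0) (mem_Yn 0) => [|a [|b s]] // ma _;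
       have := ma [::]; rewrite inE /= => /eqP ->.
  rewrite big_seq1 /zm /wskew !big_ord0 /= !divr1 expr1n mul1r mulr1 //.
apply: etrans IH.
have := @zE_Areldim n [::] [::] isT isT (leq0n n) (leq0n n).
have -> : zE n (fun lam => Areldim n [::] lam * reldim n [::] lam) = 0.
  rewrite /zE big1 // => lam _; rewrite /Areldim sigmazE /= big_pred0 //.
  by rewrite mul0r oppr0 mul0r addr0 mul0r mulr0.
move=> /esym/eqP; rewrite mulf_eq0 mulf_eq0 pnatr_eq0 /= gt_eqF ?ltr_wpDl ?zs_gt0 //= subr_eq0.
have e k : zE k (fun lam => reldim k [::] lam * reldim k [::] lam) = zE k (fun _ => 1).
  rewrite /zE big_seq [RHS]big_seq; apply: eq_bigr => lam hl; by rewrite reldim_nil ?mulr1.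
by rewrite !e => /eqP.
Qed.

End RealParameters.

Lemma limit_of_bounded_mul (K : realType) (u : nat -> K) (I : \bar K) :
  (exists C n0, forall n, (n0 <= n)%N -> `|n%:R * u n| <= C) ->
  ((fun n => (u n)%:E) @ \oo --> I) -> I = 0%E.
Proof.
move=> [C [n0 hC]] uI.
have u0 : u @ \oo --> (0 : K).
  apply/cvgrPdist_lt => e e0; near=> n; rewrite sub0r normrN.
  have n1 : 0 < n%:R :> K by rewrite ltr0n; near: n; exact: nbhs_infty_gt.
  rewrite -(ltr_pM2l n1) -[X in X * `|_|](ger0_norm (ltW n1)) -normrM.
  apply: (@le_lt_trans _ _ C); first by apply: hC; near: n; exact: nbhs_infty_ge.
  have C0 : 0 <= C by apply: le_trans (hC n0 (leqnn _)).
  rewrite -ltr_pdivrMr //; apply: lt_le_trans (archi_boundP _) _; first by rewrite divr_ge0 // ltW.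
  by rewrite ler_nat; near: n; exact: nbhs_infty_ge.
have uE0 : (fun n => (u n)%:E) @ \oo --> 0%E.
  by apply/fine_cvgP; split; [exact: nearW|exact: u0].
by apply: (cvg_unique _ uI uE0).
Unshelve. all: by end_near. Qed.

(** * Passage to the limit and orthogonality *)

Section Orthogonality.
Variables (z z' : C).
Hypothesis adm : admissible z z'.

Lemma zE_add n f g : zE z z' n (fun lam => f lam + g lam) = zE z z' n f + zE z z' n g.
Proof. by rewrite /zE -big_split; apply: eq_bigr => lam _; rewrite mulrDr. Qed.

Lemma zE_scale n c f : zE z z' n (fun lam => c * f lam) = c * zE z z' n f.
Proof. by rewrite /zE mulr_sumr; apply: eq_bigr => lam _; rewrite mulrCA. Qed.

Lemma zE_ext n f g : (forall lam, lam \in Yn n -> f lam = g lam) -> zE z z' n f = zE z z' n g.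
Proof.
by move=> h; rewrite /zE big_seq [RHS]big_seq; apply: eq_bigr => lam hl; rewrite h.
Qed.

Definition zO (a : nat -> seq nat -> R) :=
  exists C n0, forall n, (n0 <= n)%N -> `|n%:R * zE z z' n (a n)| <= C.

Lemma zO_ext a b n0 : (forall n lam, (n0 <= n)%N -> lam \in Yn n -> a n lam = b n lam) ->
  zO a -> zO b.
Proof.
move=> h [C [n1 hC]]; exists C, (maxn n0 n1) => n; rewrite geq_max => /andP[h0 h1].
by rewrite -(zE_ext (fun lam => h n lam h0)) hC.
Qed.

Lemma zO0 : zO (fun _ _ => 0).
Proof.
exists 0, 0%N => n _; rewrite /zE big1 ?mulr0 ?normr0 // => lam _; by rewrite mulr0.
Qed.

Lemma zOD a b : zO a -> zO b -> zO (fun n lam => a n lam + b n lam).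
Proof.
move=> [A [n0 hA]] [B [n1 hB]]; exists (A + B), (maxn n0 n1) => n.
rewrite geq_max => /andP[h0 h1]; rewrite zE_add mulrDr.
by apply: le_trans (ler_normD _ _) _; rewrite lerD ?hA ?hB.
Qed.

Lemma zOZ c a : zO a -> zO (fun n lam => c * a n lam).
Proof.
move=> [A [n0 hA]]; exists (`|c| * A), n0 => n h0.
by rewrite zE_scale mulrCA normrM ler_wpM2l ?hA.
Qed.

Lemma sm_zO a : sm a -> zO a.
Proof.
move=> [C [n0 hC]]; exists C, n0 => n h0; rewrite -zE_scale.
apply: le_trans (ler_norm_sum _ _ _) _.
apply: (@le_trans _ _ (C * zE z z' n (fun _ => 1))); last by rewrite (zE_mass adm) mulr1.
rewrite -zE_scale /zE big_seq [leRHS]big_seq; apply: ler_sum => lam hl.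
by rewrite mulr1 normrM ger0_norm ?(zm_ge0 adm) // ler_wpM2l ?(zm_ge0 adm) // hC.
Qed.

Lemma reldim_bd mu : is_part mu -> bd (fun n lam => reldim n mu lam).
Proof. by move=> hm; apply: bd_close (schur0_bd mu) (reldim_schur0 hm). Qed.

Lemma Areldim_bd mu : is_part mu -> bd (fun n lam => Areldim z z' n mu lam).
Proof.
move=> hm; apply: bdD; first by apply: bdM; [apply: bd_cst|apply: reldim_bd].
have h (tau : seq nat) : bd (fun n lam => if is_part tau then
   wt (zs z z') (ztau z z') mu tau * reldim n tau lam else 0).
  case: (boolP (is_part tau)) => pt; last exact: bd_cst.
  by apply: bdM; [apply: bd_cst|apply: reldim_bd].
have := bd_sum (Yn (sumn mu).-1) (P := fun tau => (0 < sumn mu)%N && subdiag tau mu) (fun tau _ => h tau).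
apply: (@bd_ext _ _ 0) => n lam _ _; rewrite big_seq_cond [RHS]big_seq_cond.
by apply: eq_bigr => tau /andP[/[!mem_Yn] /andP[-> _] _].
Qed.

Lemma Areldim_close mu : is_part mu ->
  sm (fun n lam => Areldim z z' n mu lam - Aschur z z' mu (iota_n n lam)).
Proof.
move=> hm.
have h (tau : seq nat) : sm (fun n lam => if is_part tau then
   wt (zs z z') (ztau z z') mu tau * (reldim n tau lam - schur0 tau (iota_n n lam)) else 0).
  case: (boolP (is_part tau)) => pt; last exact: sm0.
  by apply: smMr; [apply: bd_cst|apply: reldim_schur0].
have h1 := sm_sum (Yn (sumn mu).-1) (P := fun tau => (0 < sumn mu)%N && subdiag tau mu) (fun tau _ => h tau).
have h2 := smMr (bd_cst (- sigmaz z z' (sumn mu))) (reldim_schur0 hm).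
apply: (@sm_ext _ _ 0 _ (smD h2 h1)) => n lam _ _; rewrite (AschurE adm) // /Areldim.
rewrite opprD addrACA -mulrBr; congr (_ + _); rewrite -sumrB big_seq_cond [RHS]big_seq_cond.
by apply: eq_bigr => tau /andP[/[!mem_Yn] /andP[-> _] _]; rewrite mulrBr.
Qed.

Lemma Aschur_bd mu : is_part mu -> bd (fun n lam => Aschur z z' mu (iota_n n lam)).
Proof.
move=> hm; have h := bdB (Areldim_bd hm) (sm_bd (Areldim_close hm)).
by apply: (@bd_ext _ _ 0 _ h) => n lam _ _; rewrite opprB addrC subrK.
Qed.

Lemma schur_sym mu nu : is_part mu -> is_part nu ->
  zO (fun n lam => Aschur z z' mu (iota_n n lam) * schur0 nu (iota_n n lam) -
     schur0 mu (iota_n n lam) * Aschur z z' nu (iota_n n lam)).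
Proof.
move=> hm hn.
(* Each factor is exchanged in turn for its discrete analogue at cost O(1/n); the remaining
   difference has mean zero by [zE_sym]. *)
have a1 := smMl (Areldim_close hm) (reldim_bd hn).
have a2 := smMr (Aschur_bd hm) (reldim_schur0 hn).
have b1 := smMl (reldim_schur0 hm) (Areldim_bd hn).
have b2 := smMr (schur0_bd mu) (Areldim_close hn).
have hs := sm_zO (smB (smD b1 b2) (smD a1 a2)).
have hz : zO (fun n lam => Areldim z z' n mu lam * reldim n nu lam -
   reldim n mu lam * Areldim z z' n nu lam).
  exists 0, (maxn (sumn mu) (sumn nu)) => n; rewrite geq_max => /andP[h1 h2].
  rewrite (zE_add n _ (fun lam => - _)) (zE_sym adm hm hn h1 h2).
  have -> : zE z z' n (fun lam => - (reldim n mu lam * Areldim z z' n nu lam)) =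
     - zE z z' n (fun lam => reldim n mu lam * Areldim z z' n nu lam).
    by rewrite /zE -sumrN; apply: eq_bigr => lam _; rewrite mulrN.
  by rewrite subrr mulr0 normr0.
apply: (@zO_ext _ _ 0 _ (zOD hs hz)) => n lam _ _; ring.
Qed.

Lemma ev_cons x l w : ev (x :: l) w = x.1 * schur0 x.2 w + ev l w.
Proof. by rewrite /ev big_cons. Qed.

Lemma Aev_cons x l w : Aev z z' (x :: l) w = x.1 * Aschur z z' x.2 w + Aev z z' l w.
Proof. by rewrite /Aev big_cons. Qed.

Lemma ev_sym l1 l2 : valid l1 -> valid l2 ->
  zO (fun n lam => Aev z z' l1 (iota_n n lam) * ev l2 (iota_n n lam) -
     ev l1 (iota_n n lam) * Aev z z' l2 (iota_n n lam)).
Proof.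
elim: l1 => [|x l1 IH] v1 v2.
  apply: (@zO_ext _ _ 0 _ zO0) => n lam _ _; by rewrite /ev /Aev !big_nil !mul0r subrr.
case/andP: v1 => px v1; have {}IH := IH v1 v2.
have hx : zO (fun n lam => Aschur z z' x.2 (iota_n n lam) * ev l2 (iota_n n lam) -
     schur0 x.2 (iota_n n lam) * Aev z z' l2 (iota_n n lam)).
  clear IH; elim: l2 v2 => [|y l2 IH2] v2.
    apply: (@zO_ext _ _ 0 _ zO0) => n lam _ _; by rewrite /ev /Aev !big_nil !mulr0 subrr.
  case/andP: v2 => py v2; have {}IH2 := IH2 v2.
  apply: (@zO_ext _ _ 0 _ (zOD (zOZ y.1 (schur_sym px py)) IH2)) => n lam _ _.
  by rewrite ev_cons Aev_cons; ring.
apply: (@zO_ext _ _ 0 _ (zOD (zOZ x.1 hx) IH)) => n lam _ _.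
by rewrite ev_cons Aev_cons; ring.
Qed.

Lemma ev_continuous l : continuous (ev l).
Proof.
apply: (@continuous_sumr R Om) => x _.
apply: (@continuous_mul R Om (fun _ => x.1)); first exact: continuous_cst.
exact: schur0_continuous.
Qed.

Lemma eigsp_orthogonal (P : probability OmB R) l1 l2 f g : is_boundary_zmeasure z z' P ->
  l1 != l2 -> eigsp z z' l1 f -> eigsp z z' l2 g -> (\int[P]_w (f w * g w)%:E = 0)%E.
Proof.
move=> hP ne [lf [vf [-> ef]]] [lg [vg [-> eg]]].
have hc : continuous (fun w => ev lf w * ev lg w).
  by apply: (@continuous_mul R Om); apply: ev_continuous.
have [A [n0 hA]] : zO (fun n lam => ev lf (iota_n n lam) * ev lg (iota_n n lam)).
  apply: (@zO_ext _ _ 0 _ (zOZ (l1 - l2)^-1 (ev_sym vf vg))) => n lam _ _.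
  rewrite ef eg -mulrA [ev lf _ * (l2 * _)]mulrCA -mulrBl mulrA mulVf ?mul1r //.
  by rewrite subr_eq0.
apply: limit_of_bounded_mul (hP _ hc); exists A, n0 => n hn.
apply: le_trans (hA n hn); rewrite le_eqVlt; apply/orP; left; apply/eqP.
congr (`|_ * _|); transitivity (\sum_(lam <- Yn n) complex.Re (zmeas z z' n lam) *
   (ev lf (iota_n n lam) * ev lg (iota_n n lam))).
  rewrite -(@sum_isY _ n (fun _ => true)); apply: eq_bigl => t; by rewrite andbT.
by rewrite /zE big_seq [RHS]big_seq; apply: eq_bigr => lam hl; rewrite (zmeasE adm).
Qed.

End Orthogonality.

(** * The filtration and the eigenspaces *)

Section PieriSchur.

(** [pieri_JT] with c = 0 and E x j = h_(x + j - N); the factor [E 0 N.+1] is h_1 = p_1 = 1. *)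
Lemma schur0_pieri mu w : is_part mu ->
  \sum_(nu <- Yn (sumn mu).+1 | subdiag mu nu) schur0 nu w = schur0 mu w.
Proof.
move=> hm; pose N := sumn mu; pose h := hfun (pcirc ^~ w).
pose E x j : R := if (N <= x + j)%N then h (x + j - N)%N else 0.
have h0 : h 0%N = 1 by [].
have JTE nu : is_part nu -> (sumn nu <= N.+1)%N -> JT E N nu = schur0 nu w.
  move=> hn hs; have hsz : (size nu <= N.+1)%N by apply: leq_trans (is_part_size hn) hs.
  rewrite schur0E /schur_h -(@dt_pad _ (size nu) N.+1) //.
    apply: eq_dt => i j hi _; rewrite /E.
    have -> : (N <= nth 0 nu i + N - i + j)%N = (i <= nth 0 nu i + j)%N by lia.
    by case: ifP => // _; congr h; lia.
  move=> i j hi hj; rewrite nth_default // add0n; have [e|hij] := eqVneq i j.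
    by subst j; rewrite leqnn subnn.
  by rewrite ifF //; lia.
have Er x j : E x.+1 j = E x j.+1 + 0 * E x j by rewrite mul0r addr0 /E addSnnS.
have El j : (j <= N)%N -> E 0 j = (j == N)%:R.
  rewrite /E add0n leq_eqVlt => /orP[/eqP->|hj]; first by rewrite leqnn subnn h0 eqxx.
  by rewrite leqNgt hj ltn_eqF.
have := pieri_JT Er El hm (is_part_size hm); rewrite [X in _ + X]big1 // addr0.
have -> : E 0 N.+1 = 1.
  rewrite /E add0n leqnSn subSnn; have [_ /(_ 0%N)] := hfun_newton (pcirc ^~ w).
  rewrite big_ord1 mul1r => e; rewrite /h e subnn.
  by rewrite {1}/pcirc eqxx mul1r.
rewrite mul1r JTE // => <-; rewrite big_seq_cond [RHS]big_seq_cond; apply: eq_bigr => nu.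
by rewrite mem_Yn => /andP[/andP[pn /eqP sn] _]; rewrite JTE ?sn.
Qed.

Variables (z z' : C).
Hypothesis adm : admissible z z'.
Notation zwt := (wt (zs z z') (ztau z z')).

Lemma sigmaz_succ m : sigmaz z z' m.+1 = sigmaz z z' m + (zs z z' + 2 * m%:R).
Proof. by rewrite !sigmazE -natr1; ring. Qed.

Lemma sigmaz0 : sigmaz z z' 0 = 0.
Proof. by rewrite sigmazE mul0r. Qed.

Lemma sigmaz_lt m k : (m < k)%N -> sigmaz z z' m < sigmaz z z' k.
Proof.
have h j : sigmaz z z' j < sigmaz z z' j.+1.
  by rewrite sigmaz_succ ltrDl ltr_wpDr ?(zs_gt0 adm) // mulr_ge0.
elim: k => // k IH; rewrite ltnS leq_eqVlt => /orP[/eqP->//|/IH h1].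
exact: lt_trans h1 (h k).
Qed.

Lemma sigmaz_inj : injective (sigmaz z z').
Proof.
move=> m k e; case: (ltngtP m k) => // h; have := sigmaz_lt h; by rewrite e ltxx.
Qed.

(** After [commutation] the off-diagonal part is the lower term of A on mu, again by Pieri, and the
    diagonal part zs + 2m makes up for the change from sigma_(m+1) to sigma_m. *)
Lemma Aschur_pieri mu w : is_part mu ->
  \sum_(nu <- Yn (sumn mu).+1 | subdiag mu nu) Aschur z z' nu w = Aschur z z' mu w.
Proof.
move=> hm; set m := sumn mu.
transitivity (\sum_(nu <- Yn m.+1 | subdiag mu nu) (- sigmaz z z' m.+1 * schur0 nu w +
   \sum_(tau <- Yn m | subdiag tau nu) zwt nu tau * schur0 tau w)).
  rewrite big_seq_cond [RHS]big_seq_cond; apply: eq_bigr => nu.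
  by rewrite mem_Yn => /andP[/andP[pn /eqP sn] _]; rewrite (AschurE adm) // sn.
rewrite big_split /= -mulr_sumr schur0_pieri // (AschurE adm) // -/m.
rewrite (exchange_big_dep xpredT) //=.
transitivity (- sigmaz z z' m.+1 * schur0 mu w + \sum_(tau <- Yn m)
   ((\sum_(r <- Yn m.-1 | (0 < m)%N && (subdiag r mu && subdiag r tau)) zwt mu r) * schur0 tau w +
    (if mu == tau then zs z z' + 2 * m%:R else 0) * schur0 tau w)).
  congr (_ + _); rewrite big_seq [RHS]big_seq; apply: eq_bigr => tau.
  rewrite mem_Yn => /andP[pt /eqP st].
  by rewrite -mulrDl -(commutation (zs z z') (ztau z z') hm pt (erefl _) st) mulr_suml.
rewrite big_split /= [X in _ + (_ + X)](bigD1_seq mu) ?Yn_uniq ?mem_Yn ?hm ?eqxx //=.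
rewrite [X in _ + (_ + (_ + X))]big1 ?addr0; last first.
  by move=> tau /negPf ht; rewrite eq_sym ht mul0r.
under eq_bigr do rewrite mulr_suml.
rewrite (exchange_big_dep (fun r => (0 < m)%N && subdiag r mu)) /=; last first.
  by move=> tau r _ /and3P[-> ->].
rewrite addrCA addrC sigmaz_succ; congr (_ + _); first by ring.
rewrite big_seq_cond [RHS]big_seq_cond; apply: eq_bigr => r.
rewrite mem_Yn => /andP[/andP[pr /eqP sr] /andP[m0 hr]].
rewrite -(schur0_pieri w pr) sr prednK // mulr_sumr; apply: eq_bigl => tau.
by rewrite m0 hr.
Qed.
End PieriSchur.

Section PartitionCount.
Local Open Scope nat_scope.

Lemma npart_no1E m : npart_no1 m = \sum_(lam <- Yn m | 1 \notin lam) 1.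
Proof.
rewrite /npart_no1 -sum1_card -(@sum_isY _ m (fun lam => 1 \notin lam) (fun _ => 1)).
apply: eq_bigl => t; rewrite !inE; congr (_ && _).
apply/allP/idP => [h|/negP h x hx].
  by apply/negP; rewrite /tup_rows mem_filter => /andP[_ /h].
by apply/eqP => x1; apply: h; rewrite /tup_rows mem_filter -x1 hx x1.
Qed.

(** Appending a row of length 1 maps Y_m bijectively onto the diagrams of Y_(m+1) that have a part
    1. *)
Lemma size_Yn_succ m : size (Yn m.+1) = size (Yn m) + npart_no1 m.+1.
Proof.
rewrite npart_no1E -sum1_size (bigID (fun lam : seq nat => 1 \in lam)) /=; congr (_ + _).
rewrite -sum1_size -big_filter.
rewrite -[RHS](big_map (fun nu => incr_nth nu (size nu)) xpredT (fun _ => 1)).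
apply: perm_big; apply: uniq_perm.
- exact/filter_uniq/Yn_uniq.
- rewrite map_inj_in_uniq ?Yn_uniq // => nu nu'; rewrite !mem_Yn => /andP[p _] /andP[p' _] e.
  have es : size nu = size nu'.
    by have := congr1 size e; rewrite !size_incr_nth !ltnn => -[].
  apply: is_part_ext => // j; have := congr1 (fun s => nth 0 s j) e.
  by rewrite !nth_incr_nth es => /addnI.
move=> mu; rewrite mem_filter mem_Yn; apply/and3P/mapP.
  case=> m1 pm /eqP sm'.
  pose i := (size mu).-1; have sz : 0 < size mu by case: (mu) m1.
  have iS : i.+1 = size mu by rewrite prednK.
  have mi : nth 0 mu i = 1.
    have h0 : 0 < nth 0 mu i by rewrite is_part_gt0 // iS.
    have hk : nth 0 mu (index 1 mu) = 1 by rewrite nth_index.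
    have : nth 0 mu i <= 1.
      rewrite -hk; apply: is_part_nonincr => //; have := m1; rewrite -index_mem; lia.
    lia.
  have hi : nth 0 mu i.+1 < nth 0 mu i by rewrite mi nth_default // iS.
  have [p n e] := decr_ok pm hi; exists (decr mu i).
    by rewrite mem_Yn p -eqSS -(sumn_incr _ i) e sm' eqxx.
  have -> // : size (decr mu i) = i.
  apply/eqP; rewrite eqn_leq; apply/andP; split.
    by rewrite leqNgt -(is_part_gt0 _ p) n mi eqxx.
  case: (posnP i) => [->//|i0]; suff : i.-1 < size (decr mu i) by lia.
  rewrite -(is_part_gt0 _ p) n; have := is_part_nonincr pm (leq_pred i); rewrite mi.
  have -> : (i == i.-1) = false by lia.
  by rewrite subn0.
case=> nu; rewrite mem_Yn => /andP[pn /eqP sn] ->; split.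
- by apply/(nthP 0); exists (size nu); rewrite ?size_incr_nth ?ltnn // nth_incr_nth eqxx nth_default.
- apply: is_part_incr => //; case: (posnP (size nu)) => //= h.
  by rewrite [nth 0 nu (size nu)]nth_default // is_part_gt0 // prednK.
- by rewrite sumn_incr sn.
Qed.

Lemma npart_no1_gt0 m : 2 <= m -> 0 < npart_no1 m.
Proof.
move=> hm; rewrite npart_no1E -big_filter sum1_size -has_predT.
apply/hasP; exists [:: m] => //; rewrite mem_filter mem_Yn /= inE /is_part /=.
by rewrite addn0 eqxx andbT; lia.
Qed.

Lemma size_Yn0 : size (Yn 0) = 1.
Proof.
have : perm_eq (Yn 0) [:: [::]].
  apply: uniq_perm; rewrite ?Yn_uniq // => y; rewrite mem_Yn inE.
  apply/andP/eqP => [[py /eqP sy]|-> //].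
  by apply/nilP; rewrite /nilp -leqn0 -sy is_part_size.
by move/perm_size.
Qed.

Lemma size_Yn1 : size (Yn 1) = 1.
Proof.
rewrite size_Yn_succ size_Yn0 npart_no1E big_seq_cond big_pred0 // => y.
rewrite mem_Yn; apply/negP => /andP[/andP[py /eqP sy] /negP]; apply.
case: y py sy => // a y py sy; have := is_part_gt0 0 py; rewrite /= => a0.
have -> : a = 1 by move: sy => /=; lia.
by rewrite inE eqxx.
Qed.

End PartitionCount.

(** * Matrices of the operator on the levels of the filtration *)

Section Levels.
Variables (z z' : C).
Hypothesis adm : admissible z z'.
Notation zwt := (wt (zs z z') (ztau z z')).
Notation sg := (sigmaz z z').
Notation p M := (size (Yn M)).

Definition part M (i : 'I_(p M)) : seq nat := nth [::] (Yn M) i.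

Lemma part_in M (i : 'I_(p M)) : part i \in Yn M.
Proof. exact: mem_nth. Qed.

Lemma is_part_part M (i : 'I_(p M)) : is_part (part i).
Proof. by have := part_in i; rewrite mem_Yn => /andP[]. Qed.

Lemma sumn_part M (i : 'I_(p M)) : sumn (part i) = M.
Proof. by have := part_in i; rewrite mem_Yn => /andP[_ /eqP]. Qed.

Lemma sum_part M (P : pred (seq nat)) (F : seq nat -> R) :
  \sum_(i < p M) (if P (part i) then F (part i) else 0) = \sum_(mu <- Yn M | P mu) F mu.
Proof. by rewrite [RHS]big_mkcond (big_nth [::]) big_mkord. Qed.

(** Coordinates on level M. By [evv_inj] each function has one coefficient vector there, so matrix
    identities can be verified on functions. *)
Definition evv M (v : 'rV[R]_(p M)) (w : Om) := \sum_i v 0 i * schur0 (part i) w.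
Definition Aevv M (v : 'rV[R]_(p M)) (w : Om) := \sum_i v 0 i * Aschur z z' (part i) w.

Lemma evvD M (u v : 'rV[R]_(p M)) w : evv (u + v) w = evv u w + evv v w.
Proof. by rewrite /evv -big_split; apply: eq_bigr => i _; rewrite mxE mulrDl. Qed.

Lemma evvZ M a (v : 'rV[R]_(p M)) w : evv (a *: v) w = a * evv v w.
Proof. by rewrite /evv mulr_sumr; apply: eq_bigr => i _; rewrite mxE mulrA. Qed.

Lemma evv0 M w : evv (0 : 'rV[R]_(p M)) w = 0.
Proof. by rewrite -(scale0r 0) evvZ mul0r. Qed.

Lemma AevvD M (u v : 'rV[R]_(p M)) w : Aevv (u + v) w = Aevv u w + Aevv v w.
Proof. by rewrite /Aevv -big_split; apply: eq_bigr => i _; rewrite mxE mulrDl. Qed.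

Lemma AevvZ M a (v : 'rV[R]_(p M)) w : Aevv (a *: v) w = a * Aevv v w.
Proof. by rewrite /Aevv mulr_sumr; apply: eq_bigr => i _; rewrite mxE mulrA. Qed.

Lemma evv_inj M (u v : 'rV[R]_(p M)) : (forall w, evv u w = evv v w) -> u = v.
Proof.
move=> h; apply/eqP; rewrite -subr_eq0; apply/eqP/rowP => i; rewrite [RHS]mxE.
pose c mu := if insub (index mu (Yn M)) is Some k then (u - v) 0 k else 0.
have cE k : c (part k) = (u - v) 0 k.
  by rewrite /c /part index_uniq ?Yn_uniq // valK.
rewrite -cE; apply: (@schur0_independent M c) (part_in i) => w.
rewrite -(@sum_part M xpredT (fun mu => c mu * schur0 mu w)).
transitivity (evv (u - v) w); first by apply: eq_bigr => k _; rewrite cE.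
by rewrite evvD -scaleN1r evvZ h mulN1r subrr.
Qed.

Lemma sum_mulmx M N (F : seq nat -> R) (v : 'rV[R]_(p M)) (A : 'M[R]_(p M, p N)) :
  \sum_k (v *m A) 0 k * F (part k) = \sum_i v 0 i * (\sum_k A i k * F (part k)).
Proof.
under eq_bigr do rewrite mxE mulr_suml.
rewrite exchange_big; apply: eq_bigr => i _; rewrite mulr_sumr.
by apply: eq_bigr => k _; rewrite mulrA.
Qed.

(* Pieri's rule embeds the span of the Schur functions of level M into that of level
   M + 1; [opT M] is the matrix of A on level M. *)
Definition upJ M : 'M[R]_(p M, p M.+1) :=
  \matrix_(i, k) (subdiag (part i) (part k))%:R.
Definition dnB M : 'M[R]_(p M.+1, p M) :=
  \matrix_(k, i) (if subdiag (part i) (part k) then zwt (part k) (part i) else 0).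

Lemma evv_up M (v : 'rV[R]_(p M)) w : evv (v *m upJ M) w = evv v w.
Proof.
rewrite /evv (sum_mulmx (schur0 ^~ w)); apply: eq_bigr => i _; congr (_ * _).
rewrite -[RHS]schur0_pieri ?is_part_part // sumn_part -sum_part; apply: eq_bigr => k _.
by rewrite mxE; case: ifP => _; rewrite ?mul1r ?mul0r.
Qed.

Lemma Aevv_up M (v : 'rV[R]_(p M)) w : Aevv (v *m upJ M) w = Aevv v w.
Proof.
rewrite /Aevv (sum_mulmx (Aschur z z' ^~ w)); apply: eq_bigr => i _; congr (_ * _).
rewrite -[RHS](Aschur_pieri adm) ?is_part_part // sumn_part -sum_part.
by apply: eq_bigr => k _; rewrite mxE; case: ifP => _; rewrite ?mul1r ?mul0r.
Qed.

Lemma Aevv_succ M (v : 'rV[R]_(p M.+1)) w :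
  Aevv v w = - sg M.+1 * evv v w + evv (v *m dnB M) w.
Proof.
rewrite /evv (sum_mulmx (schur0 ^~ w)) mulr_sumr -big_split; apply: eq_bigr => k _.
rewrite (AschurE adm) ?is_part_part // sumn_part mulrDr mulrCA; congr (_ + _ * _).
rewrite /= -sum_part; apply: eq_bigr => i _; rewrite mxE.
by case: ifP => _ //; rewrite mul0r.
Qed.

Definition opT M : 'M[R]_(p M) :=
  if M is M'.+1 then (- sg M'.+1)%:M + dnB M' *m upJ M' else 0.

Lemma mul_opT M (v : 'rV[R]_(p M.+1)) :
  v *m opT M.+1 = - sg M.+1 *: v + v *m dnB M *m upJ M.
Proof. by rewrite mulmxDr mul_mx_scalar mulmxA. Qed.

Lemma AevvT M (v : 'rV[R]_(p M)) w : Aevv v w = evv (v *m opT M) w.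
Proof.
case: M v => [|M] v; last first.
  by rewrite Aevv_succ mul_opT evvD evvZ evv_up.
rewrite mulmx0 evv0 /Aevv big1 // => i _; rewrite (AschurE adm) ?is_part_part // sumn_part.
by rewrite sigmaz0 // oppr0 mul0r add0r big_pred0 ?mulr0.
Qed.

Lemma upJ_inj M (u v : 'rV[R]_(p M)) : u *m upJ M = v *m upJ M -> u = v.
Proof. by move=> h; apply: evv_inj => w; rewrite -evv_up h evv_up. Qed.

Lemma upJ_free M : row_free (upJ M).
Proof. by apply: inj_row_free => v h; apply: upJ_inj; rewrite h mul0mx. Qed.

Lemma upJ_opT M : upJ M *m opT M.+1 = opT M *m upJ M.
Proof.
apply/row_matrixP => i; rewrite !rowE !mulmxA; apply: evv_inj => w.
by rewrite -AevvT Aevv_up evv_up AevvT.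
Qed.

(** Obtained by cancelling the injective [upJ] in [upJ_opT]. Since sigma_(M+1) differs from all
    lower sigma_k, the product is invertible; level M + 1 then splits into the kernel of [dnB] and
    the image of [upJ]. *)
Lemma upJ_dnB M : upJ M *m dnB M = opT M + (sg M.+1)%:M.
Proof.
apply: (row_free_injr (upJ_free M)); rewrite /= mulmxDl -upJ_opT /= mulmxDr.
by rewrite mul_mx_scalar mul_scalar_mx mulmxA scaleNr addrAC addNr add0r.
Qed.

(** Applying [dnB] to the equation shows that [v *m dnB M] solves it one level down, so it vanishes
    by induction; then (sigma_(M+1) - c) v = 0. *)
Lemma opT_shift_inj M c (v : 'rV[R]_(p M)) :
  (forall k, (k <= M)%N -> c != sg k) -> v *m (opT M + c%:M) = 0 -> v = 0.
Proof.
elim: M c v => [|M IH] c v hc.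
  rewrite add0r mul_mx_scalar => /eqP; rewrite scaler_eq0 => /orP[|/eqP//].
  by have := hc 0%N isT; rewrite sigmaz0 // => /negPf->.
have hn := hc M.+1 (leqnn _).
rewrite mulmxDr mul_mx_scalar mul_opT => h.
have hu : v *m dnB M *m upJ M = (sg M.+1 - c) *: v.
  apply/eqP; rewrite -subr_eq0 -h scalerBl opprB scaleNr.
  by rewrite [c *: v - _]addrC addrCA addrA.
suff u0 : v *m dnB M = 0.
  move: hu; rewrite u0 mul0mx => /esym/eqP; rewrite scaler_eq0 => /orP[|/eqP//].
  by rewrite subr_eq0 eq_sym (negPf hn).
apply: (IH c) => [k hk|]; first exact/hc/leqW.
have := congr1 (mulmxr (dnB M)) hu; rewrite /= -[_ *m _ *m dnB M]mulmxA upJ_dnB -scalemxAl.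
rewrite !mulmxDr !mul_mx_scalar => hB; apply/eqP.
by rewrite addr_eq0 -(inj_eq (addIr (sg M.+1 *: (v *m dnB M)))) hB scalerBl addrC.
Qed.

Lemma upJ_dnB_unit M : upJ M *m dnB M \in unitmx.
Proof.
rewrite -row_free_unit; apply: inj_row_free => v; rewrite upJ_dnB.
by apply: opT_shift_inj => k hk; apply/eqP => /(sigmaz_inj adm) e; move: hk; rewrite -e ltnn.
Qed.

Lemma rank_dnB M : \rank (dnB M) = p M.
Proof.
apply/eqP; rewrite eqn_leq rank_leq_col -{1}(mxrank_unit (upJ_dnB_unit M)).
exact: mxrankM_maxr.
Qed.

Lemma eigsp_evv M c (v : 'rV[R]_(p M)) : v *m opT M = c *: v -> eigsp z z' c (evv v).
Proof.
move=> h; exists [seq (v 0 i, part i) | i <- enum 'I_(p M)]; split; [|split].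
- by rewrite /valid all_map; apply/allP => i _; apply: is_part_part.
- by apply/funext => w; rewrite /ev big_map big_enum.
by apply/funext => w; rewrite /Aev big_map big_enum /= -evvZ -h -AevvT.
Qed.

Lemma schur_lift0 mu : is_part mu -> exists v : 'rV[R]_(p (sumn mu)),
  forall w, evv v w = schur0 mu w /\ Aevv v w = Aschur z z' mu w.
Proof.
move=> hm; have hin : mu \in Yn (sumn mu) by rewrite mem_Yn hm eqxx.
have hi : (index mu (Yn (sumn mu)) < p (sumn mu))%N by rewrite index_mem.
exists (delta_mx 0 (Ordinal hi)) => w.
have e : part (Ordinal hi) = mu by rewrite /part nth_index.
have h (F : seq nat -> R) : \sum_i delta_mx (0 : 'I_1) (Ordinal hi) 0 i * F (part i) = F mu.
  rewrite (bigD1 (Ordinal hi)) //= mxE !eqxx mul1r e big1 ?addr0 // => i /negPf hne.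
  by rewrite mxE hne andbF mul0r.
by split; [apply: (h (schur0 ^~ w))|apply: (h (Aschur z z' ^~ w))].
Qed.

Lemma schur_lift mu M : is_part mu -> (sumn mu <= M)%N -> exists v : 'rV[R]_(p M),
  forall w, evv v w = schur0 mu w /\ Aevv v w = Aschur z z' mu w.
Proof.
move=> hm /subnK <-; elim: (M - sumn mu)%N => [|n [v hv]]; first exact: schur_lift0.
by exists (v *m upJ _) => w; rewrite evv_up Aevv_up.
Qed.

Lemma valid_lift l : valid l -> exists M (v : 'rV[R]_(p M)),
  forall w, evv v w = ev l w /\ Aevv v w = Aev z z' l w.
Proof.
suff h : valid l -> exists M0, forall M, (M0 <= M)%N -> exists v : 'rV[R]_(p M),
    forall w, evv v w = ev l w /\ Aevv v w = Aev z z' l w.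
  by move=> /h[M hM]; exists M; apply: hM.
elim: l => [|x l IH] => [_|/andP[px /IH[M0 hM0]]].
  exists 0%N => M _; exists 0 => w; rewrite evv0 -(scale0r 0) AevvZ mul0r /ev /Aev.
  by rewrite !big_nil.
exists (maxn (sumn x.2) M0) => M; rewrite geq_max => /andP[h1 /hM0[v hv]].
have [u hu] := schur_lift px h1; exists (x.1 *: u + v) => w.
rewrite evvD evvZ AevvD AevvZ ev_cons Aev_cons.
by case: (hu w) => -> ->; case: (hv w) => -> ->.
Qed.

Lemma eigspP c f : eigsp z z' c f ->
  exists M (v : 'rV[R]_(p M)), f = evv v /\ v *m opT M = c *: v.
Proof.
move=> [l [vl [-> hA]]]; have [M [v hv]] := valid_lift vl; exists M, v; split.
  by apply/funext => w; case: (hv w).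
apply: evv_inj => w; rewrite -AevvT evvZ; case: (hv w) => -> ->.
by rewrite hA.
Qed.

Lemma evv_decomp M (v : 'rV[R]_(p M)) : exists g : nat -> Om -> R,
  (forall k, (k <= M)%N -> eigsp z z' (- sg k) (g k)) /\
  (forall w, evv v w = \sum_(k < M.+1) g k w).
Proof.
elim: M v => [|M IH] v.
  exists (fun _ => evv v); split => [k|w]; last by rewrite big_ord1.
  rewrite leqn0 => /eqP->; apply: eigsp_evv.
  by rewrite mulmx0 sigmaz0 // oppr0 scale0r.
(* u is the vector of level M whose lift has the same image as v under [dnB]; the difference e is
   killed by [dnB] and is an eigenvector for [- sg M.+1]. *)
pose u := v *m dnB M *m invmx (upJ M *m dnB M).
have [g [hg hv]] := IH u; pose e := v - u *m upJ M.
have eB : e *m dnB M = 0.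
  by rewrite mulmxBl -[_ *m dnB M as X in _ - X]mulmxA /u mulmxKV ?upJ_dnB_unit // subrr.
exists (fun k => if k == M.+1 then evv e else g k); split => [k|w].
  rewrite leq_eqVlt; case: eqP => [-> _|_ /= hk]; last exact: hg.
  by apply: eigsp_evv; rewrite mul_opT eB mul0mx addr0.
rewrite big_ord_recr /= eqxx -[v](subrK (u *m upJ M)) evvD evv_up hv addrC; congr (_ + _).
by apply: eq_bigr => k _; rewrite ltn_eqF.
Qed.

(* An eigenvector of level M not killed by the down map comes from level M - 1;
   at level 1 this always happens because there is a single diagram at levels 0 and 1. *)
Lemma eigen_level M c (v : 'rV[R]_(p M)) : v *m opT M = c *: v -> v != 0 ->
  exists m (u : 'rV[R]_(p m)),
    [/\ m != 1%N, c = - sg m, evv v = evv u & u *m opT m = c *: u].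
Proof.
elim: M v => [|M IH] v hv v0.
  exists 0%N, v; split=> //; move/eqP: hv; rewrite mulmx0 eq_sym scaler_eq0 (negPf v0) orbF.
  by move/eqP=> ->; rewrite sigmaz0 // oppr0.
have descend u : v = u *m upJ M -> exists m (u : 'rV[R]_(p m)),
    [/\ m != 1%N, c = - sg m, evv v = evv u & u *m opT m = c *: u].
  move=> vE; have hu : u *m opT M = c *: u.
    by apply: upJ_inj; rewrite -mulmxA -upJ_opT mulmxA -vE hv vE scalemxAl.
  have u0 : u != 0 by apply: contraNneq v0 => u0; rewrite vE u0 mul0mx.
  have [m [x [h1 h2 h3 h4]]] := IH u hu u0; exists m, x; split=> //.
  by rewrite -h3 vE; apply/funext => w; rewrite evv_up.
have [hc|hc] := eqVneq c (- sg M.+1).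
  case: M v IH hv v0 descend hc => [|M] v IH hv v0 descend hc; last by exists M.+2, v.
  apply: (descend (v *m pinvmx (upJ 0))); rewrite mulmxKpV // submx_full //.
  by rewrite /row_full (eqP (upJ_free 0)) size_Yn0 size_Yn1.
(* The eigenvalue equation reads v dnB upJ = (c + sigma) v with c + sigma nonzero, which exhibits v
   as a lift. *)
have hs : c + sg M.+1 != 0 by rewrite addr_eq0.
apply: (descend ((c + sg M.+1)^-1 *: (v *m dnB M))).
rewrite -scalemxAl; have -> : v *m dnB M *m upJ M = (c + sg M.+1) *: v.
  by rewrite scalerDl -hv mul_opT scaleNr addrAC addNr add0r.
by rewrite scalerA mulVf ?scale1r.
Qed.

Lemma eigspE m : m != 1%N ->
  eigsp z z' (- sg m) = [set f | exists2 v : 'rV[R]_(p m),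
    (v <= kermx (opT m + (sg m)%:M))%MS & f = evv v].
Proof.
move=> m1; have hk (u : 'rV[R]_(p m)) :
    (u <= kermx (opT m + (sg m)%:M))%MS = (u *m opT m == - sg m *: u).
  by rewrite sub_kermx mulmxDr mul_mx_scalar addr_eq0 scaleNr.
apply/seteqP; split=> f /=; last by move=> [v]; rewrite hk => /eqP hv ->; apply: eigsp_evv.
move=> /eigspP[M [v [-> hv]]]; have [->|v0] := eqVneq v 0.
  by exists 0; [exact: sub0mx|apply/funext => w; rewrite !evv0].
have [k [u [_ /oppr_inj /(sigmaz_inj adm) e -> hu]]] := eigen_level hv v0.
by subst k; exists u => //; rewrite hk hu.
Qed.

Lemma has_dim_evv m k (K : 'M[R]_(k, p m)) :
  has_dim [set f | exists2 v : 'rV[R]_(p m), (v <= K)%MS & f = evv v] (\rank K).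
Proof.
have comb (c : 'I_(\rank K) -> R) : (fun w => \sum_i c i * evv (row i (row_base K)) w) =
    evv ((\row_i c i) *m row_base K).
  apply/funext => w; rewrite mulmx_sum_row.
  rewrite (big_morph (fun v => evv v w) (fun u v => evvD u v w) (evv0 m w)).
  by apply: eq_bigr => i _; rewrite evvZ mxE.
exists (fun i => evv (row i (row_base K))); split=> [c|].
  rewrite comb => h i.
  have h0 : (\row_i c i) *m row_base K = 0.
    by apply: evv_inj => w; rewrite h evv0.
  have : \row_i c i = 0.
    by apply: (row_free_injr (row_base_free K)); rewrite /= h0 mul0mx.
  by move/rowP/(_ i); rewrite !mxE.
apply/seteqP; split=> f /=.
  move=> [v]; rewrite -(eq_row_base K) => /submxP[D ->] ->; exists (D 0).
  by rewrite comb; congr (evv (_ *m _)); apply/rowP => i; rewrite mxE.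
move=> [c ->]; rewrite comb; exists ((\row_i c i) *m row_base K) => //.
by rewrite -(eq_row_base K) submxMl.
Qed.

Lemma has_dim_eigsp0 : has_dim (eigsp z z' 0) 1.
Proof.
have -> : (0 : R) = - sg 0 by rewrite sigmaz0 // oppr0.
rewrite eigspE //; set K := kermx _; suff e : \rank K = 1%N.
  by rewrite -[X in has_dim _ X]e; exact: has_dim_evv.
by rewrite /K add0r sigmaz0 // raddf0 mxrank_ker mxrank0 subn0 size_Yn0.
Qed.

Lemma has_dim_eigsp m : (2 <= m)%N -> has_dim (eigsp z z' (- sg m)) (npart_no1 m).
Proof.
case: m => // m hm; rewrite eigspE; last by case: m hm.
set K := kermx _; have <- : \rank K = npart_no1 m.+1; last exact: has_dim_evv.
(* Here A + sigma is [dnB *m upJ] with [upJ] injective, so the kernel is that of [dnB], which has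
   full rank. *)
rewrite /K /= raddfN /= addrAC addNr add0r mxrank_ker mxrankMfree ?upJ_free //.
by rewrite rank_dnB size_Yn_succ addKn.
Qed.

Lemma eigsp_spectrum c d : (0 < d)%N -> has_dim (eigsp z z' c) d -> spectrum z z' c.
Proof.
case: d => // d _ [g [hfree hE]]; exists (g ord0); split.
  rewrite hE; exists (fun i => (i == ord0)%:R); apply/funext => w.
  rewrite (bigD1 ord0) //= mul1r big1 ?addr0 // => i /negPf->; exact: mul0r.
move=> g0; have := hfree (fun i => (i == ord0)%:R).
have -> : (fun w => \sum_(i < d.+1) (i == ord0)%:R * g i w) = (fun=> 0).
  apply/funext => w; rewrite (bigD1 ord0) //= mul1r g0 big1 ?addr0 // => i /negPf->.
  exact: mul0r.
by move=> /(_ erefl ord0) /eqP; rewrite eqxx oner_eq0.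
Qed.

Lemma spectrumE : spectrum z z' = [set 0] `|` [set - sg m | m in [set m | (2 <= m)%N]].
Proof.
apply/seteqP; split=> c /=.
  move=> [f [/eigspP[M [v [-> hv]]] f0]]; have v0 : v != 0.
    by apply/eqP => v0; apply: f0; apply/funext => w; rewrite v0 evv0.
  have [m [u [m1 -> _ _]]] := eigen_level hv v0.
  case: m u m1 => [|[|m]] // _ _; last by right; exists m.+2.
  by left; rewrite sigmaz0 // oppr0.
move=> [->|[m hm <-]]; first exact: eigsp_spectrum has_dim_eigsp0.
exact: eigsp_spectrum (npart_no1_gt0 hm) (has_dim_eigsp hm).
Qed.

Lemma Lam0_decomp f : Lam0 f ->
  exists (k : nat) (lam : 'I_k -> R) (g : 'I_k -> Om -> R),
    (forall i, eigsp z z' (lam i) (g i)) /\ f = (fun w => \sum_(i < k) g i w).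
Proof.
move=> [l [vl ->]]; have [M [v hv]] := valid_lift vl; have [g [hg he]] := evv_decomp v.
exists M.+1, (fun i => - sg i), (fun i => g i); split => [i|].
  by apply: hg; rewrite -ltnS.
by apply/funext => w; rewrite -he; case: (hv w).
Qed.

End Levels.

Theorem theorem7p2 (z z' : C) (P : probability OmB R) :
  admissible z z' ->
  is_boundary_zmeasure z z' P ->
  (* (1) Lambda^circ is the (algebraic) sum of the eigenspaces of A_{z,z'}
         (eigenspaces of a linear operator for distinct eigenvalues are
         independent, so the sum is direct) ... *)
  (forall f, Lam0 f ->
     exists (k : nat) (lam : 'I_k -> R) (g : 'I_k -> Om -> R),
       (forall i, eigsp z z' (lam i) (g i)) /\
       f = (fun w => \sum_(i < k) g i w)) /\
  (* ... and the eigenspaces are mutually orthogonal in L^2(P_{z,z'}) *)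
  (forall (l1 l2 : R) (f g : Om -> R), l1 != l2 ->
     eigsp z z' l1 f -> eigsp z z' l2 g ->
     (\int[P]_w (f w * g w)%:E = 0)%E) /\
  (* (2) the spectrum is {0} U {-sigma_m : m = 2, 3, ...} *)
  spectrum z z' = [set 0] `|` [set - sigmaz z z' m | m in [set m | (2 <= m)%N]] /\
  (* (3) multiplicities *)
  has_dim (eigsp z z' 0) 1 /\
  (forall m : nat, (2 <= m)%N -> has_dim (eigsp z z' (- sigmaz z z' m)) (npart_no1 m)).
Proof.
move=> adm hP; split; first exact: Lam0_decomp.
split; first by move=> l1 l2 f g ne; exact: (eigsp_orthogonal adm hP ne).
split; first exact: spectrumE.
split; [exact: has_dim_eigsp0|exact: has_dim_eigsp].
Qed.
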